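(* Let $1<p<Q$, let $F\in(L^m(\Omega))^d$ with $p'\leq m<\frac{Q}{p-1}$, and let $u\in W^{1,p}_0(\Omega,X)$ be a weak solution to $$X^*a(x,u,Xu)=X^*F(x)\ \text{ in }\Omega,\qquad u=0\ \text{ on }\partial\Omega.$$ Then $u\in L^q(\Omega)$ with $$q=[m(p-1)]^*=\frac{m(p-1)Q}{Q-m(p-1)},$$ and there exists a constant $C=C(Q,p,\Omega,\alpha,m,X)$ such that $$\|u\|_{L^q(\Omega)}\leq C\,\|F\|_{L^m(\Omega)}^{\frac1{p-1}}.$$
   Context: Setting. $\Omega$ is a bounded open subset of $\mathbb{R}^N$, $N\geq2$. $X=\{X_1,\dots,X_d\}$, $d\geq2$, is a family of locally Lipschitz-continuous vector fields on $\mathbb{R}^N$, $X_j=(c_{j1},\dots,c_{jN})$, identified with the operators $X_j=\sum_{k=1}^N c_{jk}\partial_{x_k}$. For a $C^1$ function $u$, the $X$-gradient is $Xu=(X_1u,\dots,X_du)=C(x)\nabla u$ with $C(x)=(c_{jk}(x))$. Geometric standing assumptions. An absolutely continuous path $\gamma:[0,T]\to\mathbb{R}^N$ is $X$-subunit if $\dot\gamma(t)=\sum_{j=1}^d\theta_j(t)X_j(\gamma(t))$ with $\sum_{j=1}^d\theta_j^2(t)\leq1$ for a.e. $t\in[0,T]$. Any two points are assumed to be connected by an $X$-subunit path, and the Carnot–Carathéodory (control) distance $\delta(x,y)$ is the infimum of the $T>0$ for which there is an $X$-subunit path $\gamma:[0,T]\to\mathbb{R}^N$ with $\gamma(0)=x$,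 $\gamma(T)=y$. $B_r$ denotes a $\delta$-ball of radius $r$; $B_{\lambda r}$ is the concentric ball of radius $\lambda r$; $|E|$ is the Lebesgue measure of $E$. It is assumed that: (1) $|y-x|\to0$ if and only if $\delta(x,y)\to0$; (2) (doubling) there is a constant $Q$, which is fixed and taken $>2$ (as one may, without loss of generality), such that $0<|B_{2r}|\leq2^Q|B_r|$ for every $\delta$-ball $B_r$; (3) (Poincaré) there are constants $C_P,\nu>0$ such that for every $\delta$-ball $B_r$ and every $u\in C^1(\overline{B_{\nu r}})$, $\frac1{|B_r|}\int_{B_r}|u-u_r|\,dx\leq C_P\,r\,\frac{1}{|B_{\nu r}|}\int_{B_{\nu r}}|Xu|\,dx$, where $u_r=\frac1{|B_r|}\int_{B_r}u\,dx$. Function space. $W^{1,p}_0(\Omega,X)$ is the closure of $C_c^\infty(\Omega)$ under the norm $\|u\|_{W^{1,p}_0(\Omega,X)}=\|Xu\|_{L^p(\Omega)}$; for $u$ in this space, $Xu\in (L^p(\Omega))^d$ is the $L^p$-limit of $X\varphi_n$ for any sequence $\varphi_n\in C_c^\infty(\Omega)$ converging to $u$. $X^*$ is the formal adjoint: $\langle X^*F,\varphi\rangle=\int_\Omega F\cdot X\varphi\,dx$. $p'=p/(p-1)$. For $1\leq t<Q$, $t^*=\frac{tQ}{Q-t}$. Operator. $a:\Omega\times\mathbb{R}\times\mathbb{R}^d\to\mathbb{R}^d$ is a Carathéodory function (measurable in $x$, continuous in $(s,\xi)$ for a.e. $x$) such that for a.e. $x\in\Omega$, every $s\in\mathbb{R}$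 and every $\xi\neq\eta\in\mathbb{R}^d$: $a(x,s,\xi)\cdot\xi\geq\alpha|\xi|^p$; $|a(x,s,\xi)|\leq\beta(h(x)+|s|^{p-1}+|\xi|^{p-1})$; $[a(x,s,\xi)-a(x,s,\eta)]\cdot(\xi-\eta)>0$; where $\alpha,\beta>0$ are constants and $h\in L^{p'}(\Omega)$. Weak solution: $u\in W^{1,p}_0(\Omega,X)$ with $\int_\Omega a(x,u,Xu)\cdot Xv\,dx=\int_\Omega F\cdot Xv\,dx$ for all $v\in W^{1,p}_0(\Omega,X)$. The notation $C=C(Q,p,\Omega,\alpha,m,X)$ means that $C$ depends only on the listed data (in particular not on $F$ or $u$); the dependence on $\Omega$ and $X$ is through the constant $\mathcal{S}_p$ in the Sobolev inequality $\|w\|_{L^{p^*}(\Omega)}\leq\mathcal{S}_p\|Xw\|_{L^p(\Omega)}$ for $w\in W^{1,p}_0(\Omega,X)$. *)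

(* Defs.v *)
From HB Require Import structures.
From mathcomp Require Import all_boot all_order all_algebra.
From mathcomp Require Import all_classical all_reals all_analysis.
Set Implicit Arguments.
Unset Strict Implicit.
Unset Printing Implicit Defensive.
Import Order.TTheory GRing.Theory Num.Theory.
Import numFieldNormedType.Exports.
Local Open Scope classical_set_scope.
Local Open Scope ring_scope.

(** The library only has Lebesgue measure on the line.  The Lebesgue outer
    measure of a subset [A] of R^N is the infimum of the total volume of
    countable covers of [A] by half-open boxes; Caratheodory's construction,
    from the library, gives the (complete) sigma-algebra of Lebesgue measurable
    sets. *)

Section lebesgue.
Variables (R : realType) (N : nat).
Implicit Types (A : set 'rV[R]_N) (Q : 'rV[R]_N * 'rV[R]_N).

Definition box Q : set 'rV[R]_N :=
  [set x | forall k, Q.1 0 k <= x 0 k < Q.2 0 k].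

Definition box_volume Q : R := \prod_k Num.max 0 (Q.2 0 k - Q.1 0 k).

Definition lebesgue_outer A : \bar R :=
  ereal_inf [set \esum_(Q in C) (box_volume Q)%:E
            | C in [set C | countable C /\ A `<=` \bigcup_(Q in C) box Q]].

Lemma box_volume_ge0 Q : 0 <= box_volume Q.
Proof. by apply: prodr_ge0 => k _; rewrite le_max lexx. Qed.

Lemma lebesgue_outer0 : lebesgue_outer set0 = 0%E.
Proof.
apply/eqP; rewrite eq_le; apply/andP; split.
  by apply: ereal_inf_lbound; exists set0; [split=> // | rewrite esum_set0].
apply: le_ereal_inf_tmp => _ [C _ <-]; apply: esum_ge0 => Q _.
by rewrite lee_fin box_volume_ge0.
Qed.

Lemma lebesgue_outer_ge0 A : (0 <= lebesgue_outer A)%E.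
Proof.
apply: le_ereal_inf_tmp => _ [C _ <-]; apply: esum_ge0 => Q _.
by rewrite lee_fin box_volume_ge0.
Qed.

Lemma le_lebesgue_outer :
  {homo lebesgue_outer : A B / A `<=` B >-> (A <= B)%E}.
Proof.
move=> A B AB; apply: ereal_inf_le_tmp => _ [C [Cc BC] <-].
by exists C => //; split=> //; exact: subset_trans BC.
Qed.

Lemma lebesgue_outer_sigma_subadditive : sigma_subadditive lebesgue_outer.
Proof.
move=> A; have [[i ioo]|/forallNP Aoo] :=
    pselect (exists i, lebesgue_outer (A i) = +oo%E).
  by rewrite (eseries_pinfty _ _ ioo) ?leey// => n _;
    rewrite -ltNye (lt_le_trans _ (lebesgue_outer_ge0 _)).
suff add2e (e : {posnum R}) : (lebesgue_outer (\bigcup_n A n) <=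
    \sum_(i <oo) lebesgue_outer (A i) + e%:num%:E)%E.
  by apply/lee_addgt0Pr => _/posnumP[].
rewrite (le_trans _ (epsilon_trick _ _ _))//; last first.
  by move=> n; exact: lebesgue_outer_ge0.
pose P n (C : set ('rV[R]_N * 'rV[R]_N)) :=
  (countable C /\ A n `<=` \bigcup_(Q in C) box Q) /\
  (\esum_(Q in C) (box_volume Q)%:E <=
   lebesgue_outer (A n) + (e%:num / (2 ^ n.+1)%:R)%:E)%E.
have [C PC] : {C : nat -> set ('rV[R]_N * 'rV[R]_N) & forall n, P n (C n)}.
  apply: (@choice _ _ P) => n.
  have en1 : 0 < e%:num / (2 ^ n.+1)%:R by [].
  have fA : lebesgue_outer (A n) \is a fin_num.
    by rewrite ge0_fin_numE ?lebesgue_outer_ge0// ltey; apply/eqP/Aoo.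
  have /(lb_ereal_inf_adherent en1)[_ [D DA <-] /ltW Dle] := fA.
  by exists D.
apply: (@le_trans _ _ (\esum_(Q in \bigcup_n C n) (box_volume Q)%:E)%E).
  apply: ereal_inf_lbound; exists (\bigcup_n C n) => //; split.
    by apply: bigcup_countable => // n _; have [[]] := PC n.
  move=> x [n _ Anx]; have [[_ /(_ _ Anx)[Q CQ Qx]] _] := PC n.
  by exists Q => //; exists n.
rewrite seqDU_bigcup_eq nneseries_sum_bigcup; last 2 first.
- exact: trivIset_seqDU.
- by move=> Q; rewrite lee_fin box_volume_ge0.
apply: lee_nneseries => [n _ _|n _].
  by apply: esum_ge0 => Q _; rewrite lee_fin box_volume_ge0.
apply: le_trans (PC n).2.
rewrite esum_mkcond [leRHS]esum_mkcond; apply: le_esum => Q _.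
case: ifPn => [/set_mem QC|_].
  by rewrite mem_set//; exact: subset_seqDU QC.
by case: ifPn => // _; rewrite lee_fin box_volume_ge0.
Qed.

HB.instance Definition _ := isOuterMeasure.Build R 'rV[R]_N lebesgue_outer
  lebesgue_outer0 lebesgue_outer_ge0 le_lebesgue_outer
  lebesgue_outer_sigma_subadditive.

End lebesgue.

Definition lebesgue_space (R : realType) (N : nat) :=
  caratheodory_type (@lebesgue_outer R N).

Definition lebesgueN (R : realType) (N : nat) :
  set (lebesgue_space R N) -> \bar R := @lebesgue_outer R N.

HB.instance Definition _ (R : realType) (N : nat) :=
  isMeasure.Build _ _ _ (@lebesgueN R N)
    (@caratheodory_measure0 _ _ (@lebesgue_outer R N))
    (@caratheodory_measure_ge0 _ _ (@lebesgue_outer R N))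
    (@caratheodory_measure_sigma_additive _ _ (@lebesgue_outer R N)).

Arguments lebesgueN : clear implicits.

Section calculus.
Variables (R : realType) (N : nat).

(* The library norm on row vectors is the sup norm. *)
Definition enorm n (v : 'rV[R]_n) : R := Num.sqrt (\sum_i v 0 i ^+ 2).

Definition dotv n (v w : 'rV[R]_n) : R := \sum_i v 0 i * w 0 i.

Definition partial (k : 'I_N) (u : 'rV[R]_N -> R) : 'rV[R]_N -> R :=
  fun x => 'D_(delta_mx 0 k) u x.

Definition C1_on (U : set 'rV[R]_N) (u : 'rV[R]_N -> R) :=
  forall x, U x -> forall k,
    derivable u x (delta_mx 0 k) /\ {for x, continuous (partial k u)}.

(* [C^1] up to the boundary: [C^1] on an open neighbourhood of the closure. *)
Definition C1_closure (E : set 'rV[R]_N) (u : 'rV[R]_N -> R) :=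
  exists U : set 'rV[R]_N, [/\ open U, closure E `<=` U & C1_on U u].

Definition smooth (u : 'rV[R]_N -> R) :=
  forall ks : seq 'I_N, C1_on setT (foldr partial u ks).

Definition test_function (Omega : set 'rV[R]_N) (phi : 'rV[R]_N -> R) :=
  [/\ smooth phi, compact (closure [set x | phi x != 0])
    & closure [set x | phi x != 0] `<=` Omega].

Definition abs_continuous (a b : R) (gamma : R -> 'rV[R]_N) :=
  forall e : R, 0 < e -> exists2 eta : R, 0 < eta &
    forall n (s t : 'I_n -> R),
      (forall i, a <= s i /\ s i <= t i /\ t i <= b) ->
      (forall i j, i != j -> t i <= s j \/ t j <= s i) ->
      \sum_i (t i - s i) < eta ->
      \sum_i enorm (gamma (t i) - gamma (s i)) < e.

End calculus.

Section Lp.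
Variables (R : realType) (N : nat) (Omega : set 'rV[R]_N).

Definition Lp_norm (p : R) (f : 'rV[R]_N -> R) : \bar R :=
  Lnorm (lebesgueN R N) p%:E ((EFin \o f) \_ Omega).

Definition Lmeasurable (f : 'rV[R]_N -> R) :=
  @measurable_fun _ _ (lebesgue_space R N) R Omega f.

Definition in_Lp (p : R) (f : 'rV[R]_N -> R) :=
  Lmeasurable f /\ (Lp_norm p f < +oo)%E.

Definition Lp_normv d (p : R) (F : 'rV[R]_N -> 'rV[R]_d) : \bar R :=
  Lp_norm p (fun x => enorm (F x)).

Definition in_Lpv d (p : R) (F : 'rV[R]_N -> 'rV[R]_d) :=
  (forall j, Lmeasurable (fun x => F x 0 j)) /\
  (Lp_normv p F < +oo)%E.

End Lp.

Section vector_fields.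
Variables (R : realType) (N d : nat).
(* [X j x 0 k] is the coefficient c_jk(x). *)
Variable X : 'I_d -> 'rV[R]_N -> 'rV[R]_N.

Definition Xgrad (u : 'rV[R]_N -> R) (x : 'rV[R]_N) : 'rV[R]_d :=
  \row_j \sum_k X j x 0 k * partial k u x.

Definition locally_lipschitz (f : 'rV[R]_N -> 'rV[R]_N) :=
  forall x : 'rV[R]_N, exists2 U : set 'rV[R]_N,
    nbhs x U & [lipschitz f y | y in U].

Definition subunit (T : R) (gamma : R -> 'rV[R]_N) :=
  abs_continuous 0 T gamma /\
  exists theta : R -> 'rV[R]_d,
    {ae lebesgue_measure, forall t : R, 0 <= t <= T ->
      [/\ derivable gamma t 1,
          derive1 gamma t = \sum_j theta t 0 j *: X j (gamma t)
        & \sum_j theta t 0 j ^+ 2 <= 1]}.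

Definition joined (x y : 'rV[R]_N) (T : R) :=
  0 < T /\ exists gamma, [/\ subunit T gamma, gamma 0 = x & gamma T = y].

Definition ccdist (x y : 'rV[R]_N) : R := inf [set T | joined x y T].

Definition ccball (x : 'rV[R]_N) (r : R) : set 'rV[R]_N :=
  [set y | ccdist x y < r].

Definition volume (E : set 'rV[R]_N) : R := fine (lebesgueN R N E).

Definition mean (E : set 'rV[R]_N) (u : 'rV[R]_N -> R) : R :=
  (volume E)^-1 * \int[lebesgueN R N]_(x in E) u x.

Definition doubling (Q : R) := forall x r, 0 < r ->
  (0 < lebesgueN R N (ccball x (2 * r))
     <= (2 `^ Q)%:E * lebesgueN R N (ccball x r))%E.

Definition poincare (CP nu : R) := forall x r u, 0 < r ->
  C1_closure (ccball x (nu * r)) u ->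
  let B := ccball x r in let B' := ccball x (nu * r) in
  ((volume B)^-1%:E * \int[lebesgueN R N]_(y in B) `|u y - mean B u|%:E
   <= (CP * r)%:E * ((volume B')^-1%:E *
        \int[lebesgueN R N]_(y in B') (enorm (Xgrad u y))%:E))%E.

Record standing_assumptions (Q : R) : Prop := {
  sa_lipschitz : forall j, locally_lipschitz (X j);
  sa_connected : forall x y, exists T, joined x y T;
  sa_topology : forall x (y : nat -> 'rV[R]_N),
    (y n @[n --> \oo] --> x) <-> (ccdist x (y n) @[n --> \oo] --> (0 : R));
  sa_doubling : doubling Q;
  sa_poincare : exists CP nu : R, [/\ 0 < CP, 0 < nu & poincare CP nu] }.

(* [W0 Omega p u g] says that [u] belongs to W^{1,p}_0(Omega, X) and that its
   X-gradient is [g]: the abstract limits of test functions under the norm of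
   the X-gradient are realised as functions through L^p convergence.  The
   gradient is an argument because it is only defined almost everywhere. *)
Definition W0 (Omega : set 'rV[R]_N) (p : R)
    (u : 'rV[R]_N -> R) (g : 'rV[R]_N -> 'rV[R]_d) :=
  [/\ in_Lp Omega p u, in_Lpv Omega p g &
    exists phi : nat -> 'rV[R]_N -> R,
      [/\ forall n, test_function Omega (phi n),
          Lp_norm Omega p (fun x => phi n x - u x) @[n --> \oo] --> 0%E
        & Lp_normv Omega p (fun x => Xgrad (phi n) x - g x)
            @[n --> \oo] --> 0%E]].

Definition sobolev_exponent (Q t : R) : R := t * Q / (Q - t).

Definition sobolev_constant (Omega : set 'rV[R]_N) (Q p S : R) :=
  0 < S /\ forall w g, W0 Omega p w g ->
    (Lp_norm Omega (sobolev_exponent Q p) w <= S%:E * Lp_normv Omega p g)%E.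

Record structure_conditions (Omega : set 'rV[R]_N) (p alpha beta : R)
    (h : 'rV[R]_N -> R) (a : 'rV[R]_N -> R -> 'rV[R]_d -> 'rV[R]_d) : Prop := {
  sc_measurable : forall s xi j, Lmeasurable Omega (fun x => a x s xi 0 j);
  sc_continuous : {ae lebesgueN R N, forall x, Omega x ->
    continuous (fun z : R * 'rV[R]_d => a x z.1 z.2)};
  sc_coercive : {ae lebesgueN R N, forall x, Omega x -> forall s xi,
    alpha * enorm xi `^ p <= dotv (a x s xi) xi};
  sc_growth : {ae lebesgueN R N, forall x, Omega x -> forall s xi,
    enorm (a x s xi) <= beta * (h x + `|s| `^ (p - 1) + enorm xi `^ (p - 1))};
  sc_monotone : {ae lebesgueN R N, forall x, Omega x -> forall s xi eta,
    xi != eta -> 0 < dotv (a x s xi - a x s eta) (xi - eta)} }.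

Definition weak_solution (Omega : set 'rV[R]_N) (p : R)
    (a : 'rV[R]_N -> R -> 'rV[R]_d -> 'rV[R]_d) (F : 'rV[R]_N -> 'rV[R]_d)
    (u : 'rV[R]_N -> R) (g : 'rV[R]_N -> 'rV[R]_d) :=
  W0 Omega p u g /\
  forall v gv, W0 Omega p v gv ->
    (\int[lebesgueN R N]_(x in Omega) (dotv (a x (u x) (g x)) (gv x))%:E
     = \int[lebesgueN R N]_(x in Omega) (dotv (F x) (gv x))%:E)%E.

End vector_fields.

(* Main.v *)
Require Import Defs.
From HB Require Import structures.
From mathcomp Require Import all_boot all_order all_algebra.
From mathcomp Require Import all_classical all_reals all_analysis.
From mathcomp Require Import measurable_realfun ring lra.
Set Implicit Arguments.
Unset Strict Implicit.
Unset Printing Implicit Defensive.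
Import Order.TTheory GRing.Theory Num.Theory.
Import numFieldNormedType.Exports.
Local Open Scope classical_set_scope.
Local Open Scope ring_scope.

(** Let p' = p / (p - 1), let s = p Q / (Q - p) be the Sobolev exponent and
    write T = min (|u|, k) for a level k > 0.  The solution is tested with a
    primitive of a power of its own truncation.  For theta >= 0 the primitive v
    of T^(theta p) has X-gradient T^(theta p) Xu, so coercivity and Hoelder's
    inequality bound the energy E = int T^(theta p) |Xu|^p by
    alpha^(-p') int |F|^p' T^(theta p) (energy_estimate).  A second use of
    Hoelder's inequality bounds that integral by |F|_m^p' Z^lam, where
    Z = int T^q and lam = 1 - p' / m, as soon as theta p = q lam
    (source_estimate).  Conversely the Sobolev inequality for the primitive of
    T^theta, which is at least (T / 2)^(theta + 1), bounds Z^(1 / s) by a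
    multiple of E^(1 / p), as soon as (theta + 1) s = q (sobolev_bound).  The
    two conditions determine theta and q, and q is the exponent of the theorem.
    Since 1 / s - lam / p = 1 / q is positive, the power of Z on the right can
    be absorbed on the left (absorb_powers): Z is finite because T <= k, and
    the resulting bound does not depend on k, so Fatou's lemma lets k tend to
    infinity.

    That v is admissible rests on a chain rule for W^{1,p}_0 (W0_comp).  On
    the bounded range of a test function the derivative is approximated
    uniformly by a polynomial (weierstrass); a primitive of it vanishing at 0
    is again a polynomial, and maps test functions to test functions.

    The bound obtained is a fixed multiple of the constant of the Sobolev
    inequality, so C is taken as that multiple of the infimum of all such
    constants.  The infimum is only meaningful once one Sobolev inequality is
    known, and this is derived from doubling and the Poincare inequality
    (sobolev_W0).  For a test function w, the means of w over dyadic balls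
    shrinking to x are telescoped, starting from a ball so large that it
    contains a fixed ball on which w vanishes (dyadic_average_bound).
    Estimating the averages of |Xw| that appear, over small balls by their
    supremum tau and over large balls by Hoelder's inequality, gives
    |w x| <= C tau^(1 - p / Q) |Xw|_p^(p / Q) (pointwise_bound).  Hence a
    multiple of |w|^(s / p) is dominated at each point by an average of |Xw|
    over some ball around that point (average_witness), and the L^p bound for
    such functions, a maximal inequality proved by Vitali covering
    (maximal_weak, maximal_strong), is the Sobolev inequality. *)

(** * Lebesgue measurability of open sets *)

Section lebesgue_borel.
Variables (R : realType) (N : nat).
Implicit Types (A C : set 'rV[R]_N).
Local Notation mu := (@lebesgue_outer R N).
Local Notation boxT := ('rV[R]_N * 'rV[R]_N)%type.

(** The volumes are indexed by [C] although [f] may identify boxes: the cover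
    [f @` C] is summed through a section of [f]. *)
Lemma lebesgue_outer_cover (C : set boxT) (f : boxT -> boxT) A :
  countable C -> A `<=` \bigcup_(Q in C) box (f Q) ->
  (mu A <= \esum_(Q in C) (box_volume (f Q))%:E)%E.
Proof.
move=> Cc AC.
have fsurj : forall Q, (f @` C) Q -> exists P, C P /\ f P = Q.
  by move=> Q [P CP fPQ]; exists P.
have [g gP] : {g : boxT -> boxT & forall Q, (f @` C) Q -> C (g Q) /\ f (g Q) = Q}.
  apply: (@choice _ _ (fun Q P => (f @` C) Q -> C P /\ f P = Q)) => Q.
  by have [/fsurj[P ?]|?] := pselect ((f @` C) Q); [exists P|exists Q].
apply: (@le_trans _ _ (\esum_(Q in f @` C) (box_volume Q)%:E)%E).
  apply: ereal_inf_lbound; exists (f @` C) => //; split.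
    exact: (sub_countable (card_image_le _ _) Cc).
  by rewrite bigcup_image.
rewrite (_ : (\esum_(Q in f @` C) (box_volume Q)%:E)%E =
   (\esum_(Q in f @` C) (box_volume (f (g Q)))%:E)%E); last first.
  by apply: eq_esum => Q /gP[_ ->].
rewrite -(@reindex_esum _ _ _ (f @` C) (g @` (f @` C)) g
   (fun Q => (box_volume (f Q))%:E)); last first.
  split; [by move=> Q ?; exists Q| |by move=> Q].
  move=> P Q /set_mem/gP[_ fP] /set_mem/gP[_ fQ] PQ.
  by rewrite -fP -fQ PQ.
rewrite esum_mkcond [leRHS]esum_mkcond; apply: le_esum => Q _.
case: ifPn => [/set_mem [P /gP[CP _] <-]|_].
  by rewrite mem_set.
by case: ifPn => // _; rewrite lee_fin box_volume_ge0.
Qed.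

Definition lower_half (k : 'I_N) (c : R) (Q : boxT) : boxT :=
  (Q.1, \row_j if j == k then Num.min c (Q.2 0 j) else Q.2 0 j).

Definition upper_half (k : 'I_N) (c : R) (Q : boxT) : boxT :=
  (\row_j if j == k then Num.max c (Q.1 0 j) else Q.1 0 j, Q.2).

Lemma box_volume_split k c (Q : boxT) :
  box_volume (lower_half k c Q) + box_volume (upper_half k c Q) = box_volume Q.
Proof.
have E P : box_volume P = Num.max 0 (P.2 0 k - P.1 0 k) *
    \prod_(i < N | i != k) Num.max 0 (P.2 0 i - P.1 0 i).
  by rewrite /box_volume (bigD1 k).
rewrite !E /= !mxE eqxx.
under eq_bigr => i ik do rewrite mxE (negPf ik).
under [X in _ + _ * X = _]eq_bigr => i ik do rewrite mxE (negPf ik).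
rewrite -mulrDl; congr (_ * _).
by rewrite /Num.max /Num.min; repeat case: ifPn; rewrite -?leNgt => *; lra.
Qed.

(** A hyperplane cuts every box of a cover into two boxes whose volumes add
    up, which is Caratheodory's criterion. *)
Lemma measurable_halfspace (k : 'I_N) (c : R) :
  measurable [set x : lebesgue_space R N | x 0 k < c].
Proof.
apply: le_caratheodory_measurable => X.
apply: le_ereal_inf_tmp => _ [C [Cc XC] <-].
apply: (@le_trans _ _ (\esum_(Q in C) (box_volume (lower_half k c Q))%:E +
   \esum_(Q in C) (box_volume (upper_half k c Q))%:E)%E).
  apply: leeD; apply: lebesgue_outer_cover => // x [Xx /= Hx].
    have [Q CQ Qx] := XC _ Xx; exists Q => // j; rewrite mxE /=.
    have := Qx j; case: (eqVneq j k) => // -> /andP[-> ] /=.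
    by rewrite lt_min Hx.
  have [Q CQ Qx] := XC _ Xx; exists Q => // j; rewrite mxE /=.
  have := Qx j; case: (eqVneq j k) => // -> /andP[Q1 ->] /=.
  by rewrite ge_max Q1 !andbT leNgt; apply/negP.
rewrite -esumD; try by move=> *; rewrite lee_fin box_volume_ge0.
by apply: le_esum => Q _; rewrite -EFinD box_volume_split.
Qed.

Lemma measurable_open_box (a b : 'rV[R]_N) :
  measurable [set x : lebesgue_space R N | forall k, a 0 k < x 0 k < b 0 k].
Proof.
rewrite (_ : [set x | _] = \bigcap_(k in [set: 'I_N])
   ([set x : lebesgue_space R N | x 0 k < b 0 k] `&`
    ~` \bigcap_(n in [set: nat]) [set x | x 0 k < a 0 k + n.+1%:R^-1])).
  apply: fin_bigcap_measurable => // k _.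
  apply: measurableI; first exact: measurable_halfspace.
  apply/measurableC/bigcap_measurable; first by exists 0%N.
  by move=> n _; exact: measurable_halfspace.
apply/seteqP; split => x /= H k.
  move=> _; have /andP[ax xb] := H k; split => // H'.
  have [n] := ltr_add_invr ax.
  by move=> /ltW; rewrite leNgt => /negP; apply; apply: H'.
have [/= -> ] := H k I; rewrite andbT => /existsNP[n] /not_implyP[_] /negP.
rewrite -leNgt; apply: lt_le_trans.
by rewrite ltrDl invr_gt0.
Qed.

(** There are countably many boxes with rational corners, and those inside an
    open set cover it. *)
Lemma open_lebesgue_measurable (U : set 'rV[R]_N) : open U ->
  measurable (U : set (lebesgue_space R N)).
Proof.
move=> oU.
pose B (q : 'rV[rat]_N * 'rV[rat]_N) : set (lebesgue_space R N) :=
  [set x | forall k, (ratr (q.1 0 k) : R) < x 0 k < ratr (q.2 0 k)].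
pose F q := if `[< B q `<=` U >] then B q else set0.
rewrite (_ : U = \bigcup_q F q).
  apply: countable_bigcupT_measurable; first exact: countableP.
  move=> q; rewrite /F; case: asboolP => _ //.
  have := measurable_open_box (map_mx ratr q.1) (map_mx ratr q.2).
  by congr measurable; apply/seteqP; split => x /= H k; have := H k; rewrite !mxE.
apply/seteqP; split => [x Ux|x [q _]]; last first.
  by rewrite /F; case: asboolP => // + Bx => /(_ _ Bx).
have /nbhs_ballP[e /= e0 xeU] := open_nbhs_nbhs (conj oU Ux).
have lo k : {q : rat | ratr q \in `]x 0 k - e, x 0 k[}.
  by apply: cid; apply: rat_in_itvoo; rewrite ltrBlDr ltrDl.
have hi k : {q : rat | ratr q \in `]x 0 k, x 0 k + e[}.
  by apply: cid; apply: rat_in_itvoo; rewrite ltrDl.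
exists (\row_k sval (lo k), \row_k sval (hi k)) => //.
have loP k := svalP (lo k); have hiP k := svalP (hi k).
rewrite /F; case: asboolP => [_ k|[]] /=.
  have := loP k; have := hiP k; rewrite !mxE !in_itv /=.
  by move=> /andP[-> _] /andP[_ ->].
move=> y /= By; apply: xeU; split => // i k; rewrite ord1 /ball /= ltr_norml.
have := By k; have := loP k; have := hiP k; rewrite !mxE !in_itv /=.
move=> /andP[h1 h2] /andP[h3 h4] /andP[h5 h6].
by apply/andP; split; lra.
Qed.

Lemma continuous_lebesgue_measurable (f : 'rV[R]_N -> R) (D : set 'rV[R]_N) :
  continuous f -> measurable (D : set (lebesgue_space R N)) ->
  @measurable_fun _ _ (lebesgue_space R N) R D f.
Proof.
move=> cf mD; apply: (measurability _ (measurable_realfun.RGenOInfty.measurableE R)) => /=.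
move=> _ [_ [a ->] <-]; apply: measurableI => //.
by apply: open_lebesgue_measurable; apply: open_comp => // x _; exact: cf.
Qed.

Lemma lebesgue_bounded_fin (A : set 'rV[R]_N) :
  bounded_set A -> (lebesgueN R N A < +oo)%E.
Proof.
move=> [M [_ Mb]].
have := Mb (`|M| + 1) (ltr_pwDr ltr01 (ler_norm _)) => {}Mb.
pose Q : boxT := (const_mx (- (`|M| + 1) ), const_mx (`|M| + 2)).
apply: (@le_lt_trans _ _ (\esum_(Q in [set Q]) (box_volume Q)%:E)%E).
  apply: (@lebesgue_outer_cover [set Q] id); first exact: countable1.
  move=> x Ax; exists Q => // k; rewrite !mxE.
  have := Mb _ Ax; rewrite /= => h.
  have : `|x 0 k| <= `|M| + 1.
    apply: (le_trans _ h); rewrite [leRHS]/Num.norm/= mx_normrE.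
    exact: (le_bigmax _ (fun i => `|x i.1 i.2|) (0, k)).
  by rewrite ler_norml => /andP[-> ] /le_lt_trans -> //; rewrite ltrD2l ltr1n.
by rewrite esum_set1 ?ltry// lee_fin box_volume_ge0.
Qed.

End lebesgue_borel.

(** * Euclidean norm and absolutely continuous paths *)

Section euclidean_norm.
Variables (R : realType) (n : nat).
Implicit Types (v w : 'rV[R]_n).

Lemma enorm_ge0 v : 0 <= enorm v.
Proof. exact: sqrtr_ge0. Qed.

Lemma sqr_enorm v : enorm v ^+ 2 = dotv v v.
Proof.
rewrite sqr_sqrtr; first by apply: eq_bigr => i _; rewrite expr2.
by apply: sumr_ge0 => i _; rewrite sqr_ge0.
Qed.

Lemma dotvv_ge0 v : 0 <= dotv v v.
Proof. by rewrite -sqr_enorm sqr_ge0. Qed.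

Lemma enorm_eq0 v : (enorm v == 0) = (v == 0).
Proof.
apply/eqP/eqP => [v0|->]; last first.
  by rewrite /enorm big1 ?sqrtr0// => i _; rewrite mxE expr0n.
have := sqr_enorm v; rewrite v0 expr0n/= => /esym/eqP.
rewrite psumr_eq0 => [/allP h|i _]; last by rewrite -expr2 sqr_ge0.
apply/rowP => i; rewrite mxE.
by have := h i (mem_index_enum i); rewrite mulf_eq0 orbb => /eqP.
Qed.

Lemma enorm0 : enorm (0 : 'rV[R]_n) = 0.
Proof. by apply/eqP; rewrite enorm_eq0. Qed.

Lemma dotvDl v w z : dotv (v + w) z = dotv v z + dotv w z.
Proof. by rewrite -big_split; apply: eq_bigr => i _; rewrite mxE mulrDl. Qed.

Lemma dotvC v w : dotv v w = dotv w v.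
Proof. by apply: eq_bigr => i _; rewrite mulrC. Qed.

Lemma dotvZl a v w : dotv (a *: v) w = a * dotv v w.
Proof. by rewrite mulr_sumr; apply: eq_bigr => i _; rewrite mxE mulrA. Qed.

Lemma enormZ a v : enorm (a *: v) = `|a| * enorm v.
Proof.
rewrite /enorm -sqrtr_sqr -sqrtrM ?sqr_ge0// mulr_sumr.
by congr Num.sqrt; apply: eq_bigr => i _; rewrite mxE exprMn.
Qed.

Lemma enormN v : enorm (- v) = enorm v.
Proof. by rewrite -scaleN1r enormZ normrN1 mul1r. Qed.

(** Expanding the square of the vector |w| v - |v| w. *)
Lemma dotv_le_enorm v w : dotv v w <= enorm v * enorm w.
Proof.
have [/eqP|v0] := eqVneq (enorm v) 0.
  rewrite enorm_eq0 => /eqP ->; rewrite enorm0 mul0r /dotv big1// => i _.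
  by rewrite mxE mul0r.
have [/eqP|w0] := eqVneq (enorm w) 0.
  rewrite enorm_eq0 => /eqP ->; rewrite enorm0 mulr0 /dotv big1// => i _.
  by rewrite mxE mulr0.
have vp : 0 < enorm v by rewrite lt_def v0 enorm_ge0.
have wp : 0 < enorm w by rewrite lt_def w0 enorm_ge0.
have := dotvv_ge0 (enorm w *: v + (- enorm v) *: w).
rewrite dotvDl !dotvZl ![dotv _ (_ + _)]dotvC !dotvDl !dotvZl.
rewrite -!sqr_enorm (dotvC w v) => h.
have : 0 <= (enorm v * enorm w) * (enorm v * enorm w - dotv v w) by nra.
by rewrite pmulr_rge0 ?mulr_gt0// subr_ge0.
Qed.

Lemma enormD v w : enorm (v + w) <= enorm v + enorm w.
Proof.
rewrite -(@ler_pXn2r _ 2) ?nnegrE ?addr_ge0 ?enorm_ge0//.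
rewrite sqr_enorm dotvDl ![dotv _ (_ + _)]dotvC !dotvDl -!sqr_enorm (dotvC w v).
by have := dotv_le_enorm v w; nra.
Qed.

End euclidean_norm.

Section abs_continuous.
Variables (R : realType) (N : nat).
Implicit Types (g h : R -> 'rV[R]_N).

Lemma abs_continuous_cst a b (c : 'rV[R]_N) : abs_continuous a b (cst c).
Proof.
move=> e e0; exists 1 => // n s t _ _ _.
by rewrite big1// => i _; rewrite subrr enorm0.
Qed.

Lemma abs_continuousD a b g h :
  abs_continuous a b g -> abs_continuous a b h ->
  abs_continuous a b (fun t => g t + h t).
Proof.
move=> cg ch e e0; have e2 : 0 < e / 2 by rewrite divr_gt0.
have [d1 d10 H1] := cg _ e2; have [d2 d20 H2] := ch _ e2.
exists (Num.min d1 d2); first by rewrite lt_min d10.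
move=> n s t st dis; rewrite lt_min => /andP[/(H1 _ _ _ st dis) h1].
move=> /(H2 _ _ _ st dis) h2.
apply: le_lt_trans (_ : _ <= \sum_i enorm (g (t i) - g (s i)) +
   \sum_i enorm (h (t i) - h (s i))) _; last by rewrite (splitr e) ltrD.
rewrite -big_split; apply: ler_sum => i _.
by rewrite opprD addrACA enormD.
Qed.

Lemma abs_continuous_comp a b a' b' (m : R -> R) g :
  (forall s t, a' <= s -> s <= t -> t <= b' ->
    [/\ a <= m s, m s <= m t, m t <= b & m t - m s <= t - s]) ->
  abs_continuous a b g -> abs_continuous a' b' (g \o m).
Proof.
move=> mP cg e e0; have [d d0 H] := cg _ e0; exists d => // n s t st dis lt.
apply: (H n (m \o s) (m \o t)) => /=.
- by move=> i; have [? [? ?]] := st i; have [] := mP (s i) (t i).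
- move=> i j ij; have [? [? ?]] := st i; have [? [? ?]] := st j.
  have [ts|ts] := dis _ _ ij; [left|right].
    have [] // := mP (t i) (s j) => //; first exact: le_trans (_ : a' <= s i) _.
    exact: le_trans (_ : _ <= t j) _.
  have [] // := mP (t j) (s i) => //; first exact: le_trans (_ : a' <= s j) _.
  exact: le_trans (_ : _ <= t i) _.
- apply: le_lt_trans lt; apply: ler_sum => i _.
  by have [? [? ?]] := st i; have [] := mP (s i) (t i).
Qed.

Lemma abs_continuous_rev T g :
  abs_continuous 0 T g -> abs_continuous 0 T (fun t => g (T - t)).
Proof.
move=> cg e e0; have [d d0 H] := cg _ e0; exists d => // n s t st dis lt.
under eq_bigr do rewrite -enormN opprB.
apply: (H n (fun i => T - t i) (fun i => T - s i)) => /=.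
- by move=> i; have [? [? ?]] := st i; split; [lra|split; lra].
- by move=> i j /dis; case=> ?; [right|left]; lra.
- by apply: le_lt_trans lt; apply: ler_sum => i _; lra.
Qed.

End abs_continuous.

(** * Null sets of times under translation and reflection *)

Section null_sets.
Variable R : realType.
Local Notation lambda := (@lebesgue_measure R).

Definition translation (c : R) : R -> measurableTypeR R := fun t => t - c.

Lemma measurable_translation c : measurable_fun setT (translation c).
Proof. exact: measurable_funB. Qed.

HB.instance Definition _ c :=
  isMeasurableFun.Build _ _ _ _ (translation c) (measurable_translation c).

Lemma lebesgue_measure_translation c (A : set R) : measurable A ->
  pushforward lambda (translation c) A = lambda A.
Proof.
move=> mA; apply/esym.
apply: (@lebesgue_measure_unique R (pushforward lambda (translation c))) => [|mt _ [[a b]] _ <-|//].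
  exact: measurable_translation.
rewrite [RHS](_ : _ = lambda `]a + c, b + c]%classic); last first.
  rewrite /pushforward; congr (lambda _); rewrite /preimage.
  by apply/seteqP; split => t; rewrite /= /translation !in_itv/= ltrBrDr lerBlDr.
rewrite !lebesgue_measure_itv/= !lte_fin ltrD2r.
by case: ifPn => // _; rewrite -!EFinB opprD addrACA subrr addr0.
Qed.

Lemma ae_translation c (P : R -> Prop) :
  {ae lambda, forall t, P t} -> {ae lambda, forall t, P (t - c)}.
Proof.
move=> [A [mA A0 PA]]; exists (translation c @^-1` A); split.
- by rewrite -[_ @^-1` _]setTI; exact: measurable_translation.
- by rewrite -A0 -(lebesgue_measure_translation c mA).
- by move=> t /= ?; apply: PA.
Qed.

Lemma ae_opp (P : R -> Prop) :
  {ae lambda, forall t, P t} -> {ae lambda, forall t, P (- t)}.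
Proof.
move=> [A [mA A0 PA]]; exists ((-%R : R -> measurableTypeR R) @^-1` A); split.
- by rewrite -[_ @^-1` _]setTI; exact: oppr_measurable.
- by rewrite -A0 -(lebesgue_measureN mA).
- by move=> t /= ?; apply: PA.
Qed.

Lemma ae_neq (c : R) : {ae lambda, forall t, t != c}.
Proof.
exists [set c]; split => //; first exact: lebesgue_measure_set1.
by move=> t /= /negP; rewrite negbK => /eqP.
Qed.

End null_sets.

(** * The Carnot-Caratheodory distance *)

Section affine_reparametrisation.
Variables (R : realType) (V : normedModType R).

Lemma derive_reparam (g : R -> V) (m : R -> R) (t b : R) :
  is_derive t 1 m b -> derivable g (m t) 1 ->
  derivable (g \o m) t 1 /\ derive1 (g \o m) t = b *: derive1 g (m t).
Proof.
move=> [dm mb] dg.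
have Dm : differentiable m t by exact/derivable1_diffP.
have Dg : differentiable g (m t) by exact/derivable1_diffP.
have Dgm : differentiable (g \o m) t by exact: differentiable_comp.
split; first exact/derivable1_diffP.
have mE : 'd m t 1 = b by rewrite -mb; exact/esym/(deriveE _ Dm).
rewrite derive1E; apply: (etrans (deriveE _ Dgm)).
apply: (etrans (congr1 (fun l => l 1) (diff_comp Dm Dg))).
by apply: (etrans (congr1 ('d g (m t)) mE)); rewrite (deriv1E dg).
Qed.

End affine_reparametrisation.

Section carnot_caratheodory.
Variables (R : realType) (N d : nat) (X : 'I_d -> 'rV[R]_N -> 'rV[R]_N).
Local Notation lambda := (@lebesgue_measure R).

Lemma joined_refl x T : 0 < T -> joined X x x T.
Proof.
move=> T0; split => //; exists (cst x); split => //; split.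
  exact: abs_continuous_cst.
exists (cst 0); apply: aeW => t _; split.
- exact: derivable_cst.
- by rewrite derive1_cst big1// => j _; rewrite mxE scale0r.
- by rewrite big1// => j _; rewrite mxE expr0n.
Qed.

Lemma joined_sym x y T : joined X x y T -> joined X y x T.
Proof.
move=> [T0 [g [[acg [th aeg]] gx gy]]]; split => //.
exists (fun t => g (T - t)); split; last 2 first.
- by rewrite subr0.
- by rewrite subrr.
split; first exact: abs_continuous_rev.
exists (fun t => - th (T - t)).
have {}aeg := ae_translation (- T) aeg.
have {}aeg := ae_opp aeg.
have aeF := ae_filter_ringOfSetsType lambda.
apply: filterS aeg => t H tT.
have E : - t - - T = T - t by rewrite opprK addrC.
rewrite E in H.
have [|dg gE th1] := H; first by apply/andP; split; lra.
have [|H1 H2] := @derive_reparam _ _ g (fun s => T - s) t (-1) _ dg.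
  by have := is_deriveB (is_derive_cst T t 1) (is_derive_id t 1); rewrite sub0r.
split => //.
  rewrite [LHS]H2 gE scaleN1r -sumrN.
  by apply: eq_bigr => j _; rewrite mxE scaleNr.
by rewrite (le_trans _ th1)// ler_sum// => j _; rewrite mxE sqrrN.
Qed.

(** The concatenation is a single formula: the first path stopped at its
    endpoint, plus the second one delayed at its starting point. *)
Lemma joined_trans x y z S T :
  joined X x y S -> joined X y z T -> joined X x z (S + T).
Proof.
move=> [S0 [g [[acg [th aeg]] gx gy]]] [T0 [h [[ach [ps aeh]] hy hz]]].
split; first exact: addr_gt0.
have [k kE] : exists k : R -> 'rV[R]_N, k = fun t =>
    g (Num.min t S) + (h (Num.max (t - S) 0) + cst (- y) t) by eexists.
exists k; split; last 2 first.
- by rewrite kE min_l ?ltW// max_r ?sub0r ?oppr_le0 ?ltW//= gx hy subrr addr0.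
- rewrite kE min_r ?lerDl ?ltW// [S + T]addrC addrK max_l ?ltW//= gy hz.
  by rewrite addrCA subrr addr0.
split.
  rewrite kE; apply: abs_continuousD.
    apply: (abs_continuous_comp (m := fun t => Num.min t S) _ acg).
    by move=> s t *; rewrite /Num.min; repeat case: ifPn; rewrite -?leNgt => *;
      split; lra.
  apply: abs_continuousD; last exact: abs_continuous_cst.
  apply: (abs_continuous_comp (m := fun t => Num.max (t - S) 0) _ ach).
  by move=> s t *; rewrite /Num.max; repeat case: ifPn; rewrite -?leNgt => *;
      split; lra.
exists (fun t => if t < S then th t else ps (t - S)).
have {}aeh := ae_translation S aeh.
have aeF := ae_filter_ringOfSetsType lambda.
near=> t => tST.
have [tS|] := ltP t S; last rewrite le_eqVlt => /orP[/eqP St|tS].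
- have gk : \near t, g t = k t.
    near=> s; have sS : s < S.
      by near: s; exact: lt_nbhsl.
    rewrite kE min_l ?ltW// max_r ?hy ?subr_le0 ?ltW//=.
    by rewrite subrr addr0.
  have [dg gE th1] : [/\ derivable g t 1,
          derive1 g t = \sum_j th t 0 j *: X j (g t)
        & \sum_j th t 0 j ^+ 2 <= 1].
    have : 0 <= t <= S by apply/andP; split; lra.
    by near: t; exact: aeg.
  have kg : derive1 k t = derive1 g t.
    by rewrite derive1E derive1E; exact/esym/near_eq_derive.
  split; [exact: (near_eq_derivable gk dg)| |exact: th1].
  by rewrite kg gE -(nbhs_singleton gk).
- by exfalso; move: St => /esym/eqP; apply/negP; near: t; exact: ae_neq.
- have hk : \near t, h (t - S) = k t.
    near=> s; have sS : S < s.
      by near: s; exact: lt_nbhsr.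
    rewrite kE min_r ?ltW// max_l ?gy ?subr_ge0 ?ltW//=.
    by rewrite addrCA subrr addr0.
  have [dh hE ps1] : [/\ derivable h (t - S) 1,
          derive1 h (t - S) = \sum_j ps (t - S) 0 j *: X j (h (t - S))
        & \sum_j ps (t - S) 0 j ^+ 2 <= 1].
    have : 0 <= t - S <= T by apply/andP; split; lra.
    by near: t; exact: aeh.
  have [|H1 H2] := @derive_reparam _ _ h (fun s => s - S) t 1 _ dh.
    by have := is_deriveB (is_derive_id t 1) (is_derive_cst S t 1); rewrite subr0.
  have kh : derive1 k t = derive1 h (t - S).
    rewrite -[RHS]scale1r -H2 derive1E derive1E; exact/esym/near_eq_derive.
  split; [exact: (near_eq_derivable hk H1)| |exact: ps1].
  by rewrite kh hE -(nbhs_singleton hk).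
Unshelve. all: by end_near. Qed.

Hypothesis connected : forall x y, exists T, joined X x y T.

Lemma has_lbound_joined x y : has_lbound [set T | joined X x y T].
Proof. by exists 0 => T [/ltW]. Qed.

Lemma joined_ccdist_le x y T : joined X x y T -> ccdist X x y <= T.
Proof. by move=> xyT; apply: ge_inf => //; exact: has_lbound_joined. Qed.

Lemma ccdist_lt_joined x y r :
  ccdist X x y < r -> exists2 T, joined X x y T & T < r.
Proof. by apply: inf_lt; have [T xyT] := connected x y; exists T. Qed.

Lemma ccdist_ge0 x y : 0 <= ccdist X x y.
Proof.
apply: lb_le_inf; first by have [T xyT] := connected x y; exists T.
by move=> T [/ltW].
Qed.

Lemma ccdistxx x : ccdist X x x = 0.
Proof.
apply/eqP; rewrite eq_le ccdist_ge0 andbT leNgt; apply/negP => d0.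
have h : 0 < ccdist X x x / 2 by rewrite divr_gt0.
have := joined_ccdist_le (joined_refl x h); lra.
Qed.

Lemma ccdistC x y : ccdist X x y = ccdist X y x.
Proof.
rewrite /ccdist; congr inf; apply/seteqP; split => T /=; exact: joined_sym.
Qed.

Lemma ccdist_triangle y x z : ccdist X x z <= ccdist X x y + ccdist X y z.
Proof.
apply/ler_addgt0Pr => e e0; have e2 : 0 < e / 2 by rewrite divr_gt0.
have [|S xyS Sl] := @ccdist_lt_joined x y (ccdist X x y + e / 2); first lra.
have [|T yzT Tl] := @ccdist_lt_joined y z (ccdist X y z + e / 2); first lra.
by have := joined_ccdist_le (joined_trans xyS yzT); lra.
Qed.

Lemma ccball_center x r : 0 < r -> ccball X x r x.
Proof. by rewrite /ccball /= ccdistxx. Qed.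

Lemma le_ccball x r s : r <= s -> ccball X x r `<=` ccball X x s.
Proof. by move=> rs y /= /lt_le_trans; apply. Qed.

Lemma ccball_sub x y r s : ccdist X y x + r <= s ->
  ccball X x r `<=` ccball X y s.
Proof.
move=> h z; rewrite /ccball /= => xz.
by have := ccdist_triangle x y z; lra.
Qed.

Lemma ccball_engulf x y z r s : r <= s ->
  ccball X x r z -> ccball X y s z -> ccball X x r `<=` ccball X y (3 * s).
Proof.
move=> rs; rewrite /ccball /= => xz yz w /= xw.
have := ccdist_triangle z y w; have := ccdist_triangle x z w.
by rewrite (ccdistC z x) /=; lra.
Qed.

Hypothesis topology : forall x (y : nat -> 'rV[R]_N),
  (y n @[n --> \oo] --> x) <->
  (ccdist X x (y n) @[n --> \oo] --> (0 : R)).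

(** The Euclidean and control topologies are only compared along sequences,
    hence the argument by contradiction with points at distance 1 / (n + 1). *)
Lemma nbhs_ccball x U : nbhs x U -> exists2 e, 0 < e & ccball X x e `<=` U.
Proof.
move=> xU; apply: contrapT => /forall2NP noe.
have {}noe n : exists z, ccball X x n.+1%:R^-1 z /\ ~ U z.
  have [/negP|] := noe n.+1%:R^-1; first by rewrite invr_gt0 ltr0n.
  by move=> /existsNP[z /not_implyP[? ?]]; exists z.
have [y yP] := choice noe.
have /topology yx : ccdist X x (y n) @[n --> \oo] --> (0 : R).
  apply: (@squeeze_cvgr _ _ _ _ (fun=> 0) (fun n => n.+1%:R^-1)).
  - by near=> n; rewrite ccdist_ge0/= ltW//; have [] := yP n.
  - exact: cvg_cst.
  - exact: cvg_harmonic.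
have [n _ yU] := yx _ xU.
by have [_] := yP n; apply; exact: (yU n (leqnn n)).
Unshelve. all: by end_near. Qed.

Lemma open_ccball x r : open (ccball X x r).
Proof.
rewrite openE => y xy; rewrite /interior.
apply: contrapT => yN.
have {}noe n : exists z, ball y n.+1%:R^-1 z /\ ~ ccball X x r z.
  apply: contrapT => /forallNP H; apply: yN.
  apply/nbhs_ballP; exists n.+1%:R^-1 => //=.
  by move=> z yz; apply: contrapT => zN; exact: (H z).
have [z zP] := choice noe.
have /topology zy : z n @[n --> \oo] --> y.
  apply/cvg_ballP => e e0; near=> n.
  apply: le_ball (zP n).1; apply: ltW; near: n; exact: near_infty_natSinv_lt (PosNum e0).
have [n _ H] : \forall n \near \oo, ccdist X y (z n) < r - ccdist X x y.
  by apply: (cvgr_lt 0) => //; rewrite subr_gt0.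
have [_] := zP n; apply; rewrite /ccball/=.
by have := ccdist_triangle y x (z n); have := H n (leqnn n); rewrite /=; lra.
Unshelve. all: by end_near. Qed.

End carnot_caratheodory.

(** * Smooth functions and the X-gradient *)

Section mean_value.
Variable R : realType.
Implicit Types (g dg : R -> R).

Lemma mean_value_between g dg (a b : R) : (forall t : R, is_derive t 1 g (dg t)) ->
  exists2 c, Num.min a b <= c <= Num.max a b & g b - g a = dg c * (b - a).
Proof.
move=> gP; wlog ab : a b / a <= b.
  move=> H; have [/H//|/H[c cab E]] := orP (le_total a b).
  exists c; first by rewrite minC maxC.
  by rewrite -opprB E -mulrN opprB.
have cg : {within `[a, b], continuous g}.
  by apply: derivable_within_continuous => x _; have [] := gP x.
have [c cab E] := MVT_segment ab (fun x _ => gP x) cg.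
by exists c => //; rewrite min_l// max_r//; move: cab; rewrite in_itv.
Qed.

Lemma mean_value_bound g dg (a b M : R) : (forall t : R, is_derive t 1 g (dg t)) ->
  (forall t, Num.min a b <= t <= Num.max a b -> `|dg t| <= M) ->
  `|g b - g a| <= M * `|b - a|.
Proof.
move=> gP dgM; have [c cab ->] := mean_value_between a b gP.
by rewrite normrM ler_wpM2r// dgM.
Qed.

End mean_value.

Section partial_derivatives.
Variables (R : realType) (N : nat).
Implicit Types (u v : 'rV[R]_N -> R) (x y e : 'rV[R]_N).

Lemma derivable_line u x e (t : R) : derivable u (x + t *: e) e ->
  is_derive t 1 (fun s => u (x + s *: e)) ('D_e u (x + t *: e)).
Proof.
have E : (fun h : R => h^-1 *: (((fun s => u (x + s *: e)) \o shift t) (h *: 1)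
     - u (x + t *: e)))
   = (fun h => h^-1 *: ((u \o shift (x + t *: e)) (h *: e) - u (x + t *: e))).
  apply/funext => h /=; congr (_ *: (u _ - _)).
  by rewrite [h *: 1]mulr1 scalerDl addrCA.
by move=> du; split; rewrite /derivable /derive E.
Qed.

(** Passing from x to y one coordinate at a time, each step is controlled by
    the mean value theorem. *)
Lemma C1_continuous u : C1_on setT u -> continuous u.
Proof.
move=> C1; suff cu (x : 'rV[R]_N) : u y @[y --> x] --> u x by move=> x; exact: cu.
have [M M0 xM] : exists2 M : R, 0 < M & \forall y \near x, forall k,
    `|partial k u y| <= M.
  pose M := 1 + \sum_k `|partial k u x|.
  have M0 : 0 < M by rewrite ltr_pwDl// sumr_ge0.
  exists M => //.
  apply: (@filter_forall _ _ (fun k y => `|partial k u y| <= M) (nbhs x) _) => k.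
  have [_ ck] := C1 x I k; apply: (cvgr_norm_le _ ck).
  rewrite /M (bigD1 k)//= addrCA ltr_pwDr// ltr_pwDl// sumr_ge0//.
have /nbhs_ballP[r /= r0 {}xM] := xM.
pose mix y (s : seq 'I_N) : 'rV[R]_N :=
  \row_j if j \in s then y 0 j else x 0 j.
have step y (k : 'I_N) (s : seq 'I_N) : ball x r y ->
   `|u (mix y (k :: s)) - u (mix y s)| <= M * `|y 0 k - x 0 k|.
  move=> [_ xy]; set z := mix y; have [ks|ks] := boolP (k \in s).
    rewrite (_ : z (k :: s) = z s).
      by rewrite subrr normr0 mulr_ge0// ltW.
    by apply/rowP => j; rewrite !mxE in_cons; case: eqVneq => // ->; rewrite ks.
  have line (t : R) : is_derive t 1 (fun t : R => u (z s + t *: delta_mx 0 k))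
      (partial k u (z s + t *: delta_mx 0 k)).
    by apply: derivable_line; have [] := C1 (z s + t *: delta_mx 0 k) I k.
  have zk : z (k :: s) = z s + (y 0 k - x 0 k) *: delta_mx 0 k.
    apply/rowP => j; rewrite !mxE in_cons eqxx/=; case: eqVneq => [->|_] /=.
      by rewrite (negPf ks) mulr1 addrC subrK.
    by rewrite mulr0 addr0.
  have := mean_value_bound (a := 0) (b := y 0 k - x 0 k) (M := M) line.
  rewrite scale0r addr0 subr0 -zk => H.
  apply: (le_trans (H _)).
    move=> t tk; apply: xM; split => // i j; rewrite ord1 /ball/= !mxE eqxx/=.
    have := xy 0 j; rewrite /ball/=.
    have [->|_] := eqVneq j k; last first.
      rewrite mulr0 addr0; case: ifP => // _.
      by rewrite subrr normr0.
    rewrite (negPf ks) mulr1 opprD addrA subrr sub0r normrN.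
    move: tk; rewrite /Num.min /Num.max !ltr_norml.
    by repeat case: ifPn; rewrite -?leNgt => *; lra.
  by [].
apply/(@cvgrPdistC_le _ _ _ _ (nbhs_filter x)) => e e0.
pose c := e / (M * N.+1%:R).
have c0 : 0 < c by rewrite divr_gt0 ?mulr_gt0.
apply/nbhs_ballP; exists (Num.min r c) => /=; first by rewrite lt_min r0.
move=> y [_ xyrc].
have xy : ball x r y.
  by split => // i j; have := xyrc i j; rewrite /ball/= lt_min => /andP[].
have yc k : `|y 0 k - x 0 k| <= c.
  by have := xyrc 0 k; rewrite /ball/= lt_min distrC => /andP[_ /ltW].
have H s : `|u (mix y s) - u x|
    <= (size s)%:R * (M * c).
  elim: s => [|k s IH].
    rewrite (_ : mix y _ = x) ?subrr ?normr0 ?mul0r//.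
    by apply/rowP => j; rewrite mxE.
  rewrite /= -natr1 mulrDl mul1r [leRHS]addrC.
  have Mc : M * `|y 0 k - x 0 k| <= M * c by rewrite ler_wpM2l// ltW.
  apply: (le_trans _ (lerD (le_trans (step y k s xy) Mc) IH)).
  by rewrite (le_trans _ (ler_normD _ _))// addrA subrK.
have := H (enum 'I_N); rewrite (_ : mix y _ = y); last first.
  by apply/rowP => j; rewrite mxE mem_enum.
rewrite size_enum_ord => /le_trans; apply.
apply: (@le_trans _ _ (N.+1%:R * (M * c))).
  by rewrite ler_wpM2r ?ler_nat// mulr_ge0// ltW.
rewrite le_eqVlt; apply/orP; left; apply/eqP; rewrite /c.
have N0 : (N.+1%:R : R) != 0 by rewrite pnatr_eq0.
have M1 : M != 0 by rewrite gt_eqF.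
move: (N.+1%:R : R) N0 => n N0.
by field; apply/andP.
Qed.

Lemma smooth_partial k u : smooth u -> smooth (partial k u).
Proof. by move=> su ks; have := su (rcons ks k); rewrite -cats1 foldr_cat. Qed.

Lemma smooth_derivable k u x : smooth u -> derivable u x (delta_mx 0 k).
Proof. by move=> /(_ [::] x I k)[]. Qed.

Lemma smooth_continuous u : smooth u -> continuous u.
Proof. by move=> /(_ [::]) /C1_continuous. Qed.

(** Smoothness quantifies over all iterated derivatives, so it is proved for
    a class of functions stable under differentiation. *)
Lemma smooth_class (S : set ('rV[R]_N -> R)) :
  (forall f, S f -> continuous f) ->
  (forall f k, S f -> S (partial k f)) ->
  (forall f k x, S f -> derivable f x (delta_mx 0 k)) ->
  S `<=` @smooth R N.
Proof.
move=> Sc SD Sd f Sf ks.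
have S_ : S (foldr (@partial R N) f ks) by elim: (ks) => //= k ks0; exact: SD.
by move=> x _ k; split; [exact: Sd|apply: Sc; exact: SD].
Qed.

Lemma partialD k u v : smooth u -> smooth v ->
  partial k (u \+ v) = partial k u \+ partial k v.
Proof.
by move=> su sv; apply/funext => x; apply: deriveD; exact: smooth_derivable.
Qed.

Lemma partialM k u v : smooth u -> smooth v ->
  partial k (u \* v) = (u \* partial k v) \+ (v \* partial k u).
Proof.
by move=> su sv; apply/funext => x; apply: deriveM; exact: smooth_derivable.
Qed.

(** The Leibniz rule mixes sums and products, so only the class closed under
    both is stable under differentiation. *)
Inductive smooth_ring : set ('rV[R]_N -> R) :=
| smooth_ring_base u : smooth u -> smooth_ring u
| smooth_ringD u v : smooth_ring u -> smooth_ring v -> smooth_ring (u \+ v)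
| smooth_ringM u v : smooth_ring u -> smooth_ring v -> smooth_ring (u \* v).

Lemma smooth_ring_derivable f k x :
  smooth_ring f -> derivable f x (delta_mx 0 k).
Proof.
elim=> {f} [f sf|f g _ df _ dg|f g _ df _ dg]; first exact: smooth_derivable.
- exact: (derivableD df dg).
- exact: (derivableM df dg).
Qed.

Lemma smooth_ring_smooth : smooth_ring `<=` @smooth R N.
Proof.
apply: smooth_class.
- move=> f; elim=> {f} [f|f g _ cf _ cg|f g _ cf _ cg].
  + exact: smooth_continuous.
  + by move=> x; apply: continuousD; [exact: cf|exact: cg].
  + by move=> x; apply: continuousM; [exact: cf|exact: cg].
- move=> f k; elim=> {f} [f sf|f g Sf Sf' Sg Sg'|f g Sf Sf' Sg Sg'].
  + exact/smooth_ring_base/smooth_partial.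
  + rewrite (_ : partial k _ = partial k f \+ partial k g); first exact: smooth_ringD.
    by apply/funext => x; apply: deriveD; exact: smooth_ring_derivable.
  + rewrite (_ : partial k _ = (f \* partial k g) \+ (g \* partial k f)).
      by apply: smooth_ringD; exact: smooth_ringM.
    by apply/funext => x; apply: deriveM; exact: smooth_ring_derivable.
- by move=> f k x; exact: smooth_ring_derivable.
Qed.

Lemma smoothD u v : smooth u -> smooth v -> smooth (u \+ v).
Proof.
by move=> su sv; apply: smooth_ring_smooth; apply: smooth_ringD;
  exact: smooth_ring_base.
Qed.

Lemma smoothM u v : smooth u -> smooth v -> smooth (u \* v).
Proof.
by move=> su sv; apply: smooth_ring_smooth; apply: smooth_ringM;
  exact: smooth_ring_base.
Qed.

Lemma smooth_cst (c : R) : smooth (cst c : 'rV[R]_N -> R).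
Proof.
apply: (@smooth_class [set f | exists a, f = cst a]); last by exists c.
- by move=> _ [a ->]; exact: cst_continuous.
- by move=> _ k [a ->]; exists 0; apply/funext => x; exact: derive_cst.
- by move=> _ k x [a ->]; exact: derivable_cst.
Qed.

Lemma smooth_horner (p : {poly R}) u : smooth u -> smooth (fun x => p.[u x]).
Proof.
move=> su; elim/poly_ind: p => [|p c IH].
  rewrite (_ : (fun _ => _) = cst 0); first exact: smooth_cst.
  by apply/funext => x; rewrite horner0.
rewrite (_ : (fun _ => _) = ((fun x => p.[u x]) \* u) \+ cst c); last first.
  by apply/funext => x; rewrite !hornerE.
by apply: smoothD; [exact: smoothM|exact: smooth_cst].
Qed.

Lemma partial_horner k (p : {poly R}) u x : smooth u ->
  partial k (fun x => p.[u x]) x = p^`().[u x] * partial k u x.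
Proof.
move=> su; elim/poly_ind: p => [|p c IH].
  rewrite (_ : (fun _ => _) = cst 0); last first.
    by apply/funext => y; rewrite horner0.
  by rewrite deriv0 horner0 mul0r; exact: derive_cst.
rewrite (_ : (fun _ => _) = ((fun x => p.[u x]) \* u) \+ cst c); last first.
  by apply/funext => y; rewrite !hornerE.
have sp := smooth_horner p su.
rewrite (partialD k (smoothM sp su) (smooth_cst c)) (partialM k sp su) /=.
rewrite IH [partial k (cst c) x]derive_cst addr0.
rewrite derivD derivC addr0 derivM derivX mulr1 !hornerE mulrDl addrC; congr (_ + _).
exact: (congr1 (fun z => z * _) (mulrC _ _)).
Qed.

End partial_derivatives.

Section test_functions.
Variables (R : realType) (N d : nat) (Omega : set 'rV[R]_N).
Variable X : 'I_d -> 'rV[R]_N -> 'rV[R]_N.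
Implicit Types (phi : 'rV[R]_N -> R).

Lemma test_function_outside phi x :
  test_function Omega phi -> ~ Omega x -> phi x = 0.
Proof.
move=> [_ _ sub] xO; apply: contrapT => /eqP px; apply: xO.
by apply: sub; exact: subset_closure.
Qed.

Lemma test_function_horner phi (p : {poly R}) : p.[0] = 0 ->
  test_function Omega phi -> test_function Omega (fun x => p.[phi x]).
Proof.
move=> p0 [sphi cphi subphi].
have S : closure [set x | p.[phi x] != 0] `<=` closure [set x | phi x != 0].
  apply: closureS => x /=; apply: contra_neq => ->; exact: p0.
split; first exact: smooth_horner.
- by apply: subclosed_compact cphi S; exact: closed_closure.
- exact: subset_trans S subphi.
Qed.

Lemma Xgrad_horner phi (p : {poly R}) x : smooth phi ->
  Xgrad X (fun x => p.[phi x]) x = p^`().[phi x] *: Xgrad X phi x.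
Proof.
move=> sphi; apply/rowP => j; rewrite !mxE mulr_sumr; apply: eq_bigr => k _.
by rewrite partial_horner// mulrCA.
Qed.

Lemma Xgrad_outside phi x :
  test_function Omega phi -> ~ Omega x -> Xgrad X phi x = 0.
Proof.
move=> [_ _ sub] xO; apply/rowP => j; rewrite !mxE big1// => k _.
rewrite (_ : partial k phi x = 0) ?mulr0//.
have phi0 : \near x, (cst 0 : _ -> R) x = phi x.
  have : open_nbhs x (~` closure [set x | phi x != 0]).
    split; last by move=> /sub.
    by apply: closed_openC; exact: closed_closure.
  move=> /open_nbhs_nbhs; apply: filterS => y /= yS; apply: esym.
  by apply: contrapT => /eqP ?; apply: yS; exact: subset_closure.
rewrite /partial -(near_eq_derive _ phi0); exact: derive_cst.
Qed.

Lemma locally_lipschitz_continuous (f : 'rV[R]_N -> 'rV[R]_N) :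
  locally_lipschitz f -> continuous f.
Proof.
move=> lf; suff cf (x : 'rV[R]_N) : f y @[y --> x] --> f x by move=> x; exact: cf.
have [U xU [M [_ MU]]] := lf x.
have {}MU := MU (`|M| + 1) (ltr_pwDr ltr01 (ler_norm _)).
apply/(@cvgrPdist_le _ _ _ _ (nbhs_filter x)) => e e0.
have K0 : 0 < `|M| + 1 by rewrite ltr_pwDr.
near=> y.
apply: (le_trans (MU (x, y) _)) => /=.
  by split; [exact: nbhs_singleton xU|near: y].
rewrite -ler_pdivlMl//; near: y.
by apply: cvgr_dist_le => //; rewrite mulr_gt0 ?invr_gt0.
Unshelve. all: by end_near. Qed.

Hypothesis lipX : forall j, locally_lipschitz (X j).

Lemma continuous_sum (T : topologicalType) n (f : 'I_n -> T -> R) :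
  (forall i, continuous (f i)) -> continuous (fun x => \sum_i f i x).
Proof. by move=> cf; apply: continuous_big => // ; exact: add_continuous. Qed.

Lemma Xgrad_continuous phi j : smooth phi ->
  continuous (fun x => Xgrad X phi x 0 j).
Proof.
move=> sphi.
have -> : (fun x => Xgrad X phi x 0 j) =
    (fun x => \sum_k X j x 0 k * partial k phi x).
  by apply/funext => x; rewrite mxE.
apply: continuous_sum => k x; apply: continuousM.
  apply: (@continuous_comp _ _ _ (X j) (fun v : 'rV[R]_N => v 0 k)).
    exact: (locally_lipschitz_continuous (lipX j)).
  exact: coord_continuous.
exact/smooth_continuous/smooth_partial.
Qed.

Lemma enorm_Xgrad_continuous phi : smooth phi ->
  continuous (fun x => enorm (Xgrad X phi x)).
Proof.
move=> sphi x.
apply: (@continuous_comp _ _ _ (fun x => \sum_i Xgrad X phi x 0 i ^+ 2) Num.sqrt);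
  last exact: sqrt_continuous.
apply: continuous_sum => j y.
rewrite (_ : (fun x => _) =
    (fun x => Xgrad X phi x 0 j) \* (fun x => Xgrad X phi x 0 j)).
  by apply: continuousM; exact: Xgrad_continuous.
by apply/funext => z; rewrite /= expr2.
Qed.

End test_functions.

(** * Means, Hoelder's inequality and dyadic sums *)

Section bounded_means.
Context d (T : measurableType d) (R : realType) (mu : {measure set T -> \bar R}).
Implicit Types (f : T -> R) (A B D : set T).

Lemma bounded_integrable f M D : measurable D -> (mu D < +oo)%E ->
  measurable_fun D f -> (forall x, D x -> `|f x| <= M) ->
  mu.-integrable D (EFin \o f).
Proof.
move=> mD fD mf fM; apply: measurable_bounded_integrable => //.
exists M; split => [|y My x Dx]; first exact: num_real.
by apply: (le_trans (fM _ Dx)); exact: ltW.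
Qed.

Lemma le_Rintegral_subset f A B : measurable A -> measurable B -> A `<=` B ->
  mu.-integrable B (EFin \o f) -> (forall x, B x -> 0 <= f x) ->
  \int[mu]_(x in A) f x <= \int[mu]_(x in B) f x.
Proof.
move=> mA mB AB intf f0; apply: fine_le.
- by apply: integrable_fin_num => //; exact: integrableS AB intf.
- exact: integrable_fin_num.
- apply: ge0_subset_integral => //; first by case/integrableP: intf.
Qed.

Lemma mean_dist_le f M c A B : measurable A -> measurable B -> A `<=` B ->
  (mu B < +oo)%E -> 0 < fine (mu A) ->
  measurable_fun B f -> (forall x, B x -> `|f x| <= M) ->
  `|(fine (mu A))^-1 * \int[mu]_(x in A) f x - c| <=
  (fine (mu A))^-1 * \int[mu]_(x in B) `|f x - c|.
Proof.
move=> mA mB AB fB A0 mf fM.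
have fA : (mu A < +oo)%E by apply: le_lt_trans fB; apply: le_measure; rewrite ?inE.
have mfA : measurable_fun A f by exact: measurable_funS mf.
have icB : mu.-integrable B (EFin \o (fun x => f x - c)).
  apply: (@bounded_integrable _ (M + `|c|)) => //; first exact: measurable_funB.
  by move=> x Bx; rewrite (le_trans (ler_normB _ _))// lerD2r fM.
have iA : mu.-integrable A (EFin \o f).
  by apply: (@bounded_integrable _ M) => // x /AB; exact: fM.
have icA : mu.-integrable A (EFin \o (fun=> c)).
  by apply: (@bounded_integrable _ `|c|).
have -> : (fine (mu A))^-1 * \int[mu]_(x in A) f x - c =
    (fine (mu A))^-1 * \int[mu]_(x in A) (f x - c).
  rewrite RintegralB// Rintegral_cst// mulrBr mulrCA mulVf ?mulr1//.
  by rewrite gt_eqF.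
rewrite normrM gtr0_norm ?invr_gt0// ler_pM2l ?invr_gt0//.
apply: (le_trans (le_normr_Rintegral mA _)); first exact: integrableS AB icB.
apply: le_Rintegral_subset => //.
by have := integrable_norm icB.
Qed.

End bounded_means.

Lemma restrict_EFin_fun (T : Type) (R : realType) (D : set T) (f : T -> R) :
  (EFin \o f) \_ D = EFin \o (f \_ D).
Proof. by apply/funext => x /=; rewrite !patchE; case: ifP. Qed.

Section hoelder_on.
Context d (T : measurableType d) (R : realType) (mu : {measure set T -> \bar R}).
Implicit Types (f g : T -> R).

Lemma Lnorm_restrict D f p : 0 < p ->
  Lnorm mu p%:E ((EFin \o f) \_ D) =
  ((\int[mu]_(x in D) (`|f x| `^ p)%:E) `^ p^-1)%E.
Proof.
move=> p0; rewrite unlock; congr (_ `^ _)%E; rewrite [RHS]integral_mkcond.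
apply: eq_integral => x _; rewrite !patchE; case: ifP => _ //=.
by rewrite normr0 powR0// gt_eqF.
Qed.

Lemma hoelder_on D f g p q : measurable D ->
  measurable_fun D f -> measurable_fun D g ->
  0 < p -> 0 < q -> p^-1 + q^-1 = 1 ->
  (\int[mu]_(x in D) `|f x * g x|%:E <=
    (\int[mu]_(x in D) (`|f x| `^ p)%:E) `^ p^-1 *
    (\int[mu]_(x in D) (`|g x| `^ q)%:E) `^ q^-1)%E.
Proof.
move=> mD mf mg p0 q0 pq.
have mfD : measurable_fun setT (f \_ D) := (measurable_restrictT _ mD).1 mf.
have mgD : measurable_fun setT (g \_ D) := (measurable_restrictT _ mD).1 mg.
have := hoelder mu mfD mgD p0 q0 pq.
rewrite -!restrict_EFin_fun !Lnorm_restrict// Lnorm1; apply: le_trans.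
rewrite integral_mkcond le_eqVlt; apply/orP; left; apply/eqP.
apply: eq_integral => x _; rewrite /= !patchE; case: ifP => _ //.
by rewrite mul0r normr0.
Qed.

End hoelder_on.

Section dyadic_sums.
Variable R : realType.

Lemma cvg_telescope (u b : nat -> R) (L D S : R) : 0 <= D ->
  u k @[k --> \oo] --> L -> (forall k, 0 <= b k) ->
  `|u 0%N| <= D * b 0%N -> (forall k, `|u k.+1 - u k| <= D * b k) ->
  (forall n, \sum_(k < n) b k <= S) -> `|L| <= 2 * D * S.
Proof.
move=> D0 uL b0 u0 du bS.
have ub n : `|u n| <= D * b 0%N + D * \sum_(k < n) b k.
  elim: n => [|n IH]; first by rewrite big_ord0 mulr0 addr0.
  rewrite big_ord_recr /= mulrDr addrA -(subrK (u n) (u n.+1)) addrC.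
  by rewrite (le_trans (ler_normD _ _))// lerD.
have S0 : b 0%N <= S by have := bS 1%N; rewrite big_ord1.
apply: (ler_cvg_to (cvg_norm uL) (cvg_cst (2 * D * S))).
near=> n; apply: (le_trans (ub n)).
have := ler_wpM2l D0 S0; have := ler_wpM2l D0 (bS n); lra.
Unshelve. all: by end_near. Qed.

(** The first bound is small for y 2^k > 1 and the second for y 2^k < 1, so the
    minimum is summable both ways.  The potential [P] drops by at least one
    term when y doubles, which turns the sum into an induction. *)
Lemma dyadic_min_sum (a y : R) n : 0 < a -> 0 < y ->
  \sum_(k < n) Num.min (y * 2 ^+ k)^-1 ((y * 2 ^+ k) `^ a) <=
  (2 `^ a - 1)^-1 + 3.
Proof.
move=> a0 y0; pose kappa := (2 `^ a - 1)^-1.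
have one : 1 `^ a = 1 :> R by rewrite powR1.
have two : 1 < 2 `^ a :> R.
  by rewrite -[ltLHS]one gt0_ltr_powR ?nnegrE// ltr1n.
have kappa0 : 0 < kappa by rewrite invr_gt0 subr_gt0.
have K : kappa * (2 `^ a - 1) = 1 by rewrite mulVf// gt_eqF// subr_gt0.
rewrite -/kappa; clearbody kappa.
pose P z := if 1 <= z then 2 / z else kappa + 3 - kappa * z `^ a.
apply: (@le_trans _ _ (P y)); last first.
  rewrite /P; case: ifPn => [y1|_].
    rewrite ler_pdivrMr//; apply: (@le_trans _ _ (2 * y)); first by rewrite ler_pMr.
    by rewrite ler_wpM2r//; [exact: ltW|lra].
  by rewrite gerBl mulr_ge0 ?powR_ge0// ltW.
elim: n y y0 => [|n IH] y y0.
  rewrite big_ord0 /P; case: ifPn => [y1|]; first by rewrite divr_ge0// ltW.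
  rewrite -ltNge => y1; have : y `^ a <= 1.
    by rewrite -[leRHS]one ge0_ler_powR ?nnegrE// ltW.
  by move=> ya; have := powR_ge0 y a; nra.
rewrite big_ord_recl expr0 mulr1.
have -> : \sum_(i < n) Num.min (y * 2 ^+ lift ord0 i)^-1
      ((y * 2 ^+ lift ord0 i) `^ a) =
    \sum_(k < n) Num.min ((y * 2) * 2 ^+ k)^-1 (((y * 2) * 2 ^+ k) `^ a).
  by apply: eq_bigr => i _; rewrite lift0 exprS mulrA.
apply: (le_trans (lerD (lexx _) (IH (y * 2) _))); first by rewrite mulr_gt0.
have ya0 := powR_ge0 y a.
rewrite /P; case: (leP 1 (y * 2)) => y2; case: (leP 1 y) => y1; last 2 first.
- by exfalso; lra.
- have -> : (y * 2) `^ a = y `^ a * 2 `^ a by rewrite powRM// ltW.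
  have : Num.min y^-1 (y `^ a) <= y `^ a by rewrite ge_min lexx orbT.
  by nra.
- have : Num.min y^-1 (y `^ a) <= y^-1 by rewrite ge_min lexx.
  have -> : 2 / (y * 2) = y^-1 by field; rewrite gt_eqF.
  by rewrite -[2 / y]/(2 * y^-1); lra.
- have : Num.min y^-1 (y `^ a) <= y `^ a by rewrite ge_min lexx orbT.
  have -> : 2 / (y * 2) = y^-1 by field; rewrite gt_eqF.
  have yV : y^-1 <= 2 by rewrite invf_ple ?posrE//; lra.
  have : y `^ a <= 1 by rewrite -[leRHS]one ge0_ler_powR ?nnegrE// ltW.
  by nra.
Qed.

End dyadic_sums.

(** * Volumes of balls *)

Section ball_volumes.
Variables (R : realType) (N d : nat) (X : 'I_d -> 'rV[R]_N -> 'rV[R]_N) (Q : R).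
Hypothesis sa : standing_assumptions X Q.
Local Notation mu := (lebesgueN R N).
Local Notation B := (ccball X).

Let conn := sa_connected sa.
Let topo := sa_topology sa.

Lemma measurable_ccball x r : measurable (B x r : set (lebesgue_space R N)).
Proof. exact/open_lebesgue_measurable/(open_ccball conn topo). Qed.

Lemma le_measure_ccball x r A : measurable (A : set (lebesgue_space R N)) ->
  A `<=` B x r -> (mu A <= mu (B x r))%E.
Proof. by move=> mA AB; apply: le_measure => //; rewrite inE//; exact: measurable_ccball. Qed.

Lemma ccball_measure_gt0 x r : 0 < r -> (0 < mu (B x r))%E.
Proof.
move=> r0; have r2 : 0 < r / 2 by rewrite divr_gt0.
by have /andP[] := sa_doubling sa x r2; rewrite mulrC divfK.
Qed.

Lemma doubling_iter x r n : 0 < r ->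
  (mu (B x (2 ^+ n * r)) <= ((2 `^ Q) ^+ n)%:E * mu (B x r))%E.
Proof.
move=> r0; elim: n => [|n IH]; first by rewrite !expr0 mul1r mul1e.
have rn : 0 < 2 ^+ n * r by rewrite mulr_gt0// exprn_gt0.
have /andP[_] := sa_doubling sa x rn.
rewrite exprS -mulrA => /le_trans; apply.
rewrite [X in (_ <= X%:E * _)%E]exprS EFinM -muleA.
by apply: lee_wpmul2l => //; rewrite lee_fin powR_ge0.
Qed.

(** Small balls are bounded sets, by comparison of the topologies, and doubling
    reaches the large ones. *)
Lemma ccball_measure_lty x r : (mu (B x r) < +oo)%E.
Proof.
have [e e0 eB] := nbhs_ccball conn topo (nbhsx_ballx x 1 ltr01).
have fe : (mu (B x e) < +oo)%E.
  apply: (@le_lt_trans _ _ (mu (ball x 1))); last first.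
    apply: lebesgue_bounded_fin; exists (`|x| + 1); split; first exact: num_real.
    move=> M xM y; rewrite -ball_normE /= => xy; apply: le_trans (ltW xM).
    by rewrite -lerBlDl (le_trans (lerB_dist _ _))// distrC ltW.
  apply: le_measure => //; rewrite inE; first exact: measurable_ccball.
  exact/open_lebesgue_measurable/ball_open.
have [n ne] : exists n, r <= 2 ^+ n * e.
  have [n rn] : exists n, r / e < 2 ^+ n.
    exists (Num.bound `|r / e|); apply: le_lt_trans (ler_norm _) _.
    apply: (lt_trans (archi_boundP (normr_ge0 _))).
    by rewrite -natrX ltr_nat ltn_expl.
  by exists n; rewrite -ler_pdivrMr// ltW.
apply: (@le_lt_trans _ _ (mu (B x (2 ^+ n * e)))).
  apply: le_measure_ccball; [exact: measurable_ccball|exact: le_ccball].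
apply: (le_lt_trans (doubling_iter x n e0)).
by rewrite lte_mul_pinfty// lee_fin exprn_ge0// powR_ge0.
Qed.

Lemma volume_gt0 x r : 0 < r -> 0 < volume (B x r).
Proof. by move=> r0; rewrite fine_gt0// ccball_measure_gt0// ccball_measure_lty. Qed.

Lemma volumeE x r : (volume (B x r))%:E = mu (B x r).
Proof. by rewrite fineK// ge0_fin_numE// ccball_measure_lty. Qed.

Lemma le_volume x y r s : B x r `<=` B y s -> volume (B x r) <= volume (B y s).
Proof.
by move=> H; rewrite -lee_fin !volumeE; apply: le_measure_ccball => //;
  exact: measurable_ccball.
Qed.

Lemma volume_doubling x r n : 0 < r ->
  volume (B x (2 ^+ n * r)) <= (2 `^ Q) ^+ n * volume (B x r).
Proof.
by move=> r0; rewrite -lee_fin EFinM !volumeE; exact: doubling_iter.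
Qed.

End ball_volumes.

(** * Averages over balls *)

Section integral_real.
Context d (T : measurableType d) (R : realType) (mu : {measure set T -> \bar R}).

Lemma EFin_Rintegral (f : T -> R) D : measurable D ->
  mu.-integrable D (EFin \o f) ->
  (\int[mu]_(x in D) f x)%:E = (\int[mu]_(x in D) (f x)%:E)%E.
Proof. by move=> mD fi; rewrite /Rintegral fineK//; exact: integrable_fin_num. Qed.

Lemma le_poweR (x y : \bar R) r :
  0 <= r -> (0 <= x)%E -> (x <= y)%E -> (x `^ r <= y `^ r)%E.
Proof.
move=> r0 x0 xy; have y0 := le_trans x0 xy.
by apply: gt0_ler_poweR => //; rewrite in_itv/= leey andbT.
Qed.

End integral_real.

Lemma compact_support_bounded (R : realType) (T : topologicalType)
    (f : T -> R) K : continuous f -> compact K ->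
  (forall x, ~ K x -> f x = 0) -> exists2 M, 0 <= M & forall x, `|f x| <= M.
Proof.
move=> cf cK f0.
have /compact_bounded[M [_ MK]] : compact (f @` K).
  by apply: continuous_compact => //; exact: continuous_subspaceT.
exists (`|M| + 1) => [|x]; first by rewrite addr_ge0.
have [Kx|/f0 ->] := pselect (K x); last by rewrite normr0 addr_ge0.
by apply: (MK _ (ltr_pwDr ltr01 (ler_norm _))); exists x.
Qed.

Section pointwise.
Variables (R : realType) (N d : nat) (X : 'I_d -> 'rV[R]_N -> 'rV[R]_N) (Q p : R).
Variable Omega : set 'rV[R]_N.
Hypothesis N0 : (0 < N)%N.
Hypothesis sa : standing_assumptions X Q.
Hypothesis pQ : 1 < p < Q.
Hypothesis bO : bounded_set Omega.
Local Notation mu := (lebesgueN R N).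
Local Notation B := (ccball X).
Local Notation space := (lebesgue_space R N).

Let conn := sa_connected sa.
Let topo := sa_topology sa.

Lemma test_function_bounded w : test_function Omega w ->
  exists2 M, 0 <= M & forall x, `|w x| <= M.
Proof.
move=> [sw cw _]; apply: compact_support_bounded cw _.
  exact: smooth_continuous.
move=> x xw; apply: contrapT => /eqP wx; apply: xw; exact: subset_closure.
Qed.

Lemma Xgrad_bounded w : test_function Omega w ->
  exists2 M, 0 <= M & forall x, enorm (Xgrad X w x) <= M.
Proof.
move=> tw; have [sw cw sub] := tw.
have cg : continuous (fun x => enorm (Xgrad X w x)).
  by apply: enorm_Xgrad_continuous => //; exact: sa_lipschitz sa.
have g0 x : ~ closure [set x | w x != 0] x -> enorm (Xgrad X w x) = 0.
  move=> xw; have tw' : test_function (closure [set x | w x != 0]) w by split.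
  by rewrite (Xgrad_outside X tw' xw) enorm0.
have [M M0 HM] := compact_support_bounded cg cw g0.
by exists M => // x; rewrite -[leLHS]ger0_norm ?HM// enorm_ge0.
Qed.

Lemma measurable_smooth w D : smooth w -> measurable (D : set space) ->
  measurable_fun (D : set space) (w : space -> R).
Proof. by move=> sw; apply: continuous_lebesgue_measurable; exact: smooth_continuous. Qed.

Lemma measurable_enorm_Xgrad w D : smooth w -> measurable (D : set space) ->
  measurable_fun (D : set space) (fun x : space => enorm (Xgrad X w x)).
Proof.
move=> sw; apply: continuous_lebesgue_measurable.
by apply: enorm_Xgrad_continuous => //; exact: sa_lipschitz sa.
Qed.

Definition average x r (g : 'rV[R]_N -> R) : R :=
  (volume (B x r))^-1 * \int[mu]_(y in B x r) g y.

Lemma smooth_integrable_ball w x r c : test_function Omega w ->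
  mu.-integrable (B x r : set space) (EFin \o (fun y => `|w y - c|)).
Proof.
move=> tw; have [sw _ _] := tw; have [M M0 wM] := test_function_bounded tw.
apply: (@bounded_integrable _ _ _ _ _ (M + `|c|)).
- exact: measurable_ccball sa _ _.
- exact: ccball_measure_lty sa _ _.
- apply: (measurableT_comp (@normr_measurable R setT)).
  apply: measurable_funB; last exact: measurable_cst.
  by apply: measurable_smooth; [exact: sw|exact: measurable_ccball sa _ _].
- move=> y _; rewrite normr_id (le_trans (ler_normB _ _))//.
  by rewrite lerD2r.
Qed.

Lemma Xgrad_integrable_ball w x r : test_function Omega w ->
  mu.-integrable (B x r : set space) (EFin \o (fun y => enorm (Xgrad X w y))).
Proof.
move=> tw; have [sw _ _] := tw; have [M M0 wM] := Xgrad_bounded tw.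
apply: (@bounded_integrable _ _ _ _ _ M).
- exact: measurable_ccball sa _ _.
- exact: ccball_measure_lty sa _ _.
- by apply: measurable_enorm_Xgrad => //; exact: measurable_ccball sa _ _.
- by move=> y _; rewrite ger0_norm ?enorm_ge0.
Qed.

Lemma poincare_average CP nu w x r : 0 < nu -> poincare X CP nu -> 0 < r ->
  test_function Omega w ->
  \int[mu]_(y in B x r) `|w y - mean (B x r) w| <=
  volume (B x r) * (CP * (r * average x (nu * r) (fun y => enorm (Xgrad X w y)))).
Proof.
move=> nu0 P r0 tw; have [sw _ _] := tw.
have C1w : C1_closure (B x (nu * r)) w.
  by exists setT; split; [exact: openT| |exact: (sw [::])].
have mB r' := measurable_ccball sa x r'.
have := P x r w r0 C1w; cbv zeta.
rewrite -(EFin_Rintegral (mB r) (smooth_integrable_ball x r _ tw)).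
rewrite -(EFin_Rintegral (mB _) (Xgrad_integrable_ball x _ tw)).
rewrite -!EFinM lee_fin mulrC ler_pdivrMr ?(volume_gt0 sa)// /average.
by rewrite mulrC !mulrA.
Qed.

Lemma average_ge0 x r g : 0 < r -> (forall y, 0 <= g y) -> 0 <= average x r g.
Proof.
move=> r0 g0; apply: mulr_ge0; first by rewrite invr_ge0 ltW// (volume_gt0 sa).
by apply: Rintegral_ge0 => y _; exact: g0.
Qed.

Lemma average_le_Lp w x r A : 0 < r -> 0 <= A -> test_function Omega w ->
  (\int[mu]_y (enorm (Xgrad X w y) `^ p)%:E <= (A `^ p)%:E)%E ->
  average x r (fun y => enorm (Xgrad X w y)) <=
  A * (volume (B x r)) `^ (- p^-1).
Proof.
move=> r0 A0 tw gA; have [sw _ _] := tw.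
have [p1 _] := andP pQ; have p0 : 0 < p by rewrite (lt_trans ltr01).
pose q := p / (p - 1).
have q0 : 0 < q by rewrite divr_gt0// subr_gt0.
have pq : p^-1 + q^-1 = 1.
  rewrite /q invf_div; field; by rewrite gt_eqF.
have mB := measurable_ccball sa x r.
have v0 := volume_gt0 sa x r0.
have mg := measurable_enorm_Xgrad sw mB.
have I1 : (\int[mu]_(y in B x r) (`|cst (1 : R) y| `^ q)%:E =
    (volume (B x r))%:E)%E.
  under eq_integral do rewrite normr1 powR1.
  by rewrite integral_cst// mul1e; exact/esym/(volumeE sa).
have := hoelder_on (mu : {measure set space -> \bar R}) mB mg
  (measurable_cst (1 : R)) p0 q0 pq.
under [X in (X <= _)%E -> _]eq_integral do rewrite mulr1 ger0_norm ?enorm_ge0//.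
rewrite -EFin_Rintegral//; last exact: Xgrad_integrable_ball.
under [X in (_ <= X `^ _ * _)%E -> _]eq_integral do
  rewrite ger0_norm ?enorm_ge0//.
rewrite I1 => H.
have {}H : \int[mu]_(y in B x r) enorm (Xgrad X w y) <=
    A * (volume (B x r)) `^ q^-1.
  rewrite -lee_fin EFinM; apply: (le_trans H).
  apply: lee_pmul; [exact: poweR_ge0|exact: poweR_ge0| |by rewrite poweR_EFin].
  have -> : A%:E = ((A `^ p)%:E `^ p^-1)%E.
    by rewrite poweR_EFin -powRrM mulfV ?gt_eqF// powRr1.
  apply: le_poweR; first by rewrite invr_ge0 ltW.
    by apply: integral_ge0 => y _; rewrite lee_fin powR_ge0.
  apply: le_trans gA; apply: ge0_subset_integral.
  - exact: mB.
  - exact: measurableT.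
  - apply/measurable_EFinP; apply: (measurableT_comp (measurable_powR p)).
    exact: measurable_enorm_Xgrad.
  - by move=> y _; rewrite lee_fin powR_ge0.
  - exact: subsetT.
rewrite /average mulrC ler_pdivrMr// (le_trans H)// -mulrA.
rewrite ler_wpM2l// -[X in _ * X]powRr1; last exact: ltW.
rewrite -powRD; last by rewrite (gt_eqF v0) implybT.
by have -> : - p^-1 + 1 = q^-1 by apply/eqP; rewrite addrC subr_eq addrC pq.
Qed.

End pointwise.

(** * Pointwise bounds by averages of the X-gradient *)

Section geometry.
Variables (R : realType) (N d : nat) (X : 'I_d -> 'rV[R]_N -> 'rV[R]_N) (Q p : R).
Variable Omega : set 'rV[R]_N.
Hypothesis N0 : (0 < N)%N.
Hypothesis sa : standing_assumptions X Q.
Hypothesis pQ : 1 < p < Q.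
Hypothesis bO : bounded_set Omega.
Local Notation mu := (lebesgueN R N).
Local Notation B := (ccball X).
Local Notation space := (lebesgue_space R N).

Let conn := sa_connected sa.
Let topo := sa_topology sa.

Lemma coord_le_norm (x : 'rV[R]_N) k : `|x 0 k| <= `|x|.
Proof.
rewrite [leRHS]/Num.norm/= mx_normrE.
exact: (le_bigmax _ (fun i => `|x i.1 i.2|) (0, k)).
Qed.

Lemma outer_ball : exists y e, 0 < e /\ forall z, B y e z -> ~ Omega z.
Proof.
have [M [_ MO]] := bO.
have {}MO x : Omega x -> `|x| <= `|M| + 1.
  by move=> Ox; apply: (MO _ (ltr_pwDr ltr01 (ler_norm _))).
pose y : 'rV[R]_N := const_mx (`|M| + 2).
have [e e0 eB] := nbhs_ccball conn topo (nbhsx_ballx y 1 ltr01).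
exists y, e; split => // z /eB [_ yz] /MO.
pose k := Ordinal N0; have := yz 0 k; rewrite /ball /= mxE ltr_norml.
by have := coord_le_norm z k; have := ler_norm (z 0 k); lra.
Qed.

(** A compact cube is covered by finitely many balls of integer radius. *)
Lemma bounded_sub_ccball y : exists n : nat, Omega `<=` B y n%:R.
Proof.
have [M [_ MO]] := bO.
pose K : set 'rV[R]_N := [set x | forall k, `[- (`|M| + 1), `|M| + 1]%classic (x 0 k)].
have cK : compact K := rV_compact (fun _ => @segment_compact R _ _).
have KB : cover_compact K by rewrite -compact_cover.
have [||D _ KD] := KB nat setT (fun n => B y n%:R).
- by move=> n _; exact: (open_ccball conn topo).
- move=> x _; exists (Num.bound (ccdist X y x)) => //.
  exact: (archi_boundP (ccdist_ge0 conn y x)).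
exists (\max_(n <- finmap.enum_fset D) n)%N => x Ox.
have /KD [n /= nD xn] : K x.
  move=> k; rewrite /= in_itv/= -ler_norml (le_trans (coord_le_norm x k))//.
  exact: (MO _ (ltr_pwDr ltr01 (ler_norm _))).
apply: le_ccball xn; rewrite ler_nat.
by apply: (@leq_bigmax_seq _ (finmap.enum_fset D) xpredT id n).
Qed.

(** Data for the start of the telescoping: a ball around [y] outside the
    domain, and a radius [L] for which every ball centred in the domain
    contains it, with volumes between [v] and [V]. *)
Lemma sobolev_geometry : exists y e L V v, [/\ [/\ 0 < e, 0 < L & 0 < v],
  forall z, B y e z -> ~ Omega z,
  forall x, Omega x -> B y e `<=` B x L,
  forall x, Omega x -> volume (B x L) <= V &
  forall x, Omega x -> v <= volume (B x L)].
Proof.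
have [y [e [e0 yO]]] := outer_ball.
have [n On] := bounded_sub_ccball y.
exists y, e, (n%:R + e), (volume (B y (2 * n%:R + e))), (volume (B y e)).
split => //.
- by split; rewrite // ?ltr_wpDl// (volume_gt0 sa).
- by move=> x /On; rewrite /ccball/= => xy; apply: ccball_sub => //; rewrite ccdistC lerD2r ltW.
- move=> x /On; rewrite /ccball/= => xy; apply: (le_volume sa).
  by apply: ccball_sub => //; lra.
- move=> x /On; rewrite /ccball/= => xy; apply: (le_volume sa).
  by apply: ccball_sub => //; rewrite ccdistC lerD2r ltW.
Qed.

End geometry.

Section pointwise_bound.
Variables (R : realType) (N d : nat) (X : 'I_d -> 'rV[R]_N -> 'rV[R]_N) (Q p : R).
Variable Omega : set 'rV[R]_N.
Hypothesis N0 : (0 < N)%N.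
Hypothesis sa : standing_assumptions X Q.
Hypothesis pQ : 1 < p < Q.
Hypothesis bO : bounded_set Omega.
Local Notation mu := (lebesgueN R N).
Local Notation B := (ccball X).
Local Notation space := (lebesgue_space R N).
Local Notation grad w := (fun y => enorm (Xgrad X w y)).

Let conn := sa_connected sa.
Let topo := sa_topology sa.

Lemma mean_cvg w x L : 0 < L -> test_function Omega w ->
  mean (B x (L / 2 ^+ k)) w @[k --> \oo] --> w x.
Proof.
move=> L0 tw; have [sw _ _] := tw; have [M M0 wM] := test_function_bounded tw.
apply/cvgrPdist_le => e e0.
have [r r0 rw] : exists2 r, 0 < r & B x r `<=` [set y | `|w y - w x| <= e].
  apply: (nbhs_ccball conn topo).
  have cw : w z @[z --> x] --> w x by exact: smooth_continuous.
  exact: (cvgr_distC_le w (w x) cw e e0).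
have : (fun k => L / 2 ^+ k) @ \oo --> (0 : R).
  have c : (2^-1 ^+ k : R) @[k --> \oo] --> (0 : R).
    by apply: cvg_expr; rewrite ger0_norm// invf_lt1// ltr1n.
  rewrite (_ : (fun k => _) = (fun k => L * 2^-1 ^+ k)); last first.
    by apply/funext => k; rewrite exprVn.
  by rewrite -[0](mulr0 L); exact: cvgM (cvg_cst L) c.
move=> /cvgr_lt /(_ _ r0) [n _ nr]; exists n => // k /nr /= kr.
have mB := measurable_ccball sa x (L / 2 ^+ k).
have v0 : 0 < volume (B x (L / 2 ^+ k)).
  by rewrite (volume_gt0 sa)// divr_gt0// exprn_gt0.
rewrite distrC.
apply: (le_trans (mean_dist_le (M := M) (w x) mB mB _ _ v0 _ _)) => //.
- exact: ccball_measure_lty sa _ _.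
- exact: measurable_smooth.
rewrite ler_pdivrMl//.
have -> : volume (B x (L / 2 ^+ k)) * e = \int[mu]_(y in B x (L / 2 ^+ k)) e.
  by rewrite Rintegral_cst// mulrC.
apply: le_Rintegral => //.
- exact: (smooth_integrable_ball sa _ _ _ tw).
- apply: (bounded_integrable (M := `|e|)) => //.
  exact: ccball_measure_lty sa _ _.
- by move=> y xy; apply: rw; exact: le_ccball (ltW kr) _ xy.
Qed.

(** Telescoping of means over dyadic balls shrinking to the point; the first
    mean is controlled because w vanishes on a ball of fixed size. *)
Lemma dyadic_average_bound : exists D L s, [/\ 0 < L, 0 < s &
  forall w x S, test_function Omega w -> Omega x ->
   (forall n, \sum_(k < n) (L / 2 ^+ k) * average X x (s / 2 ^+ k) (grad w) <= S) ->
   `|w x| <= D * S].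
Proof.
have [y [e [L [V [v [[e0 L0 v0] yO yx xV _]]]]]] := sobolev_geometry N0 sa bO.
have [CP [nu [CP0 nu0 P]]] := sa_poincare sa.
have mu0 : 0 < volume (B y e) by exact: (volume_gt0 sa y e0).
pose D := Num.max (2 `^ Q * CP) (V * CP / volume (B y e)).
have D0 : 0 <= D by rewrite le_max mulr_ge0// ?powR_ge0 ?ltW.
exists (2 * D), L, (nu * L); split => //; first exact: mulr_gt0.
move=> w x S tw Ox bS; have [sw _ _] := tw.
have [M M0 wM] := test_function_bounded tw.
pose r k := L / 2 ^+ k.
have r0 k : 0 < r k by rewrite divr_gt0// exprn_gt0.
have E k : nu * L / 2 ^+ k = nu * r k by rewrite /r mulrA.
pose m k := average X x (nu * r k) (grad w).
have m0 k : 0 <= m k.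
  apply: (average_ge0 sa); first by rewrite mulr_gt0.
  by move=> z; exact: enorm_ge0.
have PB k : \int[mu]_(z in B x (r k)) `|w z - mean (B x (r k)) w| <=
    volume (B x (r k)) * (CP * (r k * m k)).
  exact: (poincare_average sa x nu0 P (r0 k) tw).
have mB k := measurable_ccball sa x (r k).
have fB k := ccball_measure_lty sa x (r k).
have vB k := volume_gt0 sa x (r0 k).
apply: (@cvg_telescope R (fun k => mean (B x (r k)) w) (fun k => r k * m k)
  (w x) D S D0 (@mean_cvg w x L L0 tw)); last first.
- by move=> n; have := bS n; under eq_bigr do rewrite E.
- move=> k; rewrite -/(r k) -/(r k.+1).
  have rk : r k = 2 ^+ 1 * r k.+1.
    by rewrite expr1 /r exprS invfM mulrCA mulVKf// pnatr_eq0.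
  have sub : B x (r k.+1) `<=` B x (r k).
    by apply: le_ccball; rewrite rk expr1 ler_pMl// ler1n.
  have mw := measurable_smooth sw (mB k).
  apply: (le_trans (mean_dist_le _ (mB k.+1) (mB k) sub (fB k) (vB k.+1) mw
    (fun y _ => wM y))).
  apply: (@le_trans _ _ (2 `^ Q * CP * (r k * m k))); last first.
    by rewrite ler_wpM2r ?le_max ?lexx// mulr_ge0// ltW.
  rewrite ler_pdivrMl; last exact: vB.
  apply: (le_trans (PB k)).
  have vd : volume (B x (r k)) <= 2 `^ Q * volume (B x (r k.+1)).
    by rewrite [X in B x X]rk; have := volume_doubling sa x 1 (r0 k.+1); rewrite expr1.
  have t0 : 0 <= CP * (r k * m k) by apply: mulr_ge0; [exact: ltW|rewrite mulr_ge0// ltW].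
  apply: (le_trans (ler_wpM2r t0 vd)); rewrite le_eqVlt; apply/orP; left.
  by apply/eqP; rewrite -/(volume (B x (r k.+1))); ring.
- set u0 := mean _ w.
  have rL : r 0%N = L by rewrite /r expr0 divr1.
  have H : volume (B y e) * `|u0| <= V * CP * (r 0%N * m 0%N).
    apply: (@le_trans _ _ (\int[mu]_(z in B x (r 0%N)) `|w z - u0|)).
      have -> : volume (B y e) * `|u0| = \int[mu]_(z in B y e) `|w z - u0|.
        rewrite mulrC -Rintegral_cst; last exact: measurable_ccball sa _ _.
        apply: eq_Rintegral => z /set_mem yz.
        by rewrite (test_function_outside tw (yO _ yz)) sub0r normrN.
      apply: le_Rintegral_subset => //; first exact: measurable_ccball sa _ _.
        by rewrite rL; exact: yx.
      exact: (smooth_integrable_ball sa _ _ _ tw).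
    apply: (le_trans (PB 0%N)).
    rewrite -mulrA ler_wpM2r//.
      by apply: mulr_ge0; [exact: ltW|rewrite mulr_ge0// ltW].
    by rewrite rL xV.
  apply: (@le_trans _ _ (V * CP / volume (B y e) * (r 0%N * m 0%N))).
    by rewrite mulrAC ler_pdivlMr// mulrC.
  by rewrite ler_wpM2r ?le_max ?lexx ?orbT// mulr_ge0// ltW.
- by move=> k; rewrite mulr_ge0// ltW.
Qed.

End pointwise_bound.

Lemma powR_exprn (R : realType) (x s : R) n : 0 <= x -> (x ^+ n) `^ s = (x `^ s) ^+ n.
Proof.
move=> x0; elim: n => [|n IH]; first by rewrite !expr0 powR1.
by rewrite !exprS powRM ?exprn_ge0// IH.
Qed.

Section hedberg.
Variables (R : realType) (N d : nat) (X : 'I_d -> 'rV[R]_N -> 'rV[R]_N) (Q p : R).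
Variable Omega : set 'rV[R]_N.
Hypothesis N0 : (0 < N)%N.
Hypothesis sa : standing_assumptions X Q.
Hypothesis pQ : 1 < p < Q.
Hypothesis bO : bounded_set Omega.
Local Notation mu := (lebesgueN R N).
Local Notation B := (ccball X).
Local Notation grad w := (fun y => enorm (Xgrad X w y)).

(** Iterated doubling, up to a ball that contains a fixed one: this is how the
    homogeneous dimension Q enters the Sobolev exponent. *)
Lemma volume_lower_bound s : 0 < s -> exists2 v, 0 < v &
  forall x k, Omega x -> v <= (2 ^+ k) `^ Q * volume (B x (s / 2 ^+ k)).
Proof.
move=> s0.
have [y [e [L [V [v [[e0 L0 v0] _ _ _ vx]]]]]] := sobolev_geometry N0 sa bO.
have [n sn] : exists n, L <= 2 ^+ n * s.
  exists (Num.bound `|L / s|); rewrite -ler_pdivrMr//.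
  apply: le_trans (ler_norm _) _; apply: ltW.
  apply: (lt_trans (archi_boundP (normr_ge0 _))).
  by rewrite -natrX ltr_nat ltn_expl.
have c0 : 0 < (2 `^ Q) ^+ n :> R by rewrite exprn_gt0// powR_gt0.
exists (v / (2 `^ Q) ^+ n) => [|x k Ox]; first exact: divr_gt0.
rewrite ler_pdivrMr//; apply: (le_trans (vx x Ox)).
have sk : 0 < s / 2 ^+ k by rewrite divr_gt0// exprn_gt0.
apply: (@le_trans _ _ (volume (B x (2 ^+ n * s)))).
  by apply: (le_volume sa); apply: le_ccball.
apply: (le_trans (volume_doubling sa x n s0)); rewrite mulrC ler_pM2r//.
have := volume_doubling sa x k sk; rewrite mulrC divfK; last first.
  by rewrite expf_neq0// pnatr_eq0.
move=> /le_trans; apply; rewrite le_eqVlt; apply/orP; left; apply/eqP.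
by rewrite powR_exprn.
Qed.

(** Hedberg's splitting: the k-th average is at most [tau] by hypothesis, and at
    most a multiple of 2^(kQ/p) [A] by Hoelder's inequality. *)
Lemma pointwise_bound : exists C s, [/\ 0 < C, 0 < s &
  forall w x tau A, test_function Omega w -> Omega x -> 0 < tau -> 0 < A ->
   (\int[mu]_y (enorm (Xgrad X w y) `^ p)%:E <= (A `^ p)%:E)%E ->
   (forall k, average X x (s / 2 ^+ k) (grad w) <= tau) ->
   `|w x| <= C * (tau * (A / tau) `^ (p / Q))].
Proof.
have [D [L [s [L0 s0 DH]]]] := dyadic_average_bound N0 sa bO.
have [v v0 vx] := volume_lower_bound s0.
have [p1 pltQ] := andP pQ; have p0 : 0 < p by rewrite (lt_trans ltr01).
have Q0 : 0 < Q by rewrite (lt_trans p0).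
pose a := Q / p - 1.
have a0 : 0 < a by rewrite subr_gt0 ltr_pdivlMr// mul1r.
pose C1 := Num.max 1 (v `^ (- p^-1)).
have C10 : 0 < C1 by rewrite lt_max ltr01.
pose K : R := (2 `^ a - 1)^-1 + 3.
have K0 : 0 < K.
  rewrite addr_gt0// invr_gt0 subr_gt0.
  have one : 1 `^ a = 1 :> R by rewrite powR1.
  by rewrite -[ltLHS]one gt0_ltr_powR ?nnegrE// ltr1n.
exists (`|D| * (L * C1 * K) + 1), s; split => //.
  by rewrite ltr_wpDl// ?mulr_ge0// ltW.
move=> w x tau A tw Ox tau0 A0 gA mt.
(* Both bounds on the k-th average agree, up to a constant, at z 2^k = 1. *)
pose z := (A / tau) `^ (p / Q).
have z0 : 0 < z by rewrite powR_gt0// divr_gt0.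
have zs : z `^ (Q / p) = A / tau.
  have pp : p / Q * (Q / p) = 1 by field; rewrite !gt_eqF.
  by rewrite -powRrM pp powRr1// ltW// divr_gt0.
suff /(DH w x _ tw Ox) h : forall n,
    \sum_(k < n) (L / 2 ^+ k) * average X x (s / 2 ^+ k) (grad w)
      <= L * C1 * (tau * z) * K.
  apply: (le_trans h); rewrite -/z.
  have t0 : 0 < tau * z by exact: mulr_gt0.
  have u0 : 0 <= L * C1 * K by rewrite ltW// !mulr_gt0.
  have := ler_wpM2r (mulr_ge0 u0 (ltW t0)) (ler_norm D).
  by nra.
move=> n; apply: (@le_trans _ _ (L * C1 * (tau * z) *
   \sum_(k < n) Num.min (z * 2 ^+ k)^-1 ((z * 2 ^+ k) `^ a))); last first.
  apply: ler_wpM2l; first by rewrite ltW// !mulr_gt0.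
  exact: dyadic_min_sum.
rewrite mulr_sumr; apply: ler_sum => k _.
set T := 2 ^+ k; have T0 : 0 < T :> R by rewrite exprn_gt0.
set m := average _ _ _ _.
have sk : 0 < s / T by rewrite divr_gt0.
have m2 : m <= C1 * (A * T `^ (Q / p)).
  apply: (le_trans (average_le_Lp sa pQ x sk (ltW A0) tw gA)).
  rewrite mulrCA ler_wpM2l//; first exact: ltW.
  have V0 := volume_gt0 sa x sk.
  apply: (@le_trans _ _ (v `^ (- p^-1) * T `^ (Q / p))); last first.
    by rewrite ler_wpM2r ?powR_ge0// le_max lexx orbT.
  have -> : T `^ (Q / p) = (T `^ Q) `^ p^-1 by rewrite -powRrM.
  rewrite !powRN ler_pdivlMl ?powR_gt0// ler_pdivrMr ?powR_gt0//.
  rewrite -powRM ?powR_ge0 ?(ltW V0)//.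
  apply: ge0_ler_powR; rewrite ?nnegrE ?invr_ge0 ?(ltW p0) ?(ltW v0)//.
    by rewrite mulr_ge0 ?powR_ge0 ?(ltW V0).
  exact: vx.
have m1 : m <= C1 * tau.
  apply: (le_trans (mt k)); apply: ler_peMl; first exact: ltW.
  by rewrite le_max lexx.
have -> : L * C1 * (tau * z) * Num.min (z * T)^-1 ((z * T) `^ a) =
   (L / T) * (C1 * Num.min tau (A * T `^ (Q / p))).
  have zT0 : 0 < z * T by exact: mulr_gt0.
  have E1 : tau = tau * z * T * (z * T)^-1.
    by field; rewrite !gt_eqF.
  have E2 : A * T `^ (Q / p) = tau * z * T * (z * T) `^ a.
    have -> : A = tau * z `^ (Q / p) by rewrite zs mulrC divfK// gt_eqF.
    rewrite -mulrA -powRM ?(ltW z0) ?(ltW T0)//.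
    have -> : Q / p = a + 1 by rewrite subrK.
    rewrite powRD; last by rewrite (gt_eqF zT0) implybT.
    by rewrite powRr1 ?(ltW zT0)//; ring.
  have -> : Num.min tau (A * T `^ (Q / p)) =
      tau * z * T * Num.min (z * T)^-1 ((z * T) `^ a).
    by rewrite minr_pMr ?(ltW (mulr_gt0 (mulr_gt0 tau0 z0) T0))// -E1 -E2.
  by field; rewrite gt_eqF.
rewrite ler_pM2l ?divr_gt0// minr_pMr ?(ltW C10)// le_min m1.
exact: m2.
Qed.

(** If every average were at most half the left-hand side, the pointwise bound
    would make that side at most half of itself. *)
Lemma average_witness : exists2 C : R, 0 < C &
  forall w x A, test_function Omega w -> 0 < A ->
   (\int[mu]_y (enorm (Xgrad X w y) `^ p)%:E <= (A `^ p)%:E)%E ->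
   w x != 0 -> exists2 r, 0 < r &
     C * (`|w x| `^ (Q / (Q - p)) * A `^ (1 - Q / (Q - p))) <
       2 * average X x r (grad w).
Proof.
have [p1 pltQ] := andP pQ; have p0 : 0 < p by rewrite (lt_trans ltr01).
have Q0 : 0 < Q by rewrite (lt_trans p0).
have Qp : 0 < Q - p by rewrite subr_gt0.
have [C [s [C0 s0 H]]] := pointwise_bound.
pose e := Q / (Q - p).
have e0 : 0 < e by rewrite divr_gt0.
exists (C `^ (- e)); rewrite ?powR_gt0// -/e.
move=> w x A tw A0 gA wx0.
have Ox : Omega x.
  by apply: contrapT => /(test_function_outside tw) /eqP; apply/negP.
set W := _ * _; have W0 : 0 < W by rewrite !mulr_gt0 ?powR_gt0// normr_gt0.
apply: contrapT => noT.
have t0 : 0 < W / 2 by rewrite divr_gt0.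
have mk k : average X x (s / 2 ^+ k) (grad w) <= W / 2.
   rewrite leNgt; apply/negP => lt; apply: noT.
  exists (s / 2 ^+ k); first by rewrite divr_gt0// exprn_gt0.
  by move: lt; rewrite ltr_pdivrMr// mulrC.
have := H w x (W / 2) A tw Ox t0 A0 gA mk; rewrite -/e; move: t0.
set t := W / 2 => t0 wt; have tW : W = 2 * t by rewrite mulrC divfK.
clearbody t.
have : `|w x| `^ e <= C `^ e * (t * A `^ (e - 1)).
  apply: (le_trans (ge0_ler_powR _ _ _ wt)); rewrite ?nnegrE ?(ltW e0)//.
    by rewrite !mulr_ge0 ?powR_ge0// ltW.
  rewrite powRM ?mulr_ge0 ?powR_ge0 ?(ltW C0) ?(ltW t0)//.
  rewrite ler_pM2l ?powR_gt0// powRM ?powR_ge0 ?(ltW t0)// -powRrM.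
  rewrite powRM ?invr_ge0 ?(ltW A0) ?(ltW t0)//.
  have -> : p / Q * e = e - 1.
    by rewrite /e; field; rewrite !gt_eqF.
  have tE : t `^ e * (t^-1) `^ (e - 1) = t.
    rewrite -[t^-1]powR_inv1 ?(ltW t0)// -powRrM mulN1r.
    rewrite -powRD; last by rewrite (gt_eqF t0) implybT.
    by rewrite opprB addrC subrK powRr1 ?(ltW t0).
  by rewrite mulrCA tE mulrC.
move=> h.
have : W <= t.
  rewrite /W mulrA -ler_pdivlMr ?powR_gt0// -powRN opprB.
  by rewrite powRN ler_pdivrMl ?powR_gt0.
by lra.
Qed.

End hedberg.

(** * The maximal inequality *)

Section vitali.
Variables (R : realType) (N d : nat) (X : 'I_d -> 'rV[R]_N -> 'rV[R]_N) (Q : R).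
Hypothesis sa : standing_assumptions X Q.
Local Notation mu := (lebesgueN R N).
Local Notation B := (ccball X).
Local Notation space := (lebesgue_space R N).
Implicit Types (h g : 'rV[R]_N -> R) (l : seq ('rV[R]_N * R)).

Let conn := sa_connected sa.
Let topo := sa_topology sa.

Definition balls l : set 'rV[R]_N := [set x | exists2 b, b \in l & B b.1 b.2 x].

Lemma measurable_balls l : measurable (balls l : set space).
Proof.
rewrite (_ : balls l = \big[setU/set0]_(b <- l) B b.1 b.2).
  apply: bigsetU_measurable => b _; exact: (measurable_ccball sa).
apply/seteqP; split => x /=.
  by move=> [b bl xb]; rewrite -bigcup_seq; exists b.
by rewrite -bigcup_seq => -[b bl xb]; exists b.
Qed.

(** Vitali covering, as an induction: the largest ball is removed together with
    all balls meeting it.  They lie in its dilate by 3, hence by 2^2, whose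
    volume is at most 2^(2Q) times larger. *)
Lemma vitali_bound h c l : measurable_fun setT (h : space -> R) ->
  (forall x, 0 <= h x) -> 0 <= c ->
  (forall b, b \in l -> 0 < b.2 /\
     (c%:E * mu (B b.1 b.2) <= \int[mu]_(x in B b.1 b.2) (h x)%:E)%E) ->
  (c%:E * mu (balls l) <=
    ((2 `^ Q) ^+ 2)%:E * \int[mu]_(x in balls l) (h x)%:E)%E.
Proof.
move=> mh h0 c0; have [n] := ubnP (size l); elim: n l => // n IH l ln hl.
have mhE D : measurable (D : set space) ->
    measurable_fun (D : set space) (fun x : space => (h x)%:E).
  by move=> mD; apply/measurable_EFinP; exact: measurable_funTS.
have [l0|] := eqVneq l [::].
  rewrite (_ : balls l = set0).
    by rewrite measure0 mule0 integral_set0 mule0.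
  by apply/seteqP; split => // x [b]; rewrite l0.
move=> lN.
have [b0 b0l bmax] : exists2 b0, b0 \in l & forall b, b \in l -> b.2 <= b0.2.
  clear -lN; elim: l lN => // b l IH _; have [->|/IH[b1 b1l bm]] := eqVneq l [::].
    by exists b; rewrite ?mem_head// => c; rewrite inE => /eqP ->.
  have [bb|bb] := leP b.2 b1.2.
    exists b1; first by rewrite inE b1l orbT.
    by move=> c; rewrite inE => /predU1P[->|/bm].
  exists b; first by rewrite mem_head.
  move=> c; rewrite inE => /predU1P[->//|/bm]/le_trans; apply; exact: ltW.
have [r0 hb0] := hl _ b0l.
pose far b := `[< B b.1 b.2 `&` B b0.1 b0.2 = set0 >].
pose l' := [seq b <- l | far b].
have l'n : (size l' < n)%N.
  rewrite ltnS in ln; apply: (leq_trans _ ln).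
  rewrite size_filter ltn_neqAle -all_count count_size andbT.
  apply/allPn; exists b0 => //=; apply/asboolPn.
  rewrite setIid => /seteqP[+ _] => /(_ b0.1); apply.
  exact: (ccball_center conn).
have {}IH := IH l' l'n (fun b bl' => hl b (mem_subseq (filter_subseq _ _) bl')).
have r4 : 0 < 2 ^+ 2 * b0.2 by rewrite mulr_gt0.
have cover : balls l `<=` B b0.1 (2 ^+ 2 * b0.2) `|` balls l'.
  move=> x [b bl xb]; have [fb|/asboolPn nf] := boolP (far b).
    by right; exists b => //; rewrite mem_filter fb.
  left; have /set0P[z [zb zb0]] : B b.1 b.2 `&` B b0.1 b0.2 != set0 by exact/eqP.
  have := @ccball_engulf _ _ _ _ conn _ _ _ _ _ (bmax _ bl) zb zb0 x xb.
  apply: le_ccball; rewrite ler_pM2r//; lra.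
have dis : [disjoint B b0.1 b0.2 & balls l'].
  apply/disj_setPS => x [xb0 [b]]; rewrite mem_filter => /andP[/asboolP fb _] xb.
  by rewrite -fb.
have sub : B b0.1 b0.2 `|` balls l' `<=` balls l.
  move=> x [xb0|[b]]; first by exists b0.
  by rewrite mem_filter => /andP[_ bl] xb; exists b.
have mB := measurable_ccball sa.
have mb := measurable_balls.
apply: (@le_trans _ _ (c%:E * (mu (B b0.1 (2 ^+ 2 * b0.2)) + mu (balls l')))%E).
  apply: lee_wpmul2l; first by rewrite lee_fin.
  apply: (@le_trans _ _ (mu (B b0.1 (2 ^+ 2 * b0.2) `|` balls l'))).
    by apply: le_measure => //; rewrite inE//; exact: measurableU.
  exact: measureU2.
rewrite ge0_muleDr//.
apply: (@le_trans _ _ (((2 `^ Q) ^+ 2)%:E *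
    (\int[mu]_(x in B b0.1 b0.2) (h x)%:E + \int[mu]_(x in balls l') (h x)%:E))%E).
  rewrite ge0_muleDr; last 2 first.
  - by apply: integral_ge0 => x _; rewrite lee_fin.
  - by apply: integral_ge0 => x _; rewrite lee_fin.
  apply: leeD => //; apply: (@le_trans _ _
    (c%:E * (((2 `^ Q) ^+ 2)%:E * mu (B b0.1 b0.2)))%E).
    by apply: lee_wpmul2l; [rewrite lee_fin|exact: doubling_iter].
  rewrite muleCA; apply: lee_wpmul2l; last exact: hb0.
  by rewrite lee_fin exprn_ge0// powR_ge0.
apply: lee_wpmul2l; first by rewrite lee_fin exprn_ge0// powR_ge0.
have mU : measurable (B b0.1 b0.2 `|` balls l' : set space).
  by apply: measurableU; [exact: mB|exact: mb].
have hE0 D x : D x -> (0 <= (h x)%:E)%E by rewrite lee_fin.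
rewrite -(ge0_integral_setU mu (mB _ _) (mb l') (mhE _ mU) (hE0 _) dis).
exact: (ge0_subset_integral mu mU (mb l) (mhE _ (mb l)) (hE0 _) sub).
Qed.

Lemma measurable_truncation g t : measurable_fun setT (g : space -> R) ->
  measurable_fun setT (fun x : space => if t < 4 * g x then g x else 0).
Proof.
move=> mg; apply: measurable_fun_ifT; [|exact: mg|exact: measurable_cst].
apply: measurable_fun_ltr; first exact: measurable_cst.
by apply: measurable_funM; [exact: measurable_cst|exact: mg].
Qed.

(** Compactness of [K] makes the Vitali covering finite.  The values of [g] below
    t / 4 contribute at most half of an average exceeding t / 2, so they can
    be discarded; this is what makes the bounds for all levels summable. *)
Lemma maximal_weak g K t : measurable_fun setT (g : space -> R) ->
  (forall x, 0 <= g x) ->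
  (forall x r, mu.-integrable (B x r : set space) (EFin \o g)) ->
  0 < t -> compact K ->
  (forall x, K x -> exists2 r, 0 < r & t < 2 * average X x r g) ->
  (t%:E * mu K <= (4 * (2 `^ Q) ^+ 2)%:E *
     \int[mu]_x ((if t < 4 * g x then g x else 0)%:E))%E.
Proof.
move=> mg g0 gi t0 cK Kr.
pose h x := if t < 4 * g x then g x else 0.
have mh : measurable_fun setT (h : space -> R).
  exact: measurable_truncation.
have h0 x : 0 <= h x by rewrite /h; case: ifP.
have [r rP] : {r : 'rV[R]_N -> R &
    forall x, K x -> 0 < r x /\ t < 2 * average X x (r x) g}.
  apply: (@choice _ _ (fun x r => K x -> 0 < r /\ t < 2 * average X x r g)) => x.
  by have [/Kr[r]|] := pselect (K x); [exists r|exists 0].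
have : cover_compact K by rewrite -compact_cover.
move=> /(_ _ K (fun x => B x (r x))) [||D Dsub KD].
- by move=> x _; exact: (open_ccball conn topo).
- by move=> x Kx; exists x => //; apply: (ccball_center conn); have [] := rP x Kx.
pose l := [seq (x, r x) | x <- finmap.enum_fset D].
have Kl : K `<=` balls l.
  move=> x /KD[z /= zD xz]; exists (z, r z) => //.
  by apply/mapP; exists z.
have mball x s : measurable (B x s : set space) by exact: (measurable_ccball sa).
have t4 : 0 <= t / 4 by rewrite divr_ge0// ltW.
have lP b : b \in l -> 0 < b.2 /\
    ((t / 4)%:E * mu (B b.1 b.2) <= \int[mu]_(x in B b.1 b.2) (h x)%:E)%E.
  move=> /mapP[x xD ->] /=.
  have [r0 rt] : 0 < r x /\ t < 2 * average X x (r x) g.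
    by apply: rP; have := Dsub x xD; rewrite inE.
  split => //.
  have hint : mu.-integrable (B x (r x) : set space) (EFin \o h).
    apply: le_integrable (gi x (r x)) => //.
      by apply/measurable_EFinP; exact: measurable_funTS.
    move=> y _; rewrite /= !ger0_norm// lee_fin /h; case: ifP => // _; exact: g0.
  rewrite -(volumeE sa) -EFin_Rintegral// -EFinM lee_fin.
  have V0 := volume_gt0 sa x r0.
  have gV : t * volume (B x (r x)) <= 2 * \int[mu]_(y in B x (r x)) g y.
    rewrite -ler_pdivlMr//; apply: (le_trans (ltW rt)).
    by rewrite /average [_^-1 * _]mulrC mulrA.
  have gh : \int[mu]_(y in B x (r x)) g y <=
      \int[mu]_(y in B x (r x)) h y + t / 4 * volume (B x (r x)).
    rewrite -Rintegral_cst// -RintegralD//; last first.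
      by apply: (@bounded_integrable _ _ _ _ _ `|t / 4|) => //; exact: ccball_measure_lty sa _ _.
    apply: le_Rintegral => //.
      apply: (@integrableD _ _ _ mu _ _ (EFin \o h) (EFin \o cst (t / 4))) => //.
      by apply: (@bounded_integrable _ _ _ _ _ `|t / 4|) => //; exact: ccball_measure_lty sa _ _.
    move=> y _; rewrite /h; case: ltP => ty; first by rewrite lerDl.
    by rewrite add0r; move: ty; move: (g y) => z; lra.
  move: gV gh; move: (volume (B x (r x))) (\int[mu]_(y in B x (r x)) g y)
    (\int[mu]_(y in B x (r x)) h y) => V I J; lra.
have H := vitali_bound mh h0 t4 lP.
have hE : (\int[mu]_(x in balls l) (h x)%:E <= \int[mu]_x (h x)%:E)%E.
  apply: ge0_subset_integral.
  - exact: measurable_balls.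
  - exact: measurableT.
  - exact/measurable_EFinP.
  - by move=> x _; rewrite lee_fin.
  - exact: subsetT.
have mK : (mu K <= mu (balls l))%E by apply: le_lebesgue_outer.
have -> : t%:E = (4%:E * (t / 4)%:E)%E by rewrite -EFinM mulrC divfK.
rewrite (EFinM 4 ((2 `^ Q) ^+ 2)) -!muleA; apply: lee_wpmul2l.
  by rewrite lee_fin.
apply: (@le_trans _ _ ((t / 4)%:E * mu (balls l))%E).
  by apply: lee_wpmul2l => //; rewrite lee_fin.
by apply: (le_trans H); apply: lee_wpmul2l.
Qed.

End vitali.

Section layer_sums.
Variable R : realType.

(** Only the terms below y count, so the sum is comparable to the largest. *)
Lemma truncated_geometric_sum (a b y : R) n : 0 < a -> a < 1 -> 0 <= b -> 0 <= y ->
  \sum_(i < n) (if b * a ^+ i < y then b * a ^+ i else 0) <= y / (1 - a).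
Proof.
move=> a0 a1 b0 y0; have a10 : 0 < 1 - a by rewrite subr_gt0.
apply: (@le_trans _ _ (Num.min b y / (1 - a))); last first.
  by rewrite ler_pM2r ?invr_gt0// ge_min lexx orbT.
elim: n b b0 => [|n IH] b b0.
  by rewrite big_ord0 divr_ge0 ?(ltW a10)// le_min b0.
rewrite big_ord_recl expr0 mulr1.
rewrite (eq_bigr (fun i : 'I_n => if (b * a) * a ^+ i < y then (b * a) * a ^+ i else 0)); last first.
  by move=> i _; rewrite lift0 exprS mulrA.
have ba0 : 0 <= b * a by rewrite mulr_ge0// ltW.
apply: (le_trans (lerD (lexx _) (IH _ ba0))).
rewrite ler_pdivlMr// mulrDl divfK ?gt_eqF//.
have bab : b * a <= b by rewrite ler_piMr// ltW.
rewrite /Num.min; case: (ltP b y) => byP; case: ltP => bay; nra.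
Qed.

Lemma dyadic_level (T z : R) : 0 < z -> z <= T ->
  exists i, T / 2 ^+ i.+1 <= z /\ z <= 2 * (T / 2 ^+ i.+1).
Proof.
move=> z0 zT.
have [n Tn] : exists n, T / 2 ^+ n.+1 <= z.
  have T0 : 0 < T by exact: lt_le_trans zT.
  exists (Num.bound `|T / z|); rewrite ler_pdivrMr ?exprn_gt0// -ler_pdivrMl//.
  rewrite mulrC; apply: le_trans (ler_norm _) _; apply: ltW.
  apply: (lt_trans (archi_boundP (normr_ge0 _))).
  by rewrite -natrX ltr_nat (ltn_trans (ltnSn _))// ltn_expl.
elim: n Tn => [|n IH] Tn.
  by exists 0%N; split => //; rewrite expr1 mulrC divfK.
have [/IH//|zn] := leP (T / 2 ^+ n.+1) z.
exists n.+1; split => //; apply: (le_trans (ltW zn)).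
rewrite le_eqVlt; apply/orP; left; apply/eqP.
by rewrite [2 ^+ n.+2]exprS invfM mulrCA mulVKf// pnatr_eq0.
Qed.

End layer_sums.

Lemma integral_scaled_indic d (T : measurableType d) (R : realType)
    (mu : {measure set T -> \bar R}) (c : R) (A : set T) :
  0 <= c -> measurable A ->
  (\int[mu]_x (c * \1_A x)%:E = c%:E * mu A)%E.
Proof.
move=> c0 mA; under eq_integral do rewrite EFinM.
rewrite ge0_integralZl_EFin//; last exact/measurable_EFinP.
by rewrite integral_indic// setIT.
Qed.

Section maximal_strong.
Variables (R : realType) (N d : nat) (X : 'I_d -> 'rV[R]_N -> 'rV[R]_N) (Q p : R).
Hypothesis sa : standing_assumptions X Q.
Hypothesis p1 : 1 < p.
Local Notation mu := (lebesgueN R N).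
Local Notation B := (ccball X).
Local Notation space := (lebesgue_space R N).

(** The layer-cake computation that turns the weak-type bound into an L^p
    bound, over the dyadic levels of W only. *)
Lemma maximal_strong : exists2 C : R, 0 < C & forall (W g : 'rV[R]_N -> R) T,
  measurable_fun setT (W : space -> R) -> measurable_fun setT (g : space -> R) ->
  (forall x, 0 <= W x <= T) -> (forall x, 0 <= g x) ->
  (forall x r, mu.-integrable (B x r : set space) (EFin \o g)) ->
  (forall t, 0 < t -> compact [set x | t <= W x]) ->
  (forall x, 0 < W x -> exists2 r, 0 < r & W x < 2 * average X x r g) ->
  (\int[mu]_x (W x `^ p)%:E <= C%:E * \int[mu]_x (g x `^ p)%:E)%E.
Proof.
have p0 : 0 < p by rewrite (lt_trans ltr01).
have p10 : 0 < p - 1 by rewrite subr_gt0.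
pose a : R := 2^-1 `^ (p - 1).
have a0 : 0 < a by rewrite powR_gt0// invr_gt0.
have a1 : a < 1.
  have one : 1 `^ (p - 1) = 1 :> R by rewrite powR1.
  rewrite -[ltRHS]one gt0_ltr_powR ?nnegrE ?invr_ge0//.
  by rewrite invf_lt1// ltr1n.
pose C1 : R := 4 * (2 `^ Q) ^+ 2.
have C10 : 0 < C1 by rewrite mulr_gt0// exprn_gt0// powR_gt0.
pose C2 : R := 2 `^ p * C1.
have C20 : 0 < C2 by rewrite mulr_gt0// powR_gt0.
pose C3 : R := 4 `^ (p - 1) / (1 - a).
have C30 : 0 < C3 by rewrite divr_gt0 ?powR_gt0// subr_gt0.
exists (C2 * C3); first exact: mulr_gt0.
move=> W g T mW mg WT g0 gi Wc Wr.
pose T1 := `|T| + 1.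
have T10 : 0 < T1 by rewrite ltr_wpDl.
have WT1 x : W x <= T1.
  have /andP[_ h] := WT x; rewrite (le_trans h)// (le_trans (ler_norm _))//.
  by rewrite lerDl.
pose tau i : R := T1 / 2 ^+ i.+1.
have tau0 i : 0 < tau i by rewrite divr_gt0// exprn_gt0.
have tauE i : tau i `^ (p - 1) = (T1 / 2) `^ (p - 1) * a ^+ i.
  rewrite /tau exprS invfM mulrA powRM ?invr_ge0 ?divr_ge0 ?(ltW T10) ?exprn_ge0//.
  congr (_ * _); rewrite /a -exprVn.
  by apply: powR_exprn; rewrite invr_ge0.
have level x : 0 < W x -> exists i, tau i <= W x /\ W x <= 2 * tau i.
  by move=> W0; exact: dyadic_level W0 (WT1 x).
clearbody tau.
pose K i : set space := [set x | tau i <= W x].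
have mK i : measurable (K i).
  rewrite -[K i]setTI; apply: measurable_fun_le => //.
pose f i (x : space) := ((2 * tau i) `^ p * \1_(K i) x)%:E.
have f0 i x : (0 <= f i x)%E by rewrite lee_fin mulr_ge0// powR_ge0.
have mf i : measurable_fun setT (f i).
  by apply/measurable_EFinP; apply: measurable_funM.
pose h i (x : space) := if tau i < 4 * g x then g x else 0.
have h0 i x : 0 <= h i x by rewrite /h; case: ifP.
have mh i : measurable_fun setT (h i : space -> R).
  exact: (measurable_truncation (tau i) mg).
apply: (@le_trans _ _ (\int[mu]_x \sum_(i <oo) f i x)%E).
  apply: ge0_le_integral; first exact: measurableT.
  - by move=> x _; rewrite lee_fin powR_ge0.
  - by apply/measurable_EFinP; apply: (measurableT_comp (measurable_powR p)).
  - exact: ge0_emeasurable_sum.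
  - move=> x _; have /andP[+ _] := WT x; rewrite le_eqVlt => /predU1P[<-|W0].
      by rewrite powR0 ?gt_eqF// nneseries_ge0.
    have [i [ti Wi]] := level _ W0.
    apply: (@le_trans _ _ (f i x)).
      rewrite lee_fin indicE mem_set//= mulr1.
      by rewrite ge0_ler_powR ?nnegrE ?mulr_ge0 ?(ltW p0) ?(ltW W0)// ltW// tau0.
    apply: (le_trans _ (nneseries_lim_ge i.+1 (fun k _ _ => f0 k x))).
    by rewrite big_nat_recr//= leeDr// sume_ge0.
rewrite integral_nneseries; [|exact: measurableT|exact: mf|by move=> *; exact: f0].
apply: (@le_trans _ _ (\sum_(i <oo) \int[mu]_x (C2 * (tau i `^ (p - 1) * h i x))%:E)%E).
  apply: lee_nneseries => [i _ _|i _]; first exact: integral_ge0.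
  have -> : (\int[mu]_x f i x = ((2 * tau i) `^ p)%:E * mu (K i))%E.
    by apply: integral_scaled_indic => //; exact: powR_ge0.
  under eq_integral do rewrite mulrA EFinM.
  rewrite ge0_integralZl_EFin; [|by []|by move=> x _; rewrite lee_fin|exact/measurable_EFinP|].
    2: by rewrite mulr_ge0 ?powR_ge0// ltW.
  rewrite powRM ?(ltW (tau0 i))//.
  have -> : tau i `^ p = tau i `^ (p - 1) * tau i.
    rewrite -[X in _ * X]powRr1 ?(ltW (tau0 i))// -powRD ?subrK//.
    by rewrite gt_eqF.
  rewrite mulrA EFinM -muleA.
  have -> : C2 * tau i `^ (p - 1) = 2 `^ p * tau i `^ (p - 1) * C1.
    by rewrite /C2; ring.
  rewrite [X in (_ <= X * _)%E]EFinM -muleA.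
  apply: lee_wpmul2l; first by rewrite lee_fin mulr_ge0 ?powR_ge0.
  apply: (maximal_weak sa mg g0 gi (tau0 i) (Wc _ (tau0 i))).
  move=> x /= tW; have [|r r0 Wxr] := Wr x; first exact: lt_le_trans tW.
  by exists r => //; exact: le_lt_trans Wxr.
pose H i (x : space) := (C2 * (tau i `^ (p - 1) * h i x))%:E.
have mH i : measurable_fun setT (H i).
  apply/measurable_EFinP; apply: measurable_funM; first exact: measurable_cst.
  by apply: measurable_funM; [exact: measurable_cst|exact: mh].
have H0 i x : (0 <= H i x)%E.
  rewrite lee_fin; apply: mulr_ge0; first exact: ltW.
  by apply: mulr_ge0; [exact: powR_ge0|exact: h0].
rewrite -/(H _ _); have -> : (\sum_(i <oo) \int[mu]_x (H i x) =
    \int[mu]_x \sum_(i <oo) H i x)%E.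
  by rewrite integral_nneseries; [|exact: measurableT|exact: mH|move=> *; exact: H0].
have mgp : measurable_fun setT (fun x : space => g x `^ p).
  exact: (measurableT_comp (measurable_powR p)).
rewrite -ge0_integralZl_EFin; last 4 first.
- exact: measurableT.
- by move=> x _; rewrite lee_fin powR_ge0.
- exact/measurable_EFinP.
- by apply: mulr_ge0; exact: ltW.
apply: ge0_le_integral; first exact: measurableT.
- by move=> x _; apply: nneseries_ge0 => i _ _; exact: H0.
- by apply: ge0_emeasurable_sum => [i x _ _|i _]; [exact: H0|exact: mH].
- apply/measurable_EFinP.
  by apply: measurable_funM; [exact: measurable_cst|exact: mgp].
move=> x _; apply: lime_le; first by apply: is_cvg_nneseries => i _ _; exact: H0.
near=> n; rewrite /H sumEFin lee_fin -mulr_sumr -[leRHS]mulrA.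
apply: ler_wpM2l; first exact: ltW.
have gx0 := g0 x.
have y0 : 0 <= (4 * g x) `^ (p - 1) by exact: powR_ge0.
have b0 : 0 <= (T1 / 2) `^ (p - 1) by exact: powR_ge0.
have := truncated_geometric_sum n a0 a1 b0 y0.
rewrite big_mkord => S.
apply: (@le_trans _ _ (g x * ((4 * g x) `^ (p - 1) / (1 - a)))).
  apply: (le_trans _ (ler_wpM2l gx0 S)); rewrite mulr_sumr.
  apply: ler_sum => i _; rewrite tauE /h; case: ifPn => [tg|_]; last first.
    by rewrite mulr0; case: ifP => _; rewrite mulr_ge0// ?mulr_ge0 ?exprn_ge0 ?(ltW a0).
  by rewrite -tauE gt0_ltr_powR ?nnegrE ?mulr_ge0 ?(ltW (tau0 i))// mulrC.
rewrite powRM// le_eqVlt; apply/orP; left; apply/eqP.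
have -> : g x `^ p = g x `^ (p - 1) * g x.
  rewrite -[X in _ * X]powRr1// -powRD ?subrK//.
  by rewrite gt_eqF.
by rewrite /C3; ring.
Unshelve. all: by end_near. Qed.

End maximal_strong.

(** * Limits of integrals and L^p norms *)

Lemma ereal_cvg_lt (R : realType) (u : nat -> \bar R) (l e : \bar R) :
  u @ \oo --> l -> (l < e)%E -> \forall n \near \oo, (u n < e)%E.
Proof.
by move=> ul le; apply: (ul [set y | (y < e)%E]);
  apply: open_nbhs_nbhs; split => //; exact: open_ereal_lt_ereal.
Qed.

Section ae_limits.
Context d (T : measurableType d) (R : realType) (mu : {measure set T -> \bar R}).
Variables (D : set T) (mD : measurable D).

Lemma fatou_le (f_ : nat -> T -> R) (f : T -> R) (c : \bar R) :
  (forall n, measurable_fun D (f_ n)) -> measurable_fun D f ->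
  (forall n x, 0 <= f_ n x) -> (forall x, 0 <= f x) ->
  {ae mu, forall x, D x -> f_ n x @[n --> \oo] --> f x} ->
  (forall n, (\int[mu]_(x in D) (f_ n x)%:E <= c)%E) ->
  (\int[mu]_(x in D) (f x)%:E <= c)%E.
Proof.
move=> mf_ mf f0_ f0 ff c_.
have mfE n : measurable_fun D (EFin \o f_ n) by exact/measurable_EFinP.
have := @fatou _ _ _ mu D mD (fun n => EFin \o f_ n) mfE
  (fun n x _ => f0_ n x).
have mL : measurable_fun D (fun x => limn_einf (fun n => (EFin \o f_ n) x)).
  rewrite (_ : (fun x => _) =
      (fun x => - limn_esup (fun n => - (EFin \o f_ n) x)%E)%E); last first.
    apply/funext => x; rewrite -[LHS]oppeK; congr (- _)%E.
    exact/esym/(limn_esupN (fun n => (EFin \o f_ n) x)).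
  apply: measurableT_comp => //.
  apply: (@measurable_fun_limn_esup _ _ _ D
    (fun n x => (- (EFin \o f_ n) x)%E)) => n.
  exact: measurableT_comp.
have -> : (\int[mu]_(x in D) limn_einf (fun n => (EFin \o f_ n) x) =
    \int[mu]_(x in D) (f x)%:E)%E.
  apply: ge0_ae_eq_integral => //.
  - exact/measurable_EFinP.
  - move=> x _; rewrite limn_einf_lim; apply: lime_ge; first exact: is_cvg_einfs.
    by apply: nearW => n; apply: le_ereal_inf_tmp => _ [k _ <-]; rewrite lee_fin.
  - by move=> x _; rewrite lee_fin.
  have aeF := ae_filter_ringOfSetsType mu.
  apply: filterS ff => x ff Dx.
  have fx : (EFin \o f_ n) x @[n --> \oo] --> (f x)%:E.
    by apply: cvg_EFin; [exact: nearW|exact: ff].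
  rewrite is_cvg_limn_einfE; first exact/cvg_lim.
  by apply/cvg_ex; exists (f x)%:E.
move=> /le_trans; apply; rewrite limn_einf_lim; apply: lime_le; first exact: is_cvg_einfs.
apply: nearW => n; apply: le_trans (c_ n).
by apply: ereal_inf_lbound; exists n => /=.
Qed.

(** Along a subsequence whose integrals are at most 2^-(k + 1) the sum of the
    integrands is integrable, hence finite almost everywhere. *)
Lemma Lp_cvg_ae (f_ : nat -> T -> R) (f : T -> R) p : 0 < p ->
  (forall n, measurable_fun D (f_ n)) -> measurable_fun D f ->
  (fun n => \int[mu]_(x in D) (`|f_ n x - f x| `^ p)%:E)%E @ \oo --> 0%E ->
  exists2 s : nat -> nat, (forall k, (k <= s k)%N) &
    {ae mu, forall x, D x -> f_ (s k) x @[k --> \oo] --> f x}.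
Proof.
move=> p0 mf_ mf ff.
pose u n x := `|f_ n x - f x| `^ p.
have u0 n x : 0 <= u n x by exact: powR_ge0.
have mu_ n : measurable_fun D (u n).
  apply: (measurableT_comp (measurable_powR p)); apply: measurableT_comp => //.
  exact: measurable_funB.
have [s sP] : {s : nat -> nat & forall k, (k <= s k)%N /\
    (\int[mu]_(x in D) (u (s k) x)%:E <= (2^-1 ^+ k.+1)%:E)%E}.
  apply: (@choice _ _ (fun k n => (k <= n)%N /\
    (\int[mu]_(x in D) (u n x)%:E <= (2^-1 ^+ k.+1)%:E)%E)) => k.
  have e0 : (0 < (2^-1 ^+ k.+1 : R)%:E)%E by rewrite lte_fin exprn_gt0// invr_gt0.
  have [n _ nP] := ereal_cvg_lt ff e0.
  exists (maxn k n); split; first exact: leq_maxl.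
  by apply: ltW; apply: nP; rewrite /= leq_maxr.
exists s; first by move=> k; have [] := sP k.
pose S x := (\sum_(k <oo) (u (s k) x)%:E)%E.
have mS : measurable_fun D S.
  apply: ge0_emeasurable_sum => [k x _ _|k _]; first by rewrite lee_fin.
  exact/measurable_EFinP.
have S0 x : (0 <= S x)%E by apply: nneseries_ge0 => k _ _; rewrite lee_fin.
have iS : mu.-integrable D S.
  apply/integrableP; split => //.
  rewrite (eq_integral S); last by move=> x _; rewrite gee0_abs.
  rewrite integral_nneseries//; last 2 first.
  - by move=> k; exact/measurable_EFinP.
  - by move=> k x _; rewrite lee_fin.
  apply: (@le_lt_trans _ _ (\sum_(k <oo) (2^-1 ^+ k.+1 : R)%:E)%E).
    apply: lee_nneseries => [k _ _|k _]; last by have [] := sP k.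
    by apply: integral_ge0 => x _; rewrite lee_fin.
  apply: (@le_lt_trans _ _ 1%E); last exact: ltry.
  apply: lime_le; first by apply: is_cvg_nneseries => k _ _; rewrite lee_fin exprn_ge0// invr_ge0.
  apply: nearW => n; rewrite sumEFin lee_fin big_mkord.
  suff -> : \sum_(i < n) 2^-1 ^+ i.+1 = 1 - 2^-1 ^+ n :> R.
    by rewrite gerBl exprn_ge0// invr_ge0.
  elim: n => [|n IH]; first by rewrite big_ord0 expr0 subrr.
  by rewrite big_ord_recr /= IH exprS; lra.
have aeF := ae_filter_ringOfSetsType mu.
apply: filterS (integrable_ae mD iS) => x Sfin Dx.
have {}Sfin := Sfin Dx.
have u_0 : u (s k) x @[k --> \oo] --> (0 : R).
  apply: cvg_series_cvg_0; apply: nondecreasing_is_cvgn.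
    move=> n m nm; rewrite /series /= (big_cat_nat (leq0n n) nm)/= lerDl.
    by apply: sumr_ge0.
  exists (fine (S x)) => _ [n _ <-]; rewrite /series /= -lee_fin fineK//.
  by rewrite -sumEFin; apply: nneseries_lim_ge => k _ _; rewrite lee_fin.
apply/cvgrPdistC_lt => e e0.
have ep0 : 0 < e `^ p by rewrite powR_gt0.
have [n _ H] := cvgr_lt _ u_0 _ ep0.
exists n => // k /H; rewrite /u /= => ue; rewrite ltNge; apply/negP => ek.
have : e `^ p <= `|f_ (s k) x - f x| `^ p.
  by rewrite ge0_ler_powR ?nnegrE ?(ltW p0) ?(ltW e0).
by rewrite leNgt ue.
Qed.

End ae_limits.

Section ereal_cvg0.
Variable R : realType.

Lemma ereal_cvg0P (u : nat -> \bar R) : (forall n, (0 <= u n)%E) ->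
  (u @ \oo --> 0%E <->
   forall e : R, 0 < e -> \forall n \near \oo, (u n <= e%:E)%E).
Proof.
move=> u0; split => [uc e e0|H].
  have e0' : (0 < e%:E)%E by rewrite lte_fin.
  by apply: filterS (ereal_cvg_lt uc e0') => n; exact: ltW.
apply/fine_cvgP; split.
  apply: filterS (H 1 ltr01) => n un.
  by rewrite ge0_fin_numE// (le_lt_trans un)// ltry.
apply/cvgrPdist_le => e e0; apply: filterS (H e e0) => n un.
rewrite sub0r normrN /= ger0_norm ?fine_ge0// -lee_fin fineK//.
by rewrite ge0_fin_numE// (le_lt_trans un)// ltry.
Qed.

End ereal_cvg0.

Section Lp_norms.
Variables (R : realType) (N : nat) (Omega : set 'rV[R]_N).
Hypothesis oO : open Omega.
Local Notation mu := (lebesgueN R N).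
Local Notation space := (lebesgue_space R N).
Implicit Types (f g : 'rV[R]_N -> R) (p : R).

Lemma measurable_Omega : measurable (Omega : set space).
Proof. exact: open_lebesgue_measurable. Qed.
Let mO := measurable_Omega.

Definition Lp_integral p f : \bar R := \int[mu]_(x in Omega) (`|f x| `^ p)%:E.

Lemma Lp_integral_ge0 p f : (0 <= Lp_integral p f)%E.
Proof. by apply: integral_ge0 => x _; rewrite lee_fin powR_ge0. Qed.

Lemma Lp_normE p f : 0 < p -> Lp_norm Omega p f = (Lp_integral p f `^ p^-1)%E.
Proof. by move=> p0; rewrite /Lp_norm Lnorm_restrict. Qed.

Lemma Lp_norm_ge0 p f : (0 <= Lp_norm Omega p f)%E.
Proof. exact: Lnorm_ge0. Qed.

Lemma Lp_norm_pow p f : 0 < p -> (Lp_norm Omega p f `^ p = Lp_integral p f)%E.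
Proof.
move=> p0; rewrite Lp_normE// -poweRrM mulVf ?gt_eqF// poweRe1//.
exact: Lp_integral_ge0.
Qed.

Lemma Lp_norm_leP p f A : 0 < p -> 0 <= A ->
  (Lp_norm Omega p f <= A%:E)%E <-> (Lp_integral p f <= (A `^ p)%:E)%E.
Proof.
move=> p0 A0; split => h.
  rewrite -Lp_norm_pow// -poweR_EFin; apply: le_poweR => //; first exact: ltW.
  exact: Lp_norm_ge0.
rewrite Lp_normE//.
have -> : A%:E = ((A `^ p)%:E `^ p^-1)%E.
  by rewrite poweR_EFin -powRrM mulfV ?gt_eqF// powRr1.
by apply: le_poweR => //; [rewrite invr_ge0 ltW|exact: Lp_integral_ge0].
Qed.

Lemma Lmeasurable_powR p f : Lmeasurable Omega f ->
  @measurable_fun _ _ space _ Omega (fun x => (`|f x| `^ p)%:E).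
Proof.
move=> mf; apply/measurable_EFinP; apply: (measurableT_comp (measurable_powR p)).
exact: measurableT_comp.
Qed.

Lemma le_Lp_norm p f g : 0 < p -> Lmeasurable Omega f -> Lmeasurable Omega g ->
  (forall x, Omega x -> `|f x| <= `|g x|) ->
  (Lp_norm Omega p f <= Lp_norm Omega p g)%E.
Proof.
move=> p0 mf mg fg; rewrite !(Lp_normE _ p0); apply: le_poweR.
- by rewrite invr_ge0 ltW.
- exact: Lp_integral_ge0.
apply: ge0_le_integral; first exact: mO.
- by move=> x _; rewrite lee_fin powR_ge0.
- exact: Lmeasurable_powR.
- exact: Lmeasurable_powR.
move=> x Ox; rewrite lee_fin ge0_ler_powR ?nnegrE ?(ltW p0)//.
exact: fg.
Qed.

Lemma Lp_normD p f g : 1 <= p -> Lmeasurable Omega f -> Lmeasurable Omega g ->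
  (Lp_norm Omega p (fun x => (f x + g x)%R) <=
   Lp_norm Omega p f + Lp_norm Omega p g)%E.
Proof.
move=> p1 mf mg; rewrite /Lp_norm !restrict_EFin_fun.
have mfD : @measurable_fun _ _ space R setT (f \_ Omega) :=
  (measurable_restrictT _ mO).1 mf.
have mgD : @measurable_fun _ _ space R setT (g \_ Omega) :=
  (measurable_restrictT _ mO).1 mg.
have -> : (fun x => f x + g x) \_ Omega = (f \_ Omega) \+ (g \_ Omega).
  apply/funext => x; rewrite /= !patchE; case: ifP => // _.
  by rewrite addr0.
exact: minkowski_EFin.
Qed.

Lemma Lp_norm_cvg0P p (u : nat -> 'rV[R]_N -> R) : 0 < p ->
  (fun n => Lp_norm Omega p (u n)) @ \oo --> 0%E <->
  (fun n => Lp_integral p (u n)) @ \oo --> 0%E.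
Proof.
move=> p0; split.
  move=> /(ereal_cvg0P (fun n => Lp_norm_ge0 p (u n))) H.
  apply/(ereal_cvg0P (fun n => Lp_integral_ge0 p (u n))) => e e0.
  have e'0 : 0 < e `^ p^-1 by rewrite powR_gt0.
  apply: filterS (H _ e'0) => n /(Lp_norm_leP _ p0 (ltW e'0)).
  by rewrite -powRrM mulVf ?gt_eqF// powRr1 ?(ltW e0).
move=> /(ereal_cvg0P (fun n => Lp_integral_ge0 p (u n))) H.
apply/(ereal_cvg0P (fun n => Lp_norm_ge0 p (u n))) => e e0.
have e'0 : 0 < e `^ p by rewrite powR_gt0.
by apply: filterS (H _ e'0) => n h; apply/(Lp_norm_leP _ p0 (ltW e0)).
Qed.

Lemma Lmeasurable_enorm d (G : 'rV[R]_N -> 'rV[R]_d) :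
  (forall j, Lmeasurable Omega (fun x => G x 0 j)) ->
  Lmeasurable Omega (fun x => enorm (G x)).
Proof.
move=> mG; apply: measurableT_comp.
  by apply: continuous_measurable_fun; exact: sqrt_continuous.
by apply: measurable_sum => j; apply: measurable_funX; exact: mG.
Qed.

Lemma Lmeasurable_dotv d (F G : 'rV[R]_N -> 'rV[R]_d) :
  (forall j, Lmeasurable Omega (fun x => F x 0 j)) ->
  (forall j, Lmeasurable Omega (fun x => G x 0 j)) ->
  Lmeasurable Omega (fun x => dotv (F x) (G x)).
Proof.
by move=> mF mG; apply: measurable_sum => j; apply: measurable_funM; [exact: mF|exact: mG].
Qed.

Lemma Lp_normvD d p (F G : 'rV[R]_N -> 'rV[R]_d) : 1 <= p ->
  (forall j, Lmeasurable Omega (fun x => F x 0 j)) ->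
  (forall j, Lmeasurable Omega (fun x => G x 0 j)) ->
  (Lp_normv Omega p (fun x => (F x + G x)%R) <=
   Lp_normv Omega p F + Lp_normv Omega p G)%E.
Proof.
move=> p1 mF mG; have p0 : 0 < p by exact: lt_le_trans p1.
apply: le_trans (Lp_normD p1 (Lmeasurable_enorm mF) (Lmeasurable_enorm mG)).
apply: le_Lp_norm => //.
- apply: Lmeasurable_enorm => j.
  rewrite (_ : (fun x => _) = (fun x => F x 0 j + G x 0 j)).
    by apply: measurable_funD; [exact: mF|exact: mG].
  by apply/funext => x; rewrite mxE.
- by apply: measurable_funD; exact: Lmeasurable_enorm.
- by move=> x _; rewrite !ger0_norm ?addr_ge0 ?enorm_ge0// enormD.
Qed.

Lemma Lmeasurable_continuous f : continuous f -> Lmeasurable Omega f.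
Proof. by move=> cf; exact: continuous_lebesgue_measurable. Qed.

Lemma LmeasurableB f g : Lmeasurable Omega f -> Lmeasurable Omega g ->
  Lmeasurable Omega (fun x => f x - g x).
Proof. exact: measurable_funB. Qed.

Lemma test_Lmeasurable phi : test_function Omega phi -> Lmeasurable Omega phi.
Proof. by move=> [sphi _ _]; exact/Lmeasurable_continuous/smooth_continuous. Qed.

Lemma Xgrad_Lmeasurable d (X : 'I_d -> 'rV[R]_N -> 'rV[R]_N) phi :
  (forall j, locally_lipschitz (X j)) ->
  test_function Omega phi -> forall j, Lmeasurable Omega (fun x => Xgrad X phi x 0 j).
Proof.
by move=> lX [sphi _ _] j; apply: Lmeasurable_continuous; exact: Xgrad_continuous.
Qed.

End Lp_norms.

(** * The Sobolev inequality *)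

Lemma normr_powR_continuous (R : realType) (r : R) : 0 <= r ->
  continuous (fun t : R => `|t| `^ r).
Proof.
rewrite le_eqVlt => /predU1P[<-|r0].
  rewrite (_ : (fun t => _) = cst 1); first exact: cst_continuous.
  by apply/funext => t; rewrite powRr0.
move=> t; have [->|t0] := eqVneq t 0.
  rewrite /continuous_at normr0 powR0 ?gt_eqF//.
  apply/cvgrPdist_lt => e e0.
  have e'0 : 0 < e `^ r^-1 by rewrite powR_gt0.
  have n0 : \forall s \near (0 : R), `|s| < e `^ r^-1.
    have n0 : `|s| @[s --> (0 : R)] --> (0 : R).
      by rewrite -[X in _ --> X](normr0 R); exact: norm_continuous.
    exact: (cvgr_lt 0 n0).
  apply: filterS n0 => s se; rewrite sub0r normrN ger0_norm ?powR_ge0//.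
  have -> : e = (e `^ r^-1) `^ r.
    by rewrite -powRrM mulVf ?gt_eqF// powRr1// ltW.
  by rewrite gt0_ltr_powR ?nnegrE ?(ltW e'0).
have nt0 : 0 < `|t| by rewrite normr_gt0.
rewrite /continuous_at; have -> : `|t| `^ r = expR (r * ln `|t|).
  by rewrite /powR gt_eqF.
apply: (@cvg_trans _ ((fun s : R => expR (r * ln `|s|)) @ t)).
  apply: near_eq_cvg; near=> s.
  have s0 : 0 < `|s|.
    by near: s; apply: (cvgr_gt _ (@norm_continuous _ _ t)).
  by rewrite /powR gt_eqF.
apply: (@continuous_comp _ _ _ (fun s : R => r * ln `|s|) expR); last exact: continuous_expR.
apply: (@continuousM _ _ (cst r) (fun s : R => ln `|s|)); first exact: cst_continuous.
apply: (@continuous_comp _ _ _ (fun s : R => `|s|) (@ln R)); first exact: norm_continuous.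
exact: continuous_ln.
Unshelve. all: by end_near. Qed.

Section sobolev.
Variables (R : realType) (N d : nat) (X : 'I_d -> 'rV[R]_N -> 'rV[R]_N) (Q p : R).
Variable Omega : set 'rV[R]_N.
Hypothesis N0 : (0 < N)%N.
Hypothesis sa : standing_assumptions X Q.
Hypothesis pQ : 1 < p < Q.
Hypothesis oO : open Omega.
Hypothesis bO : bounded_set Omega.
Local Notation mu := (lebesgueN R N).
Local Notation space := (lebesgue_space R N).
Local Notation grad w := (fun y => enorm (Xgrad X w y)).
Local Notation ps := (sobolev_exponent Q p).

Let p1 : 1 < p. Proof. by case/andP: pQ. Qed.
Let p0 : 0 < p. Proof. exact: lt_trans p1. Qed.
Let pltQ : p < Q. Proof. by case/andP: pQ. Qed.
Let Q0 : 0 < Q. Proof. exact: lt_trans pltQ. Qed.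
Let Qp : 0 < Q - p. Proof. by rewrite subr_gt0. Qed.
Let ps0 : 0 < ps. Proof. by rewrite divr_gt0// mulr_gt0. Qed.

Lemma Lp_integral_whole r f : 0 < r -> (forall x, ~ Omega x -> f x = 0) ->
  Lp_integral Omega r f = (\int[mu]_x (`|f x| `^ r)%:E)%E.
Proof.
move=> r0 f0; rewrite /Lp_integral integral_mkcond.
apply: eq_integral => x _; rewrite patchE; case: ifPn => // /negP xO.
rewrite f0 ?normr0 ?powR0 ?gt_eqF// => Ox.
by apply: xO; rewrite inE.
Qed.

Lemma closed_superlevel (w : 'rV[R]_N -> R) (s : R) : continuous w ->
  closed [set x : 'rV[R]_N | s <= `|w x|].
Proof.
move=> cw; have cn : continuous (fun x => `|w x|).
  by move=> x; apply: (@continuous_comp _ _ _ w (fun z : R => `|z|)); [exact: cw|exact: norm_continuous].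
apply: (@preimage_closed _ _ (fun x => `|w x|) [set z | s <= z]); last exact: closed_ge.
by move=> x _; exact: cn.
Qed.

(** With e = Q / (Q - p), the function W = c |w|^e is dominated by averages of
    |Xw| around each point, and the L^p norm of |w|^e is a power of the norm of
    [w] for the Sobolev exponent e p. *)
Lemma sobolev_test : exists2 C : R, 0 < C & forall w A,
  test_function Omega w -> 0 < A ->
  (Lp_normv Omega p (Xgrad X w) <= A%:E)%E ->
  (Lp_norm Omega ps w <= (C * A)%:E)%E.
Proof.
have [C1 C10 wit] := average_witness N0 sa pQ bO.
have [C2 C20 str] := maximal_strong sa p1.
pose e := Q / (Q - p).
have e0 : 0 < e by rewrite divr_gt0.
have pse : ps = e * p by rewrite /ps /e /sobolev_exponent; field; rewrite gt_eqF.
pose C := (C2 / C1 `^ p) `^ ps^-1.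
have C0 : 0 < C by rewrite powR_gt0// divr_gt0// powR_gt0.
exists C => // w A tw A0 gA; have [sw cw _] := tw.
have cw' := smooth_continuous sw.
have {}gA : (\int[mu]_y (grad w y `^ p)%:E <= (A `^ p)%:E)%E.
  move: gA => /(Lp_norm_leP _ _ p0 (ltW A0)).
  rewrite (Lp_integral_whole p0).
    by under eq_integral do rewrite ger0_norm ?enorm_ge0//.
  by move=> x xO; rewrite (Xgrad_outside X tw xO) enorm0.
have [M M0 wM] := test_function_bounded tw.
pose c := C1 * A `^ (1 - e).
have c0 : 0 < c by rewrite mulr_gt0// powR_gt0.
pose W x := c * `|w x| `^ e.
have mg := measurable_enorm_Xgrad sa sw (@measurableT _ space).
have mw := measurable_smooth sw (@measurableT _ space).
have mW : @measurable_fun _ _ space R setT W.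
  apply: measurable_funM; first exact: measurable_cst.
  by apply: (measurableT_comp (measurable_powR e)); exact: measurableT_comp.
have W0 x : 0 <= W x by rewrite mulr_ge0 ?powR_ge0// ltW.
have H := str W (grad w) (c * M `^ e) mW mg.
have {}H : (\int[mu]_x (W x `^ p)%:E <= C2%:E * \int[mu]_x (grad w x `^ p)%:E)%E.
  apply: H.
  - move=> x; rewrite W0 /= ler_pM2l// ge0_ler_powR ?nnegrE ?(ltW e0)//.
  - by move=> x; exact: enorm_ge0.
  - by move=> x r; exact: (Xgrad_integrable_ball sa x r tw).
  - move=> t t0.
    have -> : [set x | t <= W x] = [set x | (t / c) `^ e^-1 <= `|w x|].
      apply/seteqP; split => x /=; rewrite /W [c * _]mulrC -ler_pdivrMr// => h.
        have -> : `|w x| = (`|w x| `^ e) `^ e^-1.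
          by rewrite -powRrM mulfV ?gt_eqF// powRr1.
        rewrite ge0_ler_powR ?nnegrE ?powR_ge0 ?invr_ge0 ?(ltW e0)//.
        by rewrite divr_ge0// ltW.
      have -> : t / c = ((t / c) `^ e^-1) `^ e.
        by rewrite -powRrM mulVf ?gt_eqF// powRr1// divr_ge0// ltW.
      by rewrite ge0_ler_powR ?nnegrE ?powR_ge0 ?(ltW e0).
    apply: subclosed_compact cw _; first exact: closed_superlevel.
    move=> x /= h; apply: subset_closure => /=; rewrite -normr_gt0.
    by apply: lt_le_trans h; rewrite powR_gt0// divr_gt0.
  - move=> x Wx.
    have wx : w x != 0.
      by apply/eqP => wx; move: Wx; rewrite /W wx normr0 powR0 ?gt_eqF// mulr0 ltxx.
    have [r r0 Hr] := wit w x A tw A0 gA wx.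
    by exists r => //; rewrite /W /c mulrAC -mulrA.
apply/(Lp_norm_leP _ _ ps0 (mulr_ge0 (ltW C0) (ltW A0))).
rewrite Lp_integral_whole//; last by move=> x xO; exact: (test_function_outside tw).
have WE : (\int[mu]_x (W x `^ p)%:E =
    (c `^ p)%:E * \int[mu]_x (`|w x| `^ ps)%:E)%E.
  rewrite -ge0_integralZl_EFin; last 4 first.
  - exact: measurableT.
  - by move=> x _; rewrite lee_fin powR_ge0.
  - apply/measurable_EFinP; apply: (measurableT_comp (measurable_powR ps)).
    exact: measurableT_comp.
  - exact: powR_ge0.
  apply: eq_integral => x _.
  by rewrite /W powRM ?powR_ge0 ?(ltW c0)// -powRrM -pse EFinM.
have cp0 : 0 < c `^ p by rewrite powR_gt0.
have {}H : ((c `^ p)%:E * \int[mu]_x (`|w x| `^ ps)%:E <= (C2 * A `^ p)%:E)%E.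
  rewrite -WE EFinM; apply: (le_trans H); apply: lee_wpmul2l => //.
  by rewrite lee_fin ltW.
have -> : (C * A) `^ ps = C2 * A `^ p / c `^ p.
  rewrite powRM ?(ltW C0) ?(ltW A0)// /C -powRrM mulVf ?gt_eqF// powRr1; last first.
    by rewrite divr_ge0 ?powR_ge0 ?(ltW C20).
  rewrite /c powRM ?powR_ge0 ?(ltW C10)// -powRrM invfM.
  have -> : A `^ ps = A `^ p * (A `^ ((1 - e) * p))^-1.
    rewrite -powRN -powRD; last by rewrite (gt_eqF A0) implybT.
    by rewrite pse; congr (_ `^ _); ring.
  by ring.
by rewrite EFinM lee_pdivlMr// muleC.
Qed.

(** The inequality passes to the limit by Fatou's lemma along a subsequence of
    test functions converging almost everywhere. *)
Lemma sobolev_W0 : exists S, sobolev_constant X Omega Q p S.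
Proof.
have [C C0 HC] := sobolev_test.
exists C; split => // w g [[mw _] [mg gfin] [phi [tphi phiw phig]]].
have mphi n := test_Lmeasurable oO (tphi n).
have mgphi n := Xgrad_Lmeasurable oO (sa_lipschitz sa) (tphi n).
suff H A : 0 < A -> (Lp_normv Omega p g < A%:E)%E ->
    (Lp_norm Omega ps w <= (C * A)%:E)%E.
  have gE : Lp_normv Omega p g \is a fin_num.
    by rewrite ge0_fin_numE// Lp_norm_ge0.
  apply/lee_addgt0Pr => r r0.
  rewrite -(fineK gE); set G := fine _.
  have G0 : 0 <= G by rewrite fine_ge0// Lp_norm_ge0.
  rewrite -EFinM -EFinD.
  have -> : C * G + r = C * (G + r / C) by field; rewrite gt_eqF.
  apply: H; first by rewrite ltr_wpDl// divr_gt0.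
  by rewrite -(fineK gE) lte_fin ltrDl divr_gt0.
move=> A0 gA.
have mdiff n j : Lmeasurable Omega (fun x => (Xgrad X (phi n) x - g x) 0 j).
  rewrite (_ : (fun x => _) = (fun x => Xgrad X (phi n) x 0 j - g x 0 j)).
    by apply: LmeasurableB; [exact: mgphi|exact: mg].
  by apply/funext => x; rewrite !mxE.
have [n0 _ Hn] : \forall n \near \oo, (Lp_normv Omega p (Xgrad X (phi n)) <= A%:E)%E.
  have gE : Lp_normv Omega p g \is a fin_num.
    by rewrite ge0_fin_numE// Lp_norm_ge0.
  have d0 : 0 < A - fine (Lp_normv Omega p g).
    by rewrite subr_gt0 -lte_fin fineK.
  have := (ereal_cvg0P (fun n => Lp_norm_ge0 _ _ _)).1 phig _ d0.
  apply: filterS => n hn.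
  have -> : Xgrad X (phi n) = fun x => (Xgrad X (phi n) x - g x) + g x.
    by apply/funext => x; rewrite subrK.
  apply: le_trans (Lp_normvD oO (ltW p1) (mdiff n) mg) _.
  apply: (le_trans (leeD2r _ hn)).
  by rewrite -[in leLHS](fineK gE) -EFinD subrK.
have [s ks sae] : exists2 s : nat -> nat, (forall k, (k <= s k)%N) &
    {ae mu, forall x, Omega x -> phi (s k) x @[k --> \oo] --> w x}.
  apply: (Lp_cvg_ae (measurable_Omega oO) p0 mphi mw).
  exact: ((Lp_norm_cvg0P _ (fun n x => phi n x - w x) p0).1 phiw).
apply/(Lp_norm_leP _ _ ps0); first by rewrite mulr_ge0 ?ltW.
apply: (@fatou_le _ _ _ mu Omega (measurable_Omega oO)
  (fun k x => `|phi (s (n0 + k)%N) x| `^ ps)).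
- move=> k; apply: (measurableT_comp (measurable_powR ps)).
  by apply: measurableT_comp => //; exact: mphi.
- apply: (measurableT_comp (measurable_powR ps)).
  exact: measurableT_comp.
- by move=> *; exact: powR_ge0.
- by move=> *; exact: powR_ge0.
- have aeF := ae_filter_ringOfSetsType mu.
  apply: filterS sae => x /[apply] phix.
  have phixn : phi (s (n0 + k)%N) x @[k --> \oo] --> w x.
    rewrite (_ : (fun k => _) = (fun k => phi (s (k + n0)%N) x)); last first.
      by apply/funext => k; rewrite addnC.
    by rewrite (cvg_shiftn n0 (fun k => phi (s k) x)).
  apply: (@cvg_comp _ _ _ (fun k => phi (s (n0 + k)%N) x)
    (fun t : R => `|t| `^ ps) _ _ _ phixn).
  exact: (normr_powR_continuous (ltW ps0)).
- move=> k; apply/(Lp_norm_leP _ _ ps0); first by rewrite mulr_ge0 ?ltW.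
  by apply: HC => //; apply: Hn => /=; apply: leq_trans (ks _); exact: leq_addr.
Qed.

End sobolev.

(** * Polynomial approximation and primitives *)

Section weierstrass.
Variable R : realType.
Implicit Types (f : R -> R) (g : nat -> R).

(** The Bernstein operator: [bernstein n g] is the expectation of g at the
    number of successes in n trials with success probability 'X, written as a
    recursion on the first trial so that moments are computed by induction. *)
Fixpoint bernstein n g : {poly R} :=
  if n is m.+1 then (1 - 'X) * bernstein m g + 'X * bernstein m (g \o succn)
  else (g 0%N)%:P.

Lemma bernsteinS n g x : (bernstein n.+1 g).[x] =
  (1 - x) * (bernstein n g).[x] + x * (bernstein n (g \o succn)).[x].
Proof. by rewrite /= !hornerE. Qed.

(** Mean and variance at once: conditioning on the first trial shifts the
    centre [a], so it has to be arbitrary in the induction. *)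
Lemma bernstein_variance n (A C a x : R) :
  (bernstein n (fun k => A + C * (k%:R - a) ^+ 2)).[x] =
  A + C * (n%:R * (x * (1 - x)) + (n%:R * x - a) ^+ 2).
Proof.
elim: n a => [|n IH] a; first by rewrite /= hornerC !mul0r !add0r.
rewrite bernsteinS IH.
rewrite (_ : _ \o succn = (fun k => A + C * (k%:R - (a - 1)) ^+ 2)); last first.
  by apply/funext => k /=; rewrite -natr1; congr (_ + _ * _ ^+ 2); ring.
by rewrite IH -natr1; ring.
Qed.

Lemma le_bernstein n g h x : 0 <= x <= 1 ->
  (forall k, (k <= n)%N -> g k <= h k) ->
  (bernstein n g).[x] <= (bernstein n h).[x].
Proof.
move=> /andP[x0 x1]; elim: n g h => [|n IH] g h gh.
  by rewrite /= !hornerC gh.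
rewrite !bernsteinS lerD// ler_wpM2l ?subr_ge0//.
  by apply: IH => k kn; apply: gh; exact: leqW.
by apply: IH => k kn; exact: gh.
Qed.

Lemma uniform_modulus f (K : set R) e : continuous f -> compact K -> 0 < e ->
  exists2 d, 0 < d & forall s t, K t -> `|s - t| < d -> `|f s - f t| <= e.
Proof.
move=> cf /compact_near_coveringP cK e0.
have e2 : 0 < e / 2 by rewrite divr_gt0.
have H : \forall d \near (0 : R)^'+,
    K `<=` [set t | forall s, `|s - t| < d -> `|f s - f t| <= e].
  apply: (cK R (0^'+) (fun d t => forall s, `|s - t| < d -> `|f s - f t| <= e)).
  move=> x Kx.
  have cx : f y @[y --> x] --> f x by exact: cf.
  have [r /= r0 xr] := cvgr_dist_lt f (f x) cx _ e2.
  exists (ball x (r / 2), [set d | d < r / 2]).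
    split; first by apply: nbhsx_ballx; rewrite divr_gt0.
    by apply: nbhs_right_lt; rewrite divr_gt0.
  move=> [t d] /= [xt dr] s st.
  have h1 : `|f x - f t| < e / 2.
    by apply: xr => /=; apply: (lt_trans xt); rewrite ltr_pdivrMr//; lra.
  have h2 : `|f x - f s| < e / 2.
    apply: xr => /=; rewrite -(subrKA t) (le_lt_trans (ler_normD _ _))//.
    by rewrite (splitr r) ltrD// distrC (lt_trans st).
  rewrite -(subrKA (f x)) (le_trans (ler_normD _ _))//.
  by rewrite (splitr e) lerD// ltW// distrC.
have [d [Kd d0]] := filter_ex (filterI H (nbhs_right_gt 0)).
by exists d => // s t Kt; exact: Kd.
Qed.

(** Chebyshev's argument: |f s - f t| is at most e / 2 plus a multiple of
    (s - t)^2, whose expectation at the frequency of successes is of order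
    1 / n. *)
Lemma weierstrass01 f e : continuous f -> 0 < e ->
  exists p : {poly R}, forall x, 0 <= x <= 1 -> `|p.[x] - f x| <= e.
Proof.
move=> cf e0; have e2 : 0 < e / 2 by rewrite divr_gt0.
have cI := @segment_compact R 0 1.
have [d d0 fd] := uniform_modulus cf cI e2.
have [F F0 fF] : exists2 F, 0 <= F & forall x, 0 <= x <= 1 -> `|f x| <= F.
  have /compact_bounded[F [_ FI]] : compact (f @` `[0, 1]).
    by apply: continuous_compact => //; exact: continuous_subspaceT.
  exists (`|F| + 1) => [|x x01]; first by rewrite addr_ge0.
  by apply: (FI _ (ltr_pwDr ltr01 (ler_norm _))); exists x.
(* Where |s - t| >= d the quadratic term exceeds the oscillation 2 F of f. *)
pose C := 2 * F / d ^+ 2.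
have C0 : 0 <= C by apply: divr_ge0; rewrite ?sqr_ge0// mulr_ge0.
have fC s t : 0 <= s <= 1 -> 0 <= t <= 1 -> `|f s - f t| <= e / 2 + C * (s - t) ^+ 2.
  move=> s01 t01; have [st|ts] := ltP `|s - t| d.
    have It : `[0, 1]%classic t by rewrite /= in_itv.
    apply: (le_trans (fd s t It st)).
    by rewrite lerDl mulr_ge0// sqr_ge0.
  apply: (@le_trans _ _ (2 * F)).
    rewrite (le_trans (ler_normB _ _))// mulr_natl mulr2n.
    by rewrite lerD// fF.
  apply: (@le_trans _ _ (C * (s - t) ^+ 2)); last by rewrite lerDr ltW.
  rewrite /C mulrAC ler_pdivlMr ?exprn_gt0// ler_wpM2l ?mulr_ge0//.
  by rewrite -(real_normK (num_real (s - t))) ler_sqr ?nnegrE// ltW.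
have [n n0 Cn] : exists2 n : nat, (0 < n)%N & C / n%:R <= e / 2.
  exists (Num.bound `|C / (e / 2)|).+1 => //.
  rewrite ler_pdivrMr// mulrC -ler_pdivrMr//.
  apply: le_trans (ler_norm _) _; apply: ltW.
  by apply: (lt_trans (archi_boundP (normr_ge0 _))); rewrite ltr_nat.
have n0' : 0 < n%:R :> R by rewrite ltr0n.
exists (bernstein n (fun k => f (k%:R / n%:R))) => x x01.
have /andP[x0 x1] := x01.
have xx : x * (1 - x) <= 1 by nra.
have xx0 : 0 <= x * (1 - x) by rewrite mulr_ge0// subr_ge0.
have V c A : (bernstein n (fun k => A + c / n%:R ^+ 2 * (k%:R - n%:R * x) ^+ 2)).[x] =
    A + c / n%:R * (x * (1 - x)).
  rewrite bernstein_variance subrr expr0n addr0.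
  by congr (_ + _); field; rewrite gt_eqF.
have kn k : (k <= n)%N -> 0 <= (k%:R / n%:R : R) <= 1.
  move=> kn; rewrite divr_ge0//= ler_pdivrMr// mul1r ler_nat.
  by [].
have sq k : C * (k%:R / n%:R - x) ^+ 2 = C / n%:R ^+ 2 * (k%:R - n%:R * x) ^+ 2.
  by field; rewrite gt_eqF.
have Cnx : C / n%:R * (x * (1 - x)) <= e / 2.
  by apply: (le_trans _ Cn); rewrite ler_piMr// divr_ge0// ltW.
rewrite ler_distl; apply/andP; split.
  apply: (@le_trans _ _ ((f x - e / 2) + - C / n%:R * (x * (1 - x)))).
    by rewrite mulNr mulNr; lra.
  rewrite -V; apply: le_bernstein => // k /kn k01.
  rewrite mulNr mulNr -sq; have := fC _ _ k01 x01; rewrite ler_distl.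
  by move=> /andP[+ _]; lra.
apply: (@le_trans _ _ ((f x + e / 2) + C / n%:R * (x * (1 - x)))); last by lra.
rewrite -V; apply: le_bernstein => // k /kn k01.
by rewrite -sq; have := fC _ _ k01 x01; rewrite ler_distl => /andP[_]; lra.
Qed.

Lemma weierstrass f M e : continuous f -> 0 < M -> 0 < e ->
  exists p : {poly R}, forall x, `|x| <= M -> `|p.[x] - f x| <= e.
Proof.
move=> cf M0 e0; pose h y := f (M * (2 * y - 1)).
have ch : continuous (fun y : R => f (M * (2 * y - 1))).
  move=> y; apply: (@continuous_comp _ _ _ (fun y : R => M * (2 * y - 1)) f); last exact: cf.
  apply: cvgM; first exact: cvg_cst.
  apply: cvgB; last exact: cvg_cst.
  by apply: cvgM; [exact: cvg_cst|exact: cvg_id].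
have [p pP] := weierstrass01 ch e0.
exists (p \Po ((2 * M)^-1 *: 'X + (2^-1)%:P)) => x xM.
rewrite horner_comp !hornerE.
have M2 : 0 < 2 * M by rewrite mulr_gt0.
have -> : f x = h ((2 * M)^-1 * x + 2^-1).
  by rewrite /h; congr f; field; rewrite gt_eqF.
apply: pP; move: xM; rewrite ler_norml => /andP[x1 x2].
have E : (2 * M)^-1 * x + 2^-1 = (x + M) / (2 * M) by field; rewrite gt_eqF.
rewrite E divr_ge0 ?(ltW M2)//=; last lra.
by rewrite ler_pdivrMr//; lra.
Qed.

End weierstrass.

Section antiderivative.
Variable R : realType.
Local Notation lambda := (@lebesgue_measure R).

(** Integrals from two base points differ by a constant, so near each x the
    primitive from 0 can be compared with one from a point to the left of both
    0 and x. *)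
Lemma continuous_antiderivative (f : R -> R) : continuous f ->
  exists2 Phi : R -> R, Phi 0 = 0 & forall x : R, is_derive x 1 Phi (f x).
Proof.
move=> cf.
have fi a b : lambda.-integrable `[a, b] (EFin \o f).
  apply: continuous_compact_integrable; first exact: segment_compact.
  exact: continuous_subspaceT.
pose Phi x := if 0 <= x then \int[lambda]_(t in `]0, x]) f t
  else - \int[lambda]_(t in `]x, 0]) f t.
pose F a x := \int[lambda]_(t in `[a, x]) f t.
have FE a x : a < 0 -> a < x -> F a x - F a 0 = Phi x.
  move=> a0 ax; rewrite /Phi /F; case: leP => x0.
    by rewrite Rintegral_itvB// bnd_simp ltW.
  rewrite -opprB; congr (- _).
  by rewrite Rintegral_itvB// bnd_simp ltW.
exists Phi; first by rewrite /Phi lexx set_itv_ge ?bnd_simp ?ltxx// Rintegral_set0.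
move=> x; pose a := Num.min x 0 - 1.
have a0 : a < 0 by rewrite /a; case: (leP x 0) => ?; lra.
have ax : a < x by rewrite /a; case: (leP x 0) => ?; lra.
have [|dF FfE] := @continuous_FTC1_closed R f a x (x + 1) _ (fi _ _) ax (cf x).
  by rewrite ltrDl.
have near_F : \near x, (F a \- cst (F a 0)) x = Phi x.
  near=> y; rewrite /= FE//; near: y; exact: lt_nbhsr.
apply: (near_eq_is_derive near_F).
have D : is_derive x 1 (F a) (f x) by split; [exact: dF|rewrite -derive1E; exact: FfE].
by have := is_deriveB D (is_derive_cst (F a 0) x 1); rewrite subr0.
Unshelve. all: by end_near. Qed.

End antiderivative.

(** * The chain rule in W0 *)

Lemma poly_antiderivative (R : realType) (p : {poly R}) :
  exists2 P : {poly R}, P^`() = p & P.[0] = 0.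
Proof.
have divnK (a : R) n : a / n.+1%:R *+ n.+1 = a.
  by rewrite -mulr_natr divfK// pnatr_eq0.
exists (\poly_(i < (size p).+1) (if i is j.+1 then p`_j / i%:R else 0)).
  apply/polyP => i; rewrite coef_deriv coef_poly ltnS.
  case: ltnP => [_|sp]; last by rewrite mul0rn nth_default.
  exact: divnK.
by rewrite horner_coef0 coef_poly.
Qed.

Section ereal_cvg0_arith.
Variable R : realType.
Implicit Types (u v w : nat -> \bar R).

Lemma ereal_cvg0_leD u v w : (forall n, (0 <= u n)%E) ->
  (forall n, (0 <= v n)%E) -> (forall n, (0 <= w n)%E) ->
  (forall n, (u n <= v n + w n)%E) ->
  v @ \oo --> 0%E -> w @ \oo --> 0%E -> u @ \oo --> 0%E.
Proof.
move=> u0 v0 w0 uvw /(ereal_cvg0P v0) hv /(ereal_cvg0P w0) hw.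
apply/(ereal_cvg0P u0) => e e0; have e2 : 0 < e / 2 by rewrite divr_gt0.
apply: filterS2 (hv _ e2) (hw _ e2) => n vn wn.
by apply: (le_trans (uvw n)); rewrite (splitr e) EFinD leeD.
Qed.

Lemma ereal_cvg0_leZ u v (c : R) : 0 <= c -> (forall n, (0 <= u n)%E) ->
  (forall n, (0 <= v n)%E) -> (forall n, (u n <= c%:E * v n)%E) ->
  v @ \oo --> 0%E -> u @ \oo --> 0%E.
Proof.
move=> c0 u0 v0 uv /(ereal_cvg0P v0) hv; apply/(ereal_cvg0P u0) => e e0.
have ec : 0 < e / (c + 1) by rewrite divr_gt0// ltr_wpDl.
apply: filterS (hv _ ec) => n vn; apply: (le_trans (uv n)).
apply: (@le_trans _ _ (c%:E * (e / (c + 1))%:E)%E).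
  by apply: lee_wpmul2l.
rewrite -EFinM lee_fin mulrA ler_pdivrMr ?ltr_wpDl//; nra.
Qed.

Lemma cvg_subseq (T : topologicalType) (u : nat -> T) (l : T) (s : nat -> nat) :
  (forall k, (k <= s k)%N) -> u @ \oo --> l -> (fun k => u (s k)) @ \oo --> l.
Proof.
move=> ks ul; apply: (@cvg_comp _ _ _ s u _ \oo) => //.
by move=> A [n _ nA]; exists n => // k /= nk; apply: nA => /=; exact: leq_trans (ks k).
Qed.

End ereal_cvg0_arith.

Section chain_rule.
Variables (R : realType) (N d : nat) (X : 'I_d -> 'rV[R]_N -> 'rV[R]_N) (Q p : R).
Variable Omega : set 'rV[R]_N.
Hypothesis sa : standing_assumptions X Q.
Hypothesis p1 : 1 < p.
Hypothesis oO : open Omega.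
Hypothesis bO : bounded_set Omega.
Local Notation mu := (lebesgueN R N).
Local Notation space := (lebesgue_space R N).
Local Notation Lm := (Lmeasurable Omega).

Let p0 : 0 < p. Proof. exact: lt_trans p1. Qed.
Let mO := measurable_Omega oO.

Lemma le_Lp_norm_scale r (f g : 'rV[R]_N -> R) c : 0 < r -> 0 <= c ->
  Lm f -> Lm g -> (forall x, Omega x -> `|f x| <= c * `|g x|) ->
  (Lp_norm Omega r f <= c%:E * Lp_norm Omega r g)%E.
Proof.
move=> r0 c0 mf mg fg; rewrite !Lp_normE//.
have -> : c%:E = ((c `^ r)%:E `^ r^-1)%E.
  by rewrite poweR_EFin -powRrM mulfV ?gt_eqF// powRr1.
rewrite -poweRM; [|by rewrite lee_fin powR_ge0|exact: Lp_integral_ge0].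
apply: le_poweR; [by rewrite invr_ge0 ltW|exact: Lp_integral_ge0|].
rewrite /Lp_integral -ge0_integralZl_EFin; last 4 first.
- exact: mO.
- by move=> x _; rewrite lee_fin powR_ge0.
- exact: Lmeasurable_powR.
- exact: powR_ge0.
apply: ge0_le_integral; first exact: mO.
- by move=> x _; rewrite lee_fin powR_ge0.
- exact: Lmeasurable_powR.
- apply/measurable_EFinP; apply: measurable_funM; first exact: measurable_cst.
  exact/measurable_EFinP/Lmeasurable_powR.
- move=> x Ox; rewrite -EFinM lee_fin -powRM// ge0_ler_powR ?nnegrE ?(ltW r0)//.
    by rewrite mulr_ge0.
  exact: fg.
Qed.

Lemma Lp_norm_cst : exists2 K, 0 <= K &
  forall c, 0 <= c -> (Lp_norm Omega p (fun=> c) <= (c * K)%:E)%E.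
Proof.
have fO : (mu Omega < +oo)%E := lebesgue_bounded_fin bO.
pose K := fine (mu Omega) `^ p^-1; exists K; first exact: powR_ge0.
move=> c c0; have K0 : 0 <= K by exact: powR_ge0.
apply/(Lp_norm_leP _ _ p0 (mulr_ge0 c0 K0)).
have -> : Lp_integral Omega p (fun=> c) = ((c `^ p)%:E * mu Omega)%E.
  rewrite /Lp_integral; under eq_integral do rewrite ger0_norm//.
  by rewrite (integral_cst _ mO).
rewrite powRM// EFinM; apply: lee_wpmul2l; first by rewrite lee_fin powR_ge0.
rewrite /K -powRrM mulVf ?gt_eqF// powRr1 ?fine_ge0//.
by rewrite fineK// ge0_fin_numE.
Qed.

Lemma Lm_comp (f : R -> R) u : continuous f -> Lm u -> Lm (fun x => f (u x)).
Proof.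
by move=> cf mu_; apply: measurableT_comp => //; exact: continuous_measurable_fun.
Qed.

(** The mixed term of the product rule: bounded coefficients converging almost
    everywhere against a fixed function of L^p. *)
Lemma Lp_dominated (f : R -> R) (L : R) (psi : nat -> 'rV[R]_N -> R) u G :
  continuous f -> (forall s, `|f s| <= L) ->
  (forall k, Lm (psi k)) -> Lm u -> Lm G ->
  (Lp_norm Omega p G < +oo)%E ->
  {ae mu, forall x, Omega x -> psi k x @[k --> \oo] --> u x} ->
  (fun k => Lp_norm Omega p (fun x => (f (psi k x) - f (u x)) * G x)) @ \oo --> 0%E.
Proof.
move=> cf fL mpsi mu_ mG Gfin aepsi.
have mterm k : Lm (fun x => (f (psi k x) - f (u x)) * G x).
  by apply: measurable_funM; [apply: measurable_funB; exact: Lm_comp|exact: mG].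
apply/(Lp_norm_cvg0P _ (fun k x => (f (psi k x) - f (u x)) * G x) p0).
have aeF := ae_filter_ringOfSetsType mu.
pose dom x := (((2 * L) `^ p) * (`|G x| `^ p))%:E.
have L0 : 0 <= L by exact: le_trans (normr_ge0 _) (fL 0).
have idom : mu.-integrable (Omega : set space) dom.
  have mdom : @measurable_fun _ _ space _ Omega dom.
    apply/measurable_EFinP; apply: measurable_funM; first exact: measurable_cst.
    exact/measurable_EFinP/Lmeasurable_powR.
  apply/integrableP; split => //.
  under eq_integral do rewrite /dom gee0_abs ?lee_fin ?mulr_ge0 ?powR_ge0// EFinM.
  rewrite ge0_integralZl_EFin; last 4 first.
  - exact: mO.
  - by move=> x _; rewrite lee_fin powR_ge0.
  - exact: Lmeasurable_powR.
  - exact: powR_ge0.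
  have : (Lp_integral Omega p G < +oo)%E by rewrite -Lp_norm_pow// poweR_lty.
  by move=> ?; rewrite lte_mul_pinfty// lee_fin powR_ge0.
have [|||||_ _ +] := @dominated_convergence _ _ _ mu (Omega : set space) mO
  (fun k x => (`|(f (psi k x) - f (u x)) * G x| `^ p)%:E) (cst 0%E) dom.
- by move=> k; exact: Lmeasurable_powR.
- exact: measurable_cst.
- apply: filterS aepsi => x /[apply] px.
  have fpx : f (psi k x) @[k --> \oo] --> f (u x).
    by apply: (@cvg_comp _ _ _ (fun k => psi k x) f _ _ _ px); exact: cf.
  have H : (f (psi k x) - f (u x)) * G x @[k --> \oo] --> (f (u x) - f (u x)) * G x.
    apply: cvgM; last exact: cvg_cst.
    by apply: cvgB; [exact: fpx|exact: cvg_cst].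
  rewrite subrr mul0r in H.
  have H2 := @cvg_comp _ _ _ (fun k => (f (psi k x) - f (u x)) * G x)
    (fun t : R => `|t| `^ p) _ _ _ H (@normr_powR_continuous R p (ltW p0) 0).
  rewrite normr0 powR0 ?gt_eqF// in H2.
  by apply: cvg_EFin; [exact: nearW|exact: H2].
- exact: idom.
- apply: aeW => x k Ox; rewrite gee0_abs ?lee_fin ?powR_ge0// /dom.
  rewrite -powRM ?mulr_ge0// ge0_ler_powR ?nnegrE ?mulr_ge0 ?(ltW p0)//.
  rewrite normrM ler_wpM2r// (le_trans (ler_normB _ _))//.
  by rewrite mulr_natl mulr2n lerD.
- by rewrite integral0.
Qed.

End chain_rule.

Lemma le_norm_between (R : realDomainType) (t x : R) :
  Num.min 0 x <= t <= Num.max 0 x -> `|t| <= `|x|.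
Proof.
by case: (ltP 0 x) => [x0|x0] /andP[t0 t1];
  [rewrite !ger0_norm// ltW|rewrite !ler0_norm// lerN2].
Qed.

Section W0_composition.
Variables (R : realType) (N d : nat) (X : 'I_d -> 'rV[R]_N -> 'rV[R]_N) (Q p : R).
Variable Omega : set 'rV[R]_N.
Hypothesis sa : standing_assumptions X Q.
Hypothesis p1 : 1 < p.
Hypothesis oO : open Omega.
Hypothesis bO : bounded_set Omega.
Local Notation mu := (lebesgueN R N).
Local Notation space := (lebesgue_space R N).
Local Notation Lm := (Lmeasurable Omega).

Let p0 : 0 < p. Proof. exact: lt_trans p1. Qed.
Let mO := measurable_Omega oO.

(** The approximants are P_k(phi_k) with phi_k test functions converging to u
    and P_k polynomials vanishing at 0 that are close to Phi, together with
    their derivatives, on the range of phi_k.  Their gradients differ from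
    f(u) g by (P_k' - f)(phi_k) X phi_k, small by the choice of P_k, by
    f(phi_k) (X phi_k - g), small because f is bounded, and by
    (f(phi_k) - f(u)) g, small by dominated convergence. *)
Lemma W0_comp u g (f Phi : R -> R) (L : R) : W0 X Omega p u g ->
  continuous f -> (forall s, `|f s| <= L) ->
  Phi 0 = 0 -> (forall s : R, is_derive s 1 Phi (f s)) ->
  W0 X Omega p (fun x => Phi (u x)) (fun x => f (u x) *: g x).
Proof.
move=> [[mu_ ufin] [mg gfin] [phi [tphi phiu phig]]] cf fL Phi0 dPhi.
have L0 : 0 <= L by exact: le_trans (normr_ge0 _) (fL 0).
have cPhi : continuous Phi.
  move=> s; apply: differentiable_continuous; apply/derivable1_diffP.
  by have [] := dPhi s.
have lipPhi s t : `|Phi s - Phi t| <= L * `|s - t|.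
  by apply: (mean_value_bound dPhi) => c _; exact: fL.
have mPhi : Lm (fun x => Phi (u x)) by exact: Lm_comp.
have mfu : Lm (fun x => f (u x)) by exact: Lm_comp.
have mG := Lmeasurable_enorm mg.
have mfg j : Lm (fun x => (f (u x) *: g x) 0 j).
  rewrite (_ : (fun x => _) = (fun x => f (u x) * g x 0 j)).
    by apply: measurable_funM; [exact: mfu|exact: mg].
  by apply/funext => x; rewrite mxE.
split.
- split => //; apply: (@le_lt_trans _ _ (L%:E * Lp_norm Omega p u)%E).
    apply: (le_Lp_norm_scale oO) => // x _.
    by have := lipPhi (u x) 0; rewrite Phi0 !subr0.
  by rewrite lte_mul_pinfty.
- split => //; apply: (@le_lt_trans _ _ (L%:E * Lp_normv Omega p g)%E).
    apply: (le_Lp_norm_scale oO) => //; first exact: Lmeasurable_enorm.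
    move=> x _; rewrite enormZ normrM normr_id ler_wpM2r//.
  by rewrite lte_mul_pinfty.
have mphi n := test_Lmeasurable oO (tphi n).
have [s ks sae] : exists2 s : nat -> nat, (forall k, (k <= s k)%N) &
    {ae mu, forall x, Omega x -> phi (s k) x @[k --> \oo] --> u x}.
  apply: (Lp_cvg_ae mO p0 mphi mu_).
  exact: ((Lp_norm_cvg0P _ (fun n x => phi n x - u x) p0).1 phiu).
pose psi k := phi (s k).
have tpsi k : test_function Omega (psi k) by exact: tphi.
have mpsi k : Lm (psi k) by exact: mphi.
have psiu : (fun k => Lp_norm Omega p (fun x => psi k x - u x)) @ \oo --> 0%E.
  exact: cvg_subseq ks phiu.
have psig : (fun k => Lp_normv Omega p (fun x => Xgrad X (psi k) x - g x)) @ \oo --> 0%E.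
  exact: cvg_subseq ks phig.
have approx k : exists P : {poly R}, [/\ P.[0] = 0,
    forall x, `|P.[psi k x] - Phi (psi k x)| <= k.+1%:R^-1 &
    forall x, `|P^`().[psi k x] - f (psi k x)| * enorm (Xgrad X (psi k) x) <= k.+1%:R^-1].
  have [M M0 psiM] := test_function_bounded (tpsi k).
  have [G G0 psiG] := Xgrad_bounded sa (tpsi k).
  (* Dividing by the bounds of phi_k and of its X-gradient makes the errors on
     P_k and on the gradient both at most 1 / (k + 1). *)
  have MG0 : 0 < (M + 1) * (G + 1) by rewrite mulr_gt0 ?ltr_wpDl.
  have e0 : 0 < k.+1%:R^-1 / ((M + 1) * (G + 1)) by rewrite divr_gt0.
  have [q qf] := weierstrass cf (ltr_wpDl M0 ltr01) e0.
  have [P Pq P0] := poly_antiderivative q.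
  set e := _ / _ in e0 qf.
  have eE : e * ((M + 1) * (G + 1)) = k.+1%:R^-1 by rewrite /e divfK// gt_eqF.
  exists P; split => // x.
    have dP : forall t : R, is_derive t 1 (fun t => P.[t] - Phi t) (q.[t] - f t).
      move=> t; have HP : is_derive t 1 (horner P) q.[t].
        by split; [exact: derivable_horner|rewrite -derive1E -derivE Pq].
      exact: (is_deriveB HP (dPhi t)).
    have := mean_value_bound (a := 0) (b := psi k x) (M := e) dP.
    rewrite P0 Phi0 !subr0 => H; apply: (le_trans (H _)).
      move=> t tx; apply: qf; rewrite (@le_trans _ _ `|psi k x|)//.
        exact: le_norm_between.
      by rewrite (le_trans (psiM x))// lerDl.
    rewrite -eE ler_wpM2l ?(ltW e0)// (le_trans (psiM x))//.
    by nra.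
  rewrite Pq -eE; apply: ler_pM => //; first exact: enorm_ge0.
    by apply: qf; rewrite (le_trans (psiM x))// lerDl.
  by rewrite (le_trans (psiG x))//; nra.
have [P PP] := choice approx.
exists (fun k x => (P k).[psi k x]).
have [K K0 cK] := Lp_norm_cst p1 oO bO.
have harm : (fun k => (k.+1%:R^-1 * K)%:E) @ \oo --> (0%E : \bar R).
  apply: cvg_EFin; first exact: nearW.
  rewrite -[X in _ --> X](mul0r K); apply: cvgM; last exact: cvg_cst.
  exact: cvg_harmonic.
have k0 k : 0 <= k.+1%:R^-1 :> R by rewrite invr_ge0.
have mP k : Lm (fun x => (P k).[psi k x]).
  by apply: Lm_comp => //; exact: continuous_horner.
split.
- by move=> k; apply: test_function_horner => //; have [] := PP k.
- apply: (@ereal_cvg0_leD _ _ (fun k => (k.+1%:R^-1 * K)%:E)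
    (fun k => L%:E * Lp_norm Omega p (fun x => (psi k x - u x)%R))%E).
  + by move=> k; exact: Lp_norm_ge0.
  + by move=> k; rewrite lee_fin mulr_ge0.
  + by move=> k; rewrite mule_ge0// Lp_norm_ge0.
  + move=> k.
    have -> : (fun x => (P k).[psi k x] - Phi (u x)) =
        (fun x => ((P k).[psi k x] - Phi (psi k x)) + (Phi (psi k x) - Phi (u x))).
      by apply/funext => x; rewrite addrA subrK.
    have mPhik : Lm (fun x => Phi (psi k x)) by exact: Lm_comp.
    have m1 := LmeasurableB (mP k) mPhik; have m2 := LmeasurableB mPhik mPhi.
    apply: (le_trans (Lp_normD oO (ltW p1) m1 m2)); apply: leeD.
      apply: le_trans (cK _ (k0 k)); apply: (le_Lp_norm oO) => //; first exact: measurable_cst.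
      by move=> x _; rewrite [leRHS]ger0_norm//; have [] := PP k.
    by apply: (le_Lp_norm_scale oO) => //; exact: LmeasurableB.
  + exact: harm.
  + apply: (@ereal_cvg0_leZ _ _ _ L L0) psiu => //.
    by move=> k; rewrite mule_ge0// Lp_norm_ge0.
    by move=> k; rewrite Lp_norm_ge0.
- pose err k x := enorm (Xgrad X (psi k) x - g x).
  pose mix k x := (f (psi k x) - f (u x)) * enorm (g x).
  have mXpsi k := Xgrad_Lmeasurable oO (sa_lipschitz sa) (tpsi k).
  have merr k : Lm (err k).
    apply: Lmeasurable_enorm => j.
    rewrite (_ : (fun x => _) = (fun x => Xgrad X (psi k) x 0 j - g x 0 j)).
      by apply: measurable_funB; [exact: mXpsi|exact: mg].
    by apply/funext => x; rewrite !mxE.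
  have mmix k : Lm (mix k).
    apply: measurable_funM; last exact: mG.
    by apply: measurable_funB; [exact: Lm_comp|exact: mfu].
  have tP k : test_function Omega (fun x => (P k).[psi k x]).
    by apply: test_function_horner => //; have [] := PP k.
  have mXP k : Lm (fun x =>
      enorm (Xgrad X (fun y => (P k).[psi k y]) x - f (u x) *: g x)).
    apply: Lmeasurable_enorm => j.
    rewrite (_ : (fun x => _) =
        (fun x => Xgrad X (fun y => (P k).[psi k y]) x 0 j - (f (u x) *: g x) 0 j)).
      apply: measurable_funB; last exact: mfg.
      exact: (Xgrad_Lmeasurable oO (sa_lipschitz sa) (tP k)).
    by apply/funext => x; rewrite !mxE.
  have mixcvg : (fun k => Lp_norm Omega p (mix k)) @ \oo --> 0%E.
    exact: (Lp_dominated p1 oO cf fL mpsi mu_ mG gfin sae).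
  have errcvg : (fun k => L%:E * Lp_norm Omega p (err k))%E @ \oo --> 0%E.
    apply: (@ereal_cvg0_leZ _ _ _ L L0) psig => k //.
      by rewrite mule_ge0// Lp_norm_ge0.
    exact: Lp_norm_ge0.
  have tailcvg : (fun k => L%:E * Lp_norm Omega p (err k) + Lp_norm Omega p (mix k))%E
      @ \oo --> 0%E.
    apply: (ereal_cvg0_leD _ _ _ _ errcvg mixcvg) => k //.
    + by rewrite adde_ge0 ?mule_ge0 ?Lp_norm_ge0.
    + by rewrite mule_ge0 ?Lp_norm_ge0.
    + exact: Lp_norm_ge0.
  apply: (ereal_cvg0_leD _ _ _ _ harm tailcvg) => k.
  + exact: Lp_norm_ge0.
  + by rewrite lee_fin mulr_ge0.
  + by rewrite adde_ge0 ?mule_ge0 ?Lp_norm_ge0.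
  have mLerr : Lm (fun x => L * err k x).
    by apply: measurable_funM; [exact: measurable_cst|exact: merr].
  have mabs : Lm (fun x => `|mix k x|).
    by apply: measurableT_comp; [exact: normr_measurable|exact: mmix].
  have mtail : Lm (fun x => L * err k x + `|mix k x|).
    by apply: measurable_funD; [exact: mLerr|exact: mabs].
  have mc : Lm (fun=> k.+1%:R^-1) by exact: measurable_cst.
  apply: (@le_trans _ _ (Lp_norm Omega p
      (fun x => k.+1%:R^-1 + (L * err k x + `|mix k x|)))).
    apply: (le_Lp_norm oO p0).
    * exact: mXP.
    * by apply: measurable_funD; [exact: mc|exact: mtail].
    move=> x _; rewrite ger0_norm ?enorm_ge0// [leRHS]ger0_norm; last first.
      apply: addr_ge0; first exact: k0.
      by apply: addr_ge0; [rewrite mulr_ge0 ?enorm_ge0|].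
    have [spsi _ _] := tpsi k.
    rewrite Xgrad_horner//.
    have -> : (P k)^`().[psi k x] *: Xgrad X (psi k) x - f (u x) *: g x =
        ((P k)^`().[psi k x] - f (psi k x)) *: Xgrad X (psi k) x +
        (f (psi k x) *: (Xgrad X (psi k) x - g x) +
         (f (psi k x) - f (u x)) *: g x).
      by rewrite !scalerBl scalerBr !addrA !subrK.
    apply: (le_trans (enormD _ _)); apply: lerD.
      by rewrite enormZ; have [_ _] := PP k.
    apply: (le_trans (enormD _ _)); apply: lerD.
      by rewrite enormZ ler_wpM2r ?enorm_ge0.
    by rewrite enormZ normrM [`|enorm _|]ger0_norm ?enorm_ge0.
  apply: (le_trans (Lp_normD oO (ltW p1) mc mtail)); apply: leeD.
    exact: cK.
  apply: (le_trans (Lp_normD oO (ltW p1) mLerr mabs)); apply: leeD.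
    apply: (le_Lp_norm_scale oO p0 L0 mLerr (merr k)) => x _.
    by rewrite normrM (ger0_norm L0).
  apply: (le_Lp_norm oO p0 mabs (mmix k)) => x _.
  by rewrite normr_id.
Qed.

End W0_composition.

(** * Truncated powers and their primitives *)

Section truncated_powers.
Variable R : realType.
Implicit Types (k r s : R).

Definition trunc_pow k r s : R := Num.min `|s| k `^ r.

Lemma trunc_pow_continuous k r : 0 < k -> 0 <= r -> continuous (trunc_pow k r).
Proof.
move=> k0 r0 s.
rewrite (_ : trunc_pow k r = (fun t => `|t| `^ r) \o (fun s => Num.min `|s| k)).
  apply: continuous_comp; last exact: (normr_powR_continuous r0).
  have cn : `|t| @[t --> s] --> `|s| by exact: norm_continuous.
  by apply: continuous_min; [exact: cn|exact: cvg_cst].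
apply/funext => t /=; rewrite [`|Num.min _ _|]ger0_norm//.
by rewrite le_min normr_ge0 ltW.
Qed.

Lemma trunc_pow_ge0 k r s : 0 <= trunc_pow k r s.
Proof. exact: powR_ge0. Qed.

Lemma trunc_ge0 k s : 0 < k -> 0 <= Num.min `|s| k.
Proof. by move=> k0; rewrite le_min normr_ge0 ltW. Qed.

Lemma trunc_pow_le k r s : 0 < k -> 0 <= r -> trunc_pow k r s <= k `^ r.
Proof.
move=> k0 r0; apply: ge0_ler_powR => //; rewrite ?nnegrE ?trunc_ge0 ?(ltW k0)//.
by rewrite ge_min lexx orbT.
Qed.

Lemma trunc_powM k r1 r2 s : trunc_pow k r1 s `^ r2 = trunc_pow k (r1 * r2) s.
Proof. by rewrite /trunc_pow -powRrM. Qed.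

(** Between s / 2 and s the slope is at least the power of half the
    truncation, and so is the length of that interval. *)
Lemma trunc_pow_primitive k r s (Psi : R -> R) : 0 < k -> 0 <= r -> Psi 0 = 0 ->
  (forall t : R, is_derive t 1 Psi (trunc_pow k r t)) ->
  (Num.min `|s| k / 2) `^ (r + 1) <= `|Psi s|.
Proof.
move=> k0 r0 Psi0 dPsi; set T := Num.min `|s| k.
have T0 : 0 <= T by exact: trunc_ge0.
have Ts : T <= `|s| by rewrite /T ge_min lexx.
have Tk : T <= k by rewrite /T ge_min lexx orbT.
have rE : (T / 2) `^ (r + 1) = (T / 2) `^ r * (T / 2).
  rewrite powRD; last by apply/implyP => /eqP; lra.
  by rewrite powRr1// divr_ge0.
have low c : `|s| / 2 <= `|c| -> (T / 2) `^ r <= trunc_pow k r c.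
  move=> sc; apply: ge0_ler_powR => //; rewrite ?nnegrE ?trunc_ge0 ?divr_ge0//.
  by rewrite le_min; apply/andP; split; lra.
have [c1 c1P E1] := mean_value_between (s / 2) s dPsi.
have [c2 c2P E2] := mean_value_between 0 (s / 2) dPsi.
have sc : `|s| / 2 <= `|c1|.
  move: c1P; have [s0|s0] := leP 0 s.
    rewrite min_l; last lra; rewrite max_r; last lra.
    by move=> /andP[? ?]; rewrite !ger0_norm; lra.
  rewrite min_r; last lra; rewrite max_l; last lra.
  by move=> /andP[? ?]; rewrite !ler0_norm; lra.
have PsiE : Psi s = trunc_pow k r c1 * (s / 2) + trunc_pow k r c2 * (s / 2).
  have -> : trunc_pow k r c1 * (s / 2) = Psi s - Psi (s / 2).
    by rewrite E1; congr (_ * _); lra.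
  have -> : trunc_pow k r c2 * (s / 2) = Psi (s / 2).
    by rewrite -[RHS]subr0 -Psi0 E2 subr0.
  by rewrite subrK.
have g2 := trunc_pow_ge0 k r c2.
have g1 := le_trans (powR_ge0 _ _) (low _ sc).
rewrite PsiE -mulrDl normrM ger0_norm ?addr_ge0// rE.
apply: ler_pM; rewrite ?powR_ge0 ?divr_ge0//.
  by apply: (le_trans (low _ sc)); rewrite lerDl.
by rewrite normrM [`|2^-1|]ger0_norm ?invr_ge0//; lra.
Qed.

End truncated_powers.

(** * Testing the equation *)

Section coercive_integral.
Context d (T : measurableType d) (R : realType) (mu : {measure set T -> \bar R}).
Local Open Scope ereal_scope.
Import HBNNSimple.

Lemma ge0_le_integral_nonmeasurable (D : set T) (f g : T -> \bar R) :
  (forall x, D x -> 0 <= f x) -> (forall x, D x -> f x <= g x) ->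
  \int[mu]_(x in D) f x <= \int[mu]_(x in D) g x.
Proof.
move=> f0 fg; rewrite ge0_integralE// ge0_integralE; last first.
  by move=> x Dx; apply: le_trans (f0 _ Dx) (fg _ Dx).
apply: ge_ereal_sup => _ [h /= hf <-]; apply: ereal_sup_ubound; exists h => // x.
apply: (le_trans (hf x)); rewrite !patchE; case: ifPn => // /set_mem Dx.
exact: fg.
Qed.

Lemma integral_nonmeasurable_ae0 (D : set T) (f : T -> \bar R) : measurable D ->
  (forall x, 0 <= f x) -> {ae mu, forall x, D x -> f x = 0} ->
  \int[mu]_(x in D) f x = 0.
Proof.
move=> mD f0 fae; apply/eqP; rewrite eq_le integral_ge0// andbT.
rewrite ge0_integralE//; apply: ge_ereal_sup => _ [h /= hf <-].
rewrite -integralT_nnsfun.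
rewrite (@ge0_ae_eq_integral _ _ _ mu setT (EFin \o h) (cst 0)) ?integral0//.
- exact/measurable_EFinP.
- by move=> x _; rewrite lee_fin; exact: fun_ge0.
- have aeF := ae_filter_ringOfSetsType mu.
  apply: filterS fae => x fx _ /=; apply/eqP; rewrite eq_le.
  rewrite [(0 <= _)]lee_fin fun_ge0 andbT (le_trans (hf x))// patchE.
  by case: ifPn => // /set_mem /fx ->.
Qed.

(** [A] stands for the integrand a(x, u, Xu) . Xv, which enters only through its
    lower bound and may be nonmeasurable.  Its negative part vanishes almost everywhere, so the
    integral of [A] is a supremum over simple functions, which dominates the
    integral of [w] changed to 0 on a null set. *)
Lemma le_integral_coercive (D : set T) (A B w b : T -> R) : measurable D ->
  measurable_fun D w -> measurable_fun D B -> measurable_fun D b ->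
  (forall x, (0 <= w x)%R) -> (forall x, D x -> (0 <= b x)%R) ->
  {ae mu, forall x, D x -> (w x <= A x)%R} ->
  (forall x, D x -> (B x <= b x)%R) ->
  \int[mu]_(x in D) (A x)%:E = \int[mu]_(x in D) (B x)%:E ->
  \int[mu]_(x in D) (w x)%:E <= \int[mu]_(x in D) (b x)%:E.
Proof.
move=> mD mw mB mb w0 b0 wA Bb AB.
have aeF := ae_filter_ringOfSetsType mu.
apply: (@le_trans _ _ (\int[mu]_(x in D) (A x)%:E)).
  rewrite [leRHS]integralE [X in _ - X]integral_nonmeasurable_ae0 ?sube0//; last first.
    apply: filterS wA => x + Dx => /(_ Dx) wAx.
    by rewrite funenegE -EFinN; apply/max_idPr; rewrite lee_fin lerNl oppr0 (le_trans _ wAx).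
  have [N [mN N0 HN]] := wA.
  pose w' x := ((w \_ (~` N)) x)%:E.
  have mw' : measurable_fun D w'.
    apply/measurable_EFinP; apply/measurable_restrict => //; first exact: measurableC.
    exact: measurable_funS mw.
  have w'0 x : D x -> 0 <= w' x.
    by move=> _; rewrite lee_fin patchE; case: ifP.
  rewrite (@ge0_ae_eq_integral _ _ _ mu D _ w') //; last 3 first.
  - exact/measurable_EFinP.
  - by move=> x _; rewrite lee_fin.
  - exists N; split => // x /=; apply: contra_notP => Nx Dx.
    by rewrite /w' patchE mem_set.
  apply: ge0_le_integral_nonmeasurable => // x Dx.
  rewrite /w' patchE; case: ifPn => [/set_mem Nx|_]; last exact: funepos_ge0.
  apply: (@le_trans _ _ (A x)%:E); last by rewrite funeposE le_max lexx.
  rewrite lee_fin; apply: contrapT => H; apply: Nx; apply: HN => /=.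
  by move=> /(_ Dx).
rewrite AB [leLHS]integralE.
apply: (@le_trans _ _ (\int[mu]_(x in D) ((fun x => (B x)%:E)^\+ x))).
  by rewrite -[leRHS]sube0; apply: leeB => //; apply: integral_ge0 => x _; exact: funeneg_ge0.
apply: ge0_le_integral_nonmeasurable => x Dx; first exact: funepos_ge0.
by rewrite funeposE ge_max !lee_fin Bb// b0.
Qed.

End coercive_integral.

(** For nonnegative exponents the rule extends to x = 0, where x^0 = 1. *)
Lemma powR_addr (R : realType) (x r s : R) : 0 <= r -> 0 <= s ->
  x `^ (r + s) = x `^ r * x `^ s.
Proof.
move=> r0 s0; have [rs|rs] := eqVneq (r + s) 0.
  have [-> ->] : r = 0 /\ s = 0 by split; lra.
  by rewrite addr0 powRr0 mulr1.
by rewrite powRD//; apply/implyP => /eqP h; rewrite h eqxx in rs.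
Qed.

Section truncated_estimates.
Variables (R : realType) (N d : nat) (X : 'I_d -> 'rV[R]_N -> 'rV[R]_N) (Q p : R).
Variables (Omega : set 'rV[R]_N) (theta k : R).
Hypothesis sa : standing_assumptions X Q.
Hypothesis p1 : 1 < p.
Hypothesis theta0 : 0 <= theta.
Hypothesis k0 : 0 < k.
Hypothesis oO : open Omega.
Hypothesis bO : bounded_set Omega.
Variables (u : 'rV[R]_N -> R) (g : 'rV[R]_N -> 'rV[R]_d).
Hypothesis Wu : W0 X Omega p u g.
Local Notation mu := (lebesgueN R N).
Local Notation space := (lebesgue_space R N).
Local Notation Lm := (Lmeasurable Omega).
Local Notation tr r x := (trunc_pow k r (u x)).
Local Notation p' := (p / (p - 1)).

Let p0 : 0 < p. Proof. exact: lt_trans p1. Qed.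
Let p'0 : 0 < p'. Proof. by rewrite divr_gt0// subr_gt0. Qed.
Let tp0 : 0 <= theta * p. Proof. by apply: mulr_ge0; [exact: theta0|exact: ltW]. Qed.
Let mO := measurable_Omega oO.

Let mtr r : 0 <= r -> Lm (fun x => tr r x).
Proof.
move=> r0; apply: Lm_comp; first exact: trunc_pow_continuous.
by have [[]] := Wu.
Qed.

Let mg : Lm (fun x => enorm (g x)).
Proof. by have [_ [mg _] _] := Wu; exact: Lmeasurable_enorm. Qed.

Let mpow r (h : 'rV[R]_N -> R) : Lm h -> Lm (fun x => h x `^ r).
Proof. by move=> mh; apply: (measurableT_comp (measurable_powR r)). Qed.

Definition truncated_energy : \bar R :=
  \int[mu]_(x in Omega) (tr (theta * p) x * enorm (g x) `^ p)%:E.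

Let menergy : Lm (fun x => tr (theta * p) x * enorm (g x) `^ p).
Proof. by apply: measurable_funM; [exact: mtr|exact: mpow]. Qed.

Lemma truncated_energy_fin : truncated_energy \is a fin_num.
Proof.
rewrite ge0_fin_numE; last first.
  by apply: integral_ge0 => x _; rewrite lee_fin mulr_ge0 ?trunc_pow_ge0 ?powR_ge0.
have [_ [_ gfin] _] := Wu.
apply: (@le_lt_trans _ _ ((k `^ (theta * p))%:E * Lp_integral Omega p (fun x => enorm (g x)))%E); last first.
  apply: lte_mul_pinfty; [by rewrite lee_fin powR_ge0|by []|].
  by rewrite -Lp_norm_pow// poweR_lty.
rewrite /Lp_integral -ge0_integralZl_EFin; last 4 first.
- exact: mO.
- by move=> x _; rewrite lee_fin powR_ge0.
- exact: Lmeasurable_powR.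
- exact: powR_ge0.
apply: ge0_le_integral_nonmeasurable => x _.
  by rewrite lee_fin mulr_ge0 ?trunc_pow_ge0 ?powR_ge0.
rewrite -EFinM lee_fin ger0_norm ?enorm_ge0// ler_wpM2r ?powR_ge0//.
exact: trunc_pow_le.
Qed.

(** The test function is a primitive of the truncated power theta p, composed
    with [u].  Its source term |F| T^(theta p) |Xu| is split as
    (|F| T^(theta p / p')) (T^theta |Xu|) for Hoelder's inequality. *)
Lemma energy_estimate (alpha beta : R) (h : 'rV[R]_N -> R)
    (a : 'rV[R]_N -> R -> 'rV[R]_d -> 'rV[R]_d) (F : 'rV[R]_N -> 'rV[R]_d) :
  0 < alpha -> structure_conditions Omega p alpha beta h a ->
  (forall j, Lm (fun x => F x 0 j)) ->
  weak_solution X Omega p a F u g ->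
  (alpha%:E * truncated_energy <=
   (\int[mu]_(x in Omega) (enorm (F x) `^ p' * tr (theta * p) x)%:E) `^ p'^-1 *
   truncated_energy `^ p^-1)%E.
Proof.
move=> alpha0 sc mF [_ weak].
have cf := trunc_pow_continuous k0 tp0.
have [Phi Phi0 dPhi] := continuous_antiderivative cf.
have fL s : `|trunc_pow k (theta * p) s| <= k `^ (theta * p).
  by rewrite ger0_norm ?trunc_pow_ge0// trunc_pow_le.
have Wv := W0_comp sa p1 oO bO Wu cf fL Phi0 dPhi.
have {}weak := weak _ _ Wv.
have [_ [mgj _] _] := Wu.
have mEF := Lmeasurable_enorm mF.
have dotZ v w s : dotv v (s *: w) = s * dotv v w :> R.
  by rewrite dotvC dotvZl dotvC.
have mw : Lm (fun x => alpha * (tr (theta * p) x * enorm (g x) `^ p)).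
  by apply: measurable_funM; [exact: measurable_cst|exact: menergy].
have mB : Lm (fun x => dotv (F x) (tr (theta * p) x *: g x)).
  under eq_fun do rewrite dotZ.
  by apply: measurable_funM; [exact: mtr|exact: Lmeasurable_dotv].
pose b1 x := enorm (F x) * tr (theta * p / p') x.
pose b2 x := tr theta x * enorm (g x).
have tp'0 : 0 <= theta * p / p' by rewrite divr_ge0// ltW.
have mb1 : Lm b1 by apply: measurable_funM; [exact: mEF|exact: mtr].
have mb2 : Lm b2 by apply: measurable_funM; [exact: mtr|exact: mg].
have b10 x : 0 <= b1 x by rewrite mulr_ge0 ?enorm_ge0 ?trunc_pow_ge0.
have b20 x : 0 <= b2 x by rewrite mulr_ge0 ?enorm_ge0 ?trunc_pow_ge0.
have mb : Lm (fun x => b1 x * b2 x).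
  by apply: measurable_funM; [exact: mb1|exact: mb2].
have H : (\int[mu]_(x in Omega) (alpha * (tr (theta * p) x * enorm (g x) `^ p))%:E <=
    \int[mu]_(x in Omega) (b1 x * b2 x)%:E)%E.
  apply: (le_integral_coercive mO mw mB mb _ _ _ _ weak).
  - by move=> x; rewrite !mulr_ge0 ?trunc_pow_ge0 ?powR_ge0 ?(ltW alpha0).
  - by move=> x _; rewrite mulr_ge0.
  - have aeF := ae_filter_ringOfSetsType mu.
    apply: filterS (sc_coercive sc) => x /[apply] /(_ (u x) (g x)) co.
    by rewrite dotZ mulrCA ler_wpM2l ?trunc_pow_ge0.
  - move=> x _; rewrite dotZ.
    have trE : tr (theta * p / p') x * tr theta x = tr (theta * p) x.
      rewrite /trunc_pow -powR_addr//; congr (_ `^ _).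
      by field; rewrite (gt_eqF p0)/= subr_eq0 gt_eqF.
    have -> : b1 x * b2 x = tr (theta * p) x * (enorm (F x) * enorm (g x)).
      by rewrite -trE /b1 /b2; ring.
    by rewrite ler_wpM2l ?trunc_pow_ge0// dotv_le_enorm.
rewrite -ge0_integralZl_EFin; last 4 first.
- exact: mO.
- by move=> x _; rewrite lee_fin mulr_ge0 ?trunc_pow_ge0 ?powR_ge0.
- by apply/measurable_EFinP; exact: menergy.
- exact: ltW.
apply: (le_trans H).
have pp : p'^-1 + p^-1 = 1 by field; rewrite (gt_eqF p0)/= subr_eq0 gt_eqF.
have := hoelder_on (mu : {measure set space -> \bar R}) mO mb1 mb2 p'0 p0 pp.
have -> : (\int[mu]_(x in Omega) `|b1 x * b2 x|%:E =
    \int[mu]_(x in Omega) (b1 x * b2 x)%:E)%E.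
  by apply: eq_integral => x _; rewrite ger0_norm// mulr_ge0.
move=> /le_trans; apply.
rewrite le_eqVlt; apply/orP; left; apply/eqP; congr (_ `^ _ * _ `^ _)%E.
  apply: eq_integral => x _; rewrite ger0_norm// /b1 powRM ?enorm_ge0 ?trunc_pow_ge0//.
  by rewrite trunc_powM divfK ?gt_eqF.
apply: eq_integral => x _; rewrite ger0_norm// /b2 powRM ?enorm_ge0 ?trunc_pow_ge0//.
by rewrite trunc_powM.
Qed.

End truncated_estimates.

(** * Exponents and absorption *)

Section exponents.
Variables (R : realType) (Q p m : R).
Hypothesis pQ : 1 < p < Q.
Hypothesis mP : p / (p - 1) <= m < Q / (p - 1).
Local Notation ps := (sobolev_exponent Q p).
Local Notation q := (sobolev_exponent Q (m * (p - 1))).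

Let p1 : 0 < p - 1. Proof. by rewrite subr_gt0; case/andP: pQ. Qed.
Let p0 : 0 < p. Proof. by move: p1; lra. Qed.
Let Qp : 0 < Q - p. Proof. by rewrite subr_gt0; case/andP: pQ. Qed.
Let Q0 : 0 < Q. Proof. by move: Qp p0; lra. Qed.
Let t_ge : p <= m * (p - 1).
Proof. by case/andP: mP; rewrite ler_pdivrMr. Qed.
Let t_lt : 0 < Q - m * (p - 1).
Proof. by rewrite subr_gt0; case/andP: mP; rewrite ltr_pdivlMr. Qed.
Let t0 : 0 < m * (p - 1). Proof. exact: lt_le_trans t_ge. Qed.

Lemma source_exponent_gt0 : 0 < m.
Proof. by move: t0; rewrite pmulr_lgt0. Qed.
Let m0 := source_exponent_gt0.

Lemma sobolev_exponent_gt0 : 0 < ps.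
Proof. by rewrite divr_gt0// mulr_gt0. Qed.

Lemma solution_exponent_gt0 : 0 < q.
Proof. by rewrite divr_gt0// mulr_gt0. Qed.

(** The reciprocal of the exponent conjugate to m / p'. *)
Definition excess : R := 1 - p / (p - 1) / m.

Lemma excess_ge0 : 0 <= excess.
Proof.
by rewrite subr_ge0 ler_pdivrMr ?mul1r//; case/andP: mP.
Qed.

(** The condition m (p - 1) < Q makes the right-hand side positive: it says that
    the power of Z bounding Z is less than 1. *)
Lemma exponent_balance : ps^-1 - excess / p = q^-1.
Proof.
have p1' : p - 1 != 0 by rewrite gt_eqF.
rewrite /excess /sobolev_exponent; field.
by rewrite p1' (gt_eqF p0) (gt_eqF Q0) (gt_eqF m0) (gt_eqF Qp) (gt_eqF t_lt) ?andbT/=.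
Qed.

(** The theta for which theta p = q (1 - p' / m) and (theta + 1) s = q, with s
    the Sobolev exponent of p. *)
Definition test_exponent : R := q / ps - 1.

Lemma test_exponentM : test_exponent * p = q * excess.
Proof.
have q0 := solution_exponent_gt0; have ps0 := sobolev_exponent_gt0.
have -> : test_exponent = q * (ps^-1 - q^-1).
  by rewrite /test_exponent; field; rewrite (gt_eqF ps0) gt_eqF.
by rewrite -exponent_balance opprB addrCA subrr addr0 -mulrA divfK// gt_eqF.
Qed.

Lemma test_exponent_ge0 : 0 <= test_exponent.
Proof.
rewrite -(pmulr_lge0 _ p0) test_exponentM mulr_ge0 ?excess_ge0//.
exact: ltW solution_exponent_gt0.
Qed.

End exponents.

(** The first bound gives E^(1 / p) <= A^(1 / (p - 1)) Z^(lam / p), so by the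
    second Z^(1 / ps) is at most c A^(1 / (p - 1)) Z^(lam / p); dividing leaves
    Z^(1 / q) on the left. *)
Lemma absorb_powers (R : realType) (p ps q lam E Z A c : R) :
  1 < p -> 0 < ps -> 0 < q -> ps^-1 - lam / p = q^-1 ->
  0 <= E -> 0 <= Z -> 0 <= A -> 0 <= c ->
  E <= A * Z `^ (lam / (p / (p - 1))) * E `^ p^-1 ->
  Z <= (c * E `^ p^-1) `^ ps ->
  Z <= (c * A `^ (1 / (p - 1))) `^ q.
Proof.
move=> p1 ps0 q0 bal E0 Z0 A0 c0 HE HZ.
have p0 : 0 < p by exact: lt_trans p1.
have pm0 : 0 < p - 1 by rewrite subr_gt0.
have [->|Zn0] := eqVneq Z 0; first exact: powR_ge0.
have Zp : 0 < Z by rewrite lt_def Zn0.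
have [Ez|En0] := eqVneq E 0.
  move: HZ; rewrite Ez powR0 ?invr_eq0 ?gt_eqF// mulr0 powR0 ?gt_eqF// => HZ.
  by rewrite (le_trans HZ) ?powR_ge0.
have Ep : 0 < E by rewrite lt_def En0.
have Ep' : 0 < E `^ p^-1 by rewrite powR_gt0.
have E1 : E `^ ((p - 1) / p) <= A * Z `^ (lam / (p / (p - 1))).
  rewrite -(ler_pM2r Ep') -powRD; last by rewrite En0 implybT.
  by rewrite (_ : (p - 1) / p + p^-1 = 1) ?powRr1//; field; rewrite gt_eqF.
have E2 : E `^ p^-1 <= A `^ (1 / (p - 1)) * Z `^ (lam / p).
  have e0 : 0 <= 1 / (p - 1) by rewrite divr_ge0// ltW.
  have := ge0_ler_powR e0 _ _ E1; rewrite !nnegrE powR_ge0 mulr_ge0 ?powR_ge0//.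
  move=> /(_ isT isT); rewrite powRM ?powR_ge0// -!powRrM.
  rewrite (_ : (p - 1) / p * (1 / (p - 1)) = p^-1); last first.
    by field; rewrite (gt_eqF p0) gt_eqF.
  rewrite (_ : lam / (p / (p - 1)) * (1 / (p - 1)) = lam / p)//.
  by field; rewrite (gt_eqF p0) gt_eqF.
have Z1 : Z `^ ps^-1 <= c * E `^ p^-1.
  have e0 : 0 <= ps^-1 by rewrite invr_ge0 ltW.
  have cE0 : 0 <= c * E `^ p^-1 by rewrite mulr_ge0 ?powR_ge0.
  have -> : c * E `^ p^-1 = ((c * E `^ p^-1) `^ ps) `^ ps^-1.
    by rewrite -powRrM mulfV ?gt_eqF// powRr1.
  by apply: ge0_ler_powR HZ; rewrite ?nnegrE ?powR_ge0.
have Zl : 0 < Z `^ (lam / p) by rewrite powR_gt0.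
have Z2 : Z `^ q^-1 <= c * A `^ (1 / (p - 1)).
  rewrite -(ler_pM2r Zl) -powRD; last by rewrite Zn0 implybT.
  rewrite -bal subrK (le_trans Z1)// -mulrA ler_wpM2l//.
have -> : Z = (Z `^ q^-1) `^ q by rewrite -powRrM mulVf ?gt_eqF// powRr1.
apply: ge0_ler_powR Z2; rewrite ?nnegrE ?powR_ge0 ?(ltW q0)//.
by rewrite mulr_ge0 ?powR_ge0.
Qed.

(** * The estimate *)

Section truncated_bound.
Variables (R : realType) (N d : nat) (X : 'I_d -> 'rV[R]_N -> 'rV[R]_N) (Q p m : R).
Variables (Omega : set 'rV[R]_N) (alpha beta : R) (h : 'rV[R]_N -> R).
Variables (a : 'rV[R]_N -> R -> 'rV[R]_d -> 'rV[R]_d) (F : 'rV[R]_N -> 'rV[R]_d).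
Variables (u : 'rV[R]_N -> R) (g : 'rV[R]_N -> 'rV[R]_d).
Hypothesis sa : standing_assumptions X Q.
Hypothesis pQ : 1 < p < Q.
Hypothesis mP : p / (p - 1) <= m < Q / (p - 1).
Hypothesis oO : open Omega.
Hypothesis bO : bounded_set Omega.
Hypothesis alpha0 : 0 < alpha.
Hypothesis sc : structure_conditions Omega p alpha beta h a.
Hypothesis FL : in_Lpv Omega m F.
Hypothesis weak : weak_solution X Omega p a F u g.
Local Notation mu := (lebesgueN R N).
Local Notation space := (lebesgue_space R N).
Local Notation Lm := (Lmeasurable Omega).
Local Notation ps := (sobolev_exponent Q p).
Local Notation q := (sobolev_exponent Q (m * (p - 1))).
Local Notation p' := (p / (p - 1)).
Local Notation lam := (excess p m).
Local Notation theta := (test_exponent Q p m).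

Let p1 : 1 < p. Proof. by case/andP: pQ. Qed.
Let p0 : 0 < p. Proof. exact: lt_trans p1. Qed.
Let p'0 : 0 < p'. Proof. by rewrite divr_gt0// subr_gt0. Qed.
Let m0 := source_exponent_gt0 pQ mP.
Let ps0 := sobolev_exponent_gt0 pQ.
Let q0 := solution_exponent_gt0 pQ mP.
Let lam0 := excess_ge0 pQ mP.
Let theta0 := test_exponent_ge0 pQ mP.
Let thetap := test_exponentM pQ mP.
Let mO := measurable_Omega oO.
Let Wu : W0 X Omega p u g. Proof. by case: weak. Qed.
Let mu_ : Lm u. Proof. by case: Wu => [[]]. Qed.
Let mF : Lm (fun x => enorm (F x)). Proof. by case: FL => mF _; exact: Lmeasurable_enorm. Qed.

Let A := fine (Lp_normv Omega m F).
Let AE : Lp_normv Omega m F = A%:E.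
Proof. by rewrite fineK// ge0_fin_numE ?Lp_norm_ge0//; case: FL. Qed.
Let A0 : 0 <= A. Proof. by rewrite fine_ge0// Lp_norm_ge0. Qed.

Section fixed_level.
Variable k : R.
Hypothesis k0 : 0 < k.
Local Notation tr r x := (trunc_pow k r (u x)).

Let mtr r : 0 <= r -> Lm (fun x => tr r x).
Proof. by move=> r0; apply: Lm_comp => //; exact: trunc_pow_continuous. Qed.

Let Zint : \bar R := \int[mu]_(x in Omega) (tr q x)%:E.

Let Zint_ge0 : (0 <= Zint)%E.
Proof. by apply: integral_ge0 => x _; rewrite lee_fin trunc_pow_ge0. Qed.

Let Z := fine Zint.

Let ZE : Zint = Z%:E.
Proof.
rewrite fineK// ge0_fin_numE//.
apply: (@le_lt_trans _ _ ((k `^ q)%:E * mu Omega)%E).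
  rewrite -(integral_cst mu mO); apply: ge0_le_integral_nonmeasurable => x _.
    by rewrite lee_fin trunc_pow_ge0.
  by rewrite lee_fin trunc_pow_le// ltW.
by rewrite lte_mul_pinfty ?lee_fin ?powR_ge0//; exact: lebesgue_bounded_fin.
Qed.

Let Z0 : 0 <= Z. Proof. by rewrite fine_ge0. Qed.

(** Hoelder's inequality with exponents m / p' and 1 / lam.  For m = p' these
    degenerate, but then lam = 0 and the truncation disappears. *)
Lemma source_estimate :
  (\int[mu]_(x in Omega) (enorm (F x) `^ p' * tr (theta * p) x)%:E <=
   (A `^ p' * Z `^ lam)%:E)%E.
Proof.
have F0 x : 0 <= enorm (F x) by exact: enorm_ge0.
have IF : (\int[mu]_(x in Omega) (enorm (F x) `^ m)%:E = (A `^ m)%:E)%E.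
  rewrite -poweR_EFin -AE (Lp_norm_pow _ _ m0); apply: eq_integral => x _.
  by rewrite ger0_norm.
rewrite thetap; have [lz|lnz] := eqVneq lam 0.
  have pm : p' = m.
    have pm : p' / m = 1 by move: lz; rewrite /excess; lra.
    by apply: (divIf (lt0r_neq0 m0)); rewrite pm divff// gt_eqF.
  rewrite lz mulr0 powRr0 mulr1 pm -IF le_eqVlt; apply/orP; left; apply/eqP.
  by apply: eq_integral => x _; rewrite /trunc_pow powRr0 mulr1.
have lp : 0 < lam by rewrite lt_def lnz.
have r0 : 0 < m / p' by rewrite divr_gt0.
have s0 : 0 < lam^-1 by rewrite invr_gt0.
have rs : (m / p')^-1 + lam^-1^-1 = 1.
  by rewrite invrK invf_div /excess addrC subrK.
have ql0 : 0 <= q * lam by rewrite mulr_ge0// ltW.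
have m1 : Lm (fun x => enorm (F x) `^ p').
  exact: (measurableT_comp (measurable_powR p')).
have := hoelder_on (mu : {measure set space -> \bar R}) mO m1 (mtr ql0) r0 s0 rs.
have -> : (\int[mu]_(x in Omega) `|enorm (F x) `^ p' * tr (q * lam) x|%:E =
    \int[mu]_(x in Omega) (enorm (F x) `^ p' * tr (q * lam) x)%:E)%E.
  by apply: eq_integral => x _; rewrite ger0_norm// mulr_ge0 ?powR_ge0.
move=> /le_trans; apply; rewrite le_eqVlt; apply/orP; left; apply/eqP.
transitivity ((A `^ m)%:E `^ (m / p')^-1 * Z%:E `^ lam^-1^-1)%E.
  congr (_ `^ _ * _ `^ _)%E.
    rewrite -IF; apply: eq_integral => x _.
    by rewrite ger0_norm ?powR_ge0// -powRrM mulrC divfK// gt_eqF.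
  rewrite -ZE; apply: eq_integral => x _.
  by rewrite ger0_norm ?trunc_pow_ge0// trunc_powM mulfK.
rewrite !poweR_EFin invrK -powRrM -EFinM.
have -> : m * (m / p')^-1 = p' by rewrite invf_div mulrC divfK// gt_eqF.
by [].
Qed.

Let En := fine (truncated_energy p Omega theta k u g).
Let EnE : truncated_energy p Omega theta k u g = En%:E.
Proof. by rewrite fineK//; exact: (truncated_energy_fin p1 theta0 k0 oO Wu). Qed.
Let En0 : 0 <= En.
Proof.
rewrite fine_ge0//; apply: integral_ge0 => x _.
by rewrite lee_fin mulr_ge0 ?trunc_pow_ge0 ?powR_ge0.
Qed.

Lemma energy_bound :
  En <= A / alpha * Z `^ (lam / p') * En `^ p^-1.
Proof.
have := energy_estimate sa p1 theta0 k0 oO bO Wu alpha0 sc FL.1 weak.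
rewrite EnE poweR_EFin => H.
have swap (x y z : R) : x / alpha * y * z = x * y * z / alpha by ring.
rewrite swap ler_pdivlMr// mulrC -lee_fin EFinM.
apply: (le_trans H); rewrite [leRHS]EFinM; apply: lee_wpmul2r.
  by rewrite lee_fin powR_ge0.
have -> : A * Z `^ (lam / p') = (A `^ p' * Z `^ lam) `^ p'^-1.
  by rewrite powRM ?powR_ge0// -!powRrM mulfV ?gt_eqF// powRr1.
rewrite -poweR_EFin; apply: le_poweR.
- by rewrite invr_ge0 ltW.
- by apply: integral_ge0 => x _; rewrite lee_fin mulr_ge0 ?trunc_pow_ge0 ?powR_ge0.
- exact: source_estimate.
Qed.

(** The Sobolev inequality for a primitive of the truncated power theta. *)
Lemma sobolev_bound S : sobolev_constant X Omega Q p S ->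
  Z <= (2 `^ (q / ps) * S * En `^ p^-1) `^ ps.
Proof.
move=> [S0 sob].
have cf := trunc_pow_continuous k0 theta0.
have [Psi Psi0 dPsi] := continuous_antiderivative cf.
have fL s : `|trunc_pow k theta s| <= k `^ theta.
  by rewrite ger0_norm ?trunc_pow_ge0// trunc_pow_le.
have Wv := W0_comp sa p1 oO bO Wu cf fL Psi0 dPsi.
have SE0 : 0 <= S * En `^ p^-1 by rewrite mulr_ge0 ?powR_ge0// ltW.
have gE : (Lp_normv Omega p (fun x => tr theta x *: g x) = (En `^ p^-1)%:E)%E.
  rewrite /Lp_normv Lp_normE// -poweR_EFin -EnE; congr (_ `^ _)%E.
  apply: eq_integral => x _; rewrite ger0_norm ?enorm_ge0// enormZ.
  by rewrite powRM ?enorm_ge0// ger0_norm ?trunc_pow_ge0// trunc_powM.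
have := sob _ _ Wv; rewrite gE -EFinM => /(Lp_norm_leP _ _ ps0 SE0) H.
have Tq x : tr q x = 2 `^ q * ((Num.min `|u x| k / 2) `^ (theta + 1)) `^ ps.
  rewrite -powRrM /test_exponent subrK divfK ?gt_eqF// -powRM ?divr_ge0 ?trunc_ge0//.
  by rewrite /trunc_pow; congr (_ `^ _); lra.
have tp0 x : 0 <= ((Num.min `|u x| k / 2) `^ (theta + 1)) `^ ps by exact: powR_ge0.
have q20 : 0 < 2 `^ q :> R by rewrite powR_gt0.
have mtp : Lm (fun x => ((Num.min `|u x| k / 2) `^ (theta + 1)) `^ ps).
  rewrite (_ : (fun x => _) = (fun x => (2 `^ q)^-1 * tr q x)).
    by apply: measurable_funM; [exact: measurable_cst|apply: mtr; exact: ltW].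
  by apply/funext => x; rewrite Tq mulKf// gt_eqF.
rewrite -mulrA powRM ?powR_ge0// -powRrM divfK ?gt_eqF// -lee_fin EFinM -ZE.
have -> : Zint = ((2 `^ q)%:E *
    \int[mu]_(x in Omega) (((Num.min `|u x| k / 2) `^ (theta + 1)) `^ ps)%:E)%E.
  rewrite -ge0_integralZl_EFin; last 4 first.
  - exact: mO.
  - by move=> x _; rewrite lee_fin.
  - exact/measurable_EFinP.
  - exact: ltW.
  by apply: eq_integral => x _; rewrite Tq EFinM.
apply: lee_wpmul2l; first by rewrite lee_fin ltW.
apply: le_trans H; apply: ge0_le_integral_nonmeasurable => x _.
  by rewrite lee_fin.
rewrite lee_fin; apply: ge0_ler_powR; rewrite ?nnegrE ?powR_ge0 ?(ltW ps0)//.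
exact: (trunc_pow_primitive _ k0 theta0 Psi0 dPsi).
Qed.

Lemma truncated_bound S : sobolev_constant X Omega Q p S ->
  (\int[mu]_(x in Omega) (tr q x)%:E <=
   ((2 `^ (q / ps) * S * (A / alpha) `^ (1 / (p - 1))) `^ q)%:E)%E.
Proof.
move=> HS; have [S0 _] := HS.
rewrite -/Zint ZE lee_fin.
apply: (absorb_powers p1 ps0 q0 (exponent_balance pQ mP) En0 Z0 _ _ energy_bound).
- by rewrite divr_ge0// ltW.
- by rewrite mulr_ge0 ?powR_ge0// ltW.
- exact: sobolev_bound.
Qed.

End fixed_level.

Lemma solution_bound S : sobolev_constant X Omega Q p S ->
  (Lp_norm Omega q u <=
   (2 `^ (q / ps) * alpha `^ (- (1 / (p - 1))) * S)%:E *
     Lp_normv Omega m F `^ (1 / (p - 1)))%E.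
Proof.
move=> HS; have [S0 _] := HS.
rewrite AE poweR_EFin -EFinM.
have -> : 2 `^ (q / ps) * alpha `^ (- (1 / (p - 1))) * S * A `^ (1 / (p - 1)) =
    2 `^ (q / ps) * S * (A / alpha) `^ (1 / (p - 1)).
  rewrite powRM ?invr_ge0 ?(ltW alpha0)// -(powR_inv1 (ltW alpha0)) -powRrM mulN1r.
  have swap (x y z w : R) : x * y * z * w = x * z * (w * y) by ring.
  exact: swap.
have c0 : 0 <= 2 `^ (q / ps) * S * (A / alpha) `^ (1 / (p - 1)).
  by rewrite !mulr_ge0 ?powR_ge0// ltW.
apply/(Lp_norm_leP _ _ q0 c0); rewrite /Lp_integral.
apply: (fatou_le mO (f_ := fun n x => trunc_pow n.+1%:R q (u x))).
- move=> n; apply: Lm_comp; last exact: mu_.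
  by apply: trunc_pow_continuous => //; exact: ltW.
- by apply: (measurableT_comp (measurable_powR q)); exact: measurableT_comp.
- by move=> *; exact: powR_ge0.
- by move=> *; exact: powR_ge0.
- apply: aeW => x _.
  apply: cvg_near_cst; near=> n; rewrite /trunc_pow min_l//.
  near: n; exists (Num.bound `|u x|) => // n /= bn.
  apply: ltW; apply: (lt_le_trans (archi_boundP (normr_ge0 _))).
  by rewrite ler_nat; exact: leqW.
- by move=> n; apply: truncated_bound.
Unshelve. all: by end_near. Qed.

End truncated_bound.

Lemma le_scaled_inf (R : realType) (A : set R) (c x : R) : 0 <= c ->
  A !=set0 -> has_lbound A -> (forall s, A s -> x <= c * s) -> x <= c * inf A.
Proof.
move=> c0 A0 lA xA; have [c00|cn0] := eqVneq c 0.
  by have [s /xA] := A0; rewrite c00 !mul0r.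
have cp : 0 < c by rewrite lt_def cn0.
rewrite mulrC -ler_pdivrMr//; apply: lb_le_inf => // s /xA.
by rewrite ler_pdivrMr// mulrC.
Qed.

Theorem theorem4p9 (R : realType) (Q p alpha m : R)
    (HQ : 2 < Q) (Hp : 1 < p < Q) (Halpha : 0 < alpha)
    (Hm : p / (p - 1) <= m < Q / (p - 1)) :
  (* [K] makes precise that C depends on Omega and X only through the constant
     in the Sobolev inequality *)
  exists K : R -> R,
  forall (N d : nat) (Omega : set 'rV[R]_N) (X : 'I_d -> 'rV[R]_N -> 'rV[R]_N),
    (2 <= N)%N -> (2 <= d)%N -> open Omega -> bounded_set Omega ->
    standing_assumptions X Q ->
  exists C : R,
    (forall S : R, sobolev_constant X Omega Q p S -> C <= K S) /\
    forall (beta : R) (h : 'rV[R]_N -> R)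
        (a : 'rV[R]_N -> R -> 'rV[R]_d -> 'rV[R]_d)
        (F : 'rV[R]_N -> 'rV[R]_d)
        (u : 'rV[R]_N -> R) (Xu : 'rV[R]_N -> 'rV[R]_d),
      0 < beta -> in_Lp Omega (p / (p - 1)) h ->
      structure_conditions Omega p alpha beta h a ->
      in_Lpv Omega m F ->
      weak_solution X Omega p a F u Xu ->
      let q := sobolev_exponent Q (m * (p - 1)) in
      in_Lp Omega q u /\
      (Lp_norm Omega q u <= C%:E * Lp_normv Omega m F `^ (1 / (p - 1)))%E.
Proof.
pose c := 2 `^ (sobolev_exponent Q (m * (p - 1)) / sobolev_exponent Q p) *
  alpha `^ (- (1 / (p - 1))).
have c0 : 0 <= c by rewrite mulr_ge0 ?powR_ge0.
exists (fun S => c * S) => N d Omega X N2 _ oO bO sa.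
have N0 : (0 < N)%N by exact: ltn_trans N2.
pose Ss := [set S | sobolev_constant X Omega Q p S].
have Ss0 : Ss !=set0 by have [S] := sobolev_W0 N0 sa Hp oO bO; exists S.
have lSs : has_lbound Ss by exists 0 => S [/ltW].
(* Any two Sobolev constants give a bound, so C is built from their infimum. *)
exists (c * inf Ss); split.
  by move=> S HS; rewrite ler_wpM2l// ge_inf.
move=> beta h a F u g _ _ sc FL weak q.
have bound S (HS : Ss S) := solution_bound sa Hp Hm oO bO Halpha sc FL weak HS.
have [[[mu_ _] _ _] _] := weak.
have Ffin : (Lp_normv Omega m F `^ (1 / (p - 1)) < +oo)%E.
  by apply: poweR_lty; case: FL.
have F0 : (0 <= Lp_normv Omega m F `^ (1 / (p - 1)))%E by exact: poweR_ge0.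
have FE : (Lp_normv Omega m F `^ (1 / (p - 1)))%E \is a fin_num.
  by rewrite ge0_fin_numE.
move: FE F0 bound; set B := (_ `^ _)%E => FE F0 bound.
have ufin : (Lp_norm Omega q u < +oo)%E.
  have [S HS] := Ss0; apply: (le_lt_trans (bound _ HS)).
  by rewrite -(fineK FE) -EFinM ltry.
split; first by split.
have uE : Lp_norm Omega q u \is a fin_num by rewrite ge0_fin_numE// Lp_norm_ge0.
rewrite -(fineK uE) -(fineK FE) -EFinM lee_fin mulrAC.
apply: le_scaled_inf => // [|S HS]; first by rewrite mulr_ge0// fine_ge0.
by rewrite mulrAC -lee_fin EFinM !fineK//; exact: bound.
Qed.
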